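(* Let $m\ge2$, let $V$ be a vector space with basis $x_1,\ldots,x_n$, let $\mathsf{w}\in V^{\otimes(m+1)}$ be a $Q$-twisted superpotential with $Q=\mathrm{diag}(q_1,\ldots,q_n)$ with respect to this basis, and suppose $A(\mathsf{w})=TV/(\partial_1\mathsf{w},\ldots,\partial_n\mathsf{w})$ is an $m$-Koszul $3$-dimensional Artin-Schelter regular algebra. Let $\mathsf{p}=(p_1,\ldots,p_n)$ be non-zero scalars with $p_1=q_1$, and suppose that $D(\mathsf{w},\mathsf{p})$, the algebra $TV$ modulo the relations $\partial_i\mathsf{w}=0$ and $x_i(\partial_1\mathsf{w})-p_i(\partial_1\mathsf{w})x_i=0$ for $i=2,\ldots,n$, is a $4$-dimensional Artin-Schelter regular algebra. Then the Nakayama automorphism $\nu_D$ of $D=D(\mathsf{w},\mathsf{p})$ satisfies $\nu_D(x_i)=(p_iq_i)^{-1}x_i$ for all $i$.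
   Context: Fix a field $\Bbbk$. $TV$ is the tensor algebra with $V$ in degree $1$. For $Q\in\mathrm{GL}(V)$, $\mathsf{w}\in V^{\otimes\ell}$ is a $Q$-twisted superpotential if it is invariant under $v_1\otimes\cdots\otimes v_\ell\mapsto(Q^{-1}v_\ell)\otimes v_1\otimes\cdots\otimes v_{\ell-1}$. The partial derivative $\partial_i\colon TV\to TV$ is the linear map with $\partial_i(x_i\mathsf{v})=\mathsf{v}$ and $\partial_i(\mathsf{u})=0$ for words $\mathsf{u}$ not beginning with $x_i$. A connected graded algebra $A$ is Artin-Schelter regular of dimension $d$ if it has finite global dimension $d$, left self-injective dimension $d$, and $\mathrm{Ext}^i_A(\Bbbk,A)\cong\Bbbk(\ell)$ for $i=d$ and $0$ for $i\ne d$, some $\ell\in\mathbb{Z}$. $A$ is $m$-Koszul if it is finitely presented with relations homogeneous of degree $m$ and $\mathrm{Ext}^i_A(\Bbbk,\Bbbk)$ is concentrated in internal degree $n(i)$ (up to sign convention), where $n(2j)=jm$, $n(2j+1)=jm+1$. Nakayama automorphism: with $A^e=A\otimes A^\circ$, bimodules being left $A^e$-modules via $(a\otimes b)\cdot x=axb$ and right $A^e$-modules via $x\cdot(a\otimes b)=bxa$, a connected graded Artin-Schelter regular algebra of dimension $d$ satisfies $\mathrm{Ext}^d_{A^e}(A,A^e)\cong{}_\nu A_1(\ell)$ as graded right $A^e$-modules for a unique graded algebra automorphism $\nu=\nu_A$, where ${}_\nu A_1$ is $A$ with bimodule action $a\cdot c\cdot b=\nu(a)cb$; $\nu_A$ is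 the Nakayama automorphism. *)

(* Defs.v *)
(* Algebras and modules that are only determined up to isomorphism (quotients
   of a tensor algebra, the enveloping algebra, the trivial module) are given by
   their characterization up to isomorphism.  Homological notions are for left
   modules; all gradings are by int. *)
From mathcomp Require Import all_boot all_order all_algebra.
From mathcomp Require Import finmap.
From mathcomp.multinomials Require Import monalg.

Set Implicit Arguments.
Unset Strict Implicit.
Unset Printing Implicit Defensive.

Import GRing.Theory.
Local Open Scope ring_scope.

(* V = k^n with basis x_0, ..., x_(n-1); words in the x_i are a basis of TV. *)
Notation tensor_alg k n := {malg k[{fmonom 'I_n}]}.

Section TensorAlgebra.
Variables (k : fieldType) (n : nat).
Local Notation TV := (tensor_alg k n).
Implicit Types (f w : TV) (u : {fmonom 'I_n}).

Definition word (s : seq 'I_n) : TV := << FMonom s >>.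
Definition gen (i : 'I_n) : TV := word [:: i].

Definition tensor_grade (j : int) f : Prop :=
  forall u, u \in msupp f -> (fdeg u)%:Z = j.

Definition word_linear (F : seq 'I_n -> TV) f : TV :=
  \sum_(u <- msupp f) f@_u *: F u.

Definition partial (i : 'I_n) : TV -> TV :=
  word_linear (fun s => if s is j :: v then (if j == i then word v else 0) else 0).

(* v_1 ... v_l |-> (Q^-1 v_l) v_1 ... v_(l-1), where Q x_i = \sum_j Q j i x_j
   and the words are split at their last letter by reversing them. *)
Definition twisted_rotation (Q : 'M[k]_n) : TV -> TV :=
  word_linear (fun s => if rev s is i :: v
                        then \sum_j invmx Q j i *: word (j :: rev v) else 1).

Definition twisted_superpotential (Q : 'M[k]_n) (l : nat) w : Prop :=
  [/\ Q \in unitmx, tensor_grade l w & twisted_rotation Q w = w].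

Definition in_ideal (S : TV -> Prop) f : Prop :=
  exists (N : nat) (a r b : 'I_N -> TV),
    (forall l, S (r l)) /\ f = \sum_l a l * r l * b l.

(* pi identifies A with TV / (S). *)
Definition presents (A : algType k) (pi : {lrmorphism TV -> A})
    (S : TV -> Prop) : Prop :=
  (forall a, exists f, pi f = a) /\ (forall f, pi f = 0 <-> in_ideal S f).

Definition quotient_grade (A : algType k) (pi : {lrmorphism TV -> A})
    (j : int) (a : A) : Prop :=
  exists2 f, tensor_grade j f & pi f = a.

End TensorAlgebra.

Definition rel_A (k : fieldType) (n : nat) (w : tensor_alg k n)
    (r : tensor_alg k n) : Prop :=
  exists i, r = partial i w.

(* ord0 plays the part of the index 1: both families of relations of D are
   indexed by the i different from it. *)
Definition rel_D (k : fieldType) (n : nat) (w : tensor_alg k n.+1)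
    (p : 'I_n.+1 -> k) (r : tensor_alg k n.+1) : Prop :=
  exists2 i, i != ord0 &
    r = partial i w \/
    r = gen k i * partial ord0 w - p i *: (partial ord0 w * gen k i).

Definition is_grading (V : zmodType) (G : int -> V -> Prop) : Prop :=
  [/\ forall j, G j 0,
      forall j x y, G j x -> G j y -> G j (x - y),
      forall x, exists (s : seq int) (c : int -> V),
        (forall j, G j (c j)) /\ x = \sum_(j <- s) c j
    & forall (s : seq int) (c : int -> V), uniq s -> (forall j, G j (c j)) ->
        \sum_(j <- s) c j = 0 -> forall j, j \in s -> c j = 0].

Definition graded_ring (R : nzRingType) (G : int -> R -> Prop) : Prop :=
  [/\ is_grading G, G 0 1
    & forall i j a b, G i a -> G j b -> G (i + j) (a * b)].

Definition graded_module (R : nzRingType) (G : int -> R -> Prop)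
    (M : lmodType R) (GM : int -> M -> Prop) : Prop :=
  is_grading GM /\
  forall i j a x, G i a -> GM j x -> GM (i + j) (a *: x).

Definition connected_graded (k : fieldType) (A : algType k)
    (G : int -> A -> Prop) : Prop :=
  [/\ graded_ring G, forall j a, j < 0 -> G j a -> a = 0
    & forall a, G 0 a <-> exists c : k, a = c%:A].

Definition projective (R : nzRingType) (P : lmodType R) : Prop :=
  forall (X Y : lmodType R) (g : {linear X -> Y}) (f : {linear P -> Y}),
    (forall y, exists x, g x = y) ->
    exists h : {linear P -> X}, forall z, g (h z) = f z.

Definition injective_module (R : nzRingType) (I : lmodType R) : Prop :=
  forall (X Y : lmodType R) (g : {linear X -> Y}) (f : {linear X -> I}),
    injective g -> exists h : {linear Y -> I}, forall x, h (g x) = f x.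

Record proj_resolution (R : nzRingType) (M : lmodType R) := ProjResolution {
  pr_mod :> nat -> lmodType R;
  pr_diff : forall i, {linear pr_mod i.+1 -> pr_mod i};
  pr_aug : {linear pr_mod 0%N -> M};
  pr_proj : forall i, projective (pr_mod i);
  pr_surj : forall x, exists y, pr_aug y = x;
  pr_exact0 : forall y, pr_aug y = 0 <-> exists z, pr_diff 0 z = y;
  pr_exactS : forall i y, pr_diff i y = 0 <-> exists z, pr_diff i.+1 z = y
}.

Record inj_resolution (R : nzRingType) (M : lmodType R) := InjResolution {
  ir_mod :> nat -> lmodType R;
  ir_diff : forall i, {linear ir_mod i -> ir_mod i.+1};
  ir_aug : {linear M -> ir_mod 0%N};
  ir_inj : forall i, injective_module (ir_mod i);
  ir_injective : injective ir_aug;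
  ir_exact0 : forall y, ir_diff 0 y = 0 <-> exists x, ir_aug x = y;
  ir_exactS : forall i y, ir_diff i.+1 y = 0 <-> exists z, ir_diff i z = y
}.

Definition pd_le (R : nzRingType) (M : lmodType R) (d : nat) : Prop :=
  exists P : proj_resolution M, forall i, (d < i)%N -> forall x : P i, x = 0.

Definition id_le (R : nzRingType) (M : lmodType R) (d : nat) : Prop :=
  exists I : inj_resolution M, forall i, (d < i)%N -> forall x : I i, x = 0.

Definition global_dimension (R : nzRingType) (d : nat) : Prop :=
  (forall M : lmodType R, pd_le M d) /\
  (forall d', (forall M : lmodType R, pd_le M d') -> (d <= d')%N).

Definition injective_dimension (R : nzRingType) (M : lmodType R) (d : nat) :
    Prop :=
  id_le M d /\ (forall d', id_le M d' -> (d <= d')%N).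

Definition graded_resolution (R : nzRingType) (G : int -> R -> Prop)
    (M : lmodType R) (GM : int -> M -> Prop)
    (P : proj_resolution M) (GP : forall i, int -> P i -> Prop) : Prop :=
  [/\ forall i, graded_module G (GP i),
      forall j x, GP 0%N j x -> GM j (pr_aug P x)
    & forall i j x, GP i.+1 j x -> GP i j (pr_diff P i x)].

Section Ext.
Variables (R : nzRingType) (M : lmodType R).
Variables (P : proj_resolution M) (GP : forall i, int -> P i -> Prop).
Variables (N : lmodType R) (GN : int -> N -> Prop).

(* Homogeneous of degree j: a degree-preserving map P_i -> N(j). *)
Definition hom_deg (i : nat) (j : int) (f : P i -> N) : Prop :=
  linear f /\ forall l x, GP l x -> GN (l + j) (f x).

(* The graded Hom, i.e. the direct sum of the spaces of homogeneous maps. *)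
Definition graded_hom (i : nat) (f : P i -> N) : Prop :=
  exists (s : seq int) (c : int -> P i -> N),
    (forall j, hom_deg j (c j)) /\ forall x, f x = \sum_(j <- s) c j x.

Definition cocycle (i : nat) (f : P i -> N) : Prop :=
  graded_hom f /\ forall x, f (pr_diff P i x) = 0.

Definition coboundary (i : nat) : (P i -> N) -> Prop :=
  match i with
  | 0%N => fun f => forall x, f x = 0
  | i'.+1 => fun f =>
      exists2 g : P i' -> N, graded_hom g & forall x, f x = g (pr_diff P i' x)
  end.

Definition ext_vanishes (i : nat) : Prop :=
  forall f : P i -> N, cocycle f -> coboundary f.

Definition ext_concentrated (i : nat) (j0 : int) : Prop :=
  forall j (f : P i -> N), j != j0 -> cocycle f -> hom_deg j f -> coboundary f.

(* phi induces an isomorphism of graded abelian groups from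
   Ext^i(M, N) = cocycles / coboundaries onto (X, GX). *)
Definition ext_iso (X : zmodType) (GX : int -> X -> Prop) (i : nat)
    (phi : (P i -> N) -> X) : Prop :=
  [/\ forall f g, cocycle f -> cocycle g -> phi (f \+ g) = phi f + phi g,
      forall f, cocycle f -> (phi f = 0 <-> coboundary f),
      forall x, exists2 f, cocycle f & phi f = x
    & forall j f, cocycle f -> hom_deg j f -> GX j (phi f)].

End Ext.

Section Regularity.
Variables (k : fieldType) (A : algType k) (G : int -> A -> Prop).

(* The left module k, concentrated in degree 0, with generator e. *)
Definition trivial_module (K : lmodType A) (e : K) : Prop :=
  [/\ e != 0, forall x, exists c : k, x = c%:A *: e
    & forall j a, j != 0 -> G j a -> a *: e = 0].

Definition trivial_grade (V : zmodType) (j : int) (x : V) : Prop :=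
  j = 0 \/ x = 0.

(* N = A is the left regular module.  The last two clauses say that phi
   is right A-linear for the trivial right module structure on k(l). *)
Definition ext_trivial_regular_iso (M : lmodType A) (P : proj_resolution M)
    (GP : forall i, int -> P i -> Prop) (d : nat) (l : int) : Prop :=
  exists phi : (P d -> A^o) -> k,
    [/\ ext_iso GP (G : int -> A^o -> Prop)
          (fun j (x : k) => trivial_grade (j + l) x) phi,
        forall f c, cocycle GP (G : int -> A^o -> Prop) f ->
          phi (fun x => (f x : A) * c%:A) = c * phi f
      & forall f j a, cocycle GP (G : int -> A^o -> Prop) f ->
          j != 0 -> G j a -> phi (fun x => (f x : A) * a) = 0].

Definition AS_regular (d : nat) : Prop :=
  [/\ connected_graded G, global_dimension A d,
      injective_dimension (A^o : lmodType A) d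
    & exists (K : lmodType A) (e : K) (P : proj_resolution K)
        (GP : forall i, int -> P i -> Prop),
      [/\ trivial_module e,
          graded_resolution G (@trivial_grade K) GP,
          forall i, i != d -> ext_vanishes GP (G : int -> A^o -> Prop) i
        & exists l, ext_trivial_regular_iso GP d l]].

(* A map P_i -> k of degree j is nonzero only on generators of degree -j, hence
   the sign in the last clause. *)
Definition koszul (m : nat) : Prop :=
  (exists (n : nat) (pi : {lrmorphism tensor_alg k n -> A})
      (s : seq (tensor_alg k n)),
     [/\ presents pi (fun r => r \in s),
         forall r, r \in s -> tensor_grade m r
       & forall j f, tensor_grade j f -> G j (pi f)]) /\
  (exists (K : lmodType A) (e : K) (P : proj_resolution K)
      (GP : forall i, int -> P i -> Prop),
     [/\ trivial_module e,
         graded_resolution G (@trivial_grade K) GP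
       & forall i, ext_concentrated GP (@trivial_grade K) i
                     (- (i./2 * m + odd i)%:Z)]).

End Regularity.

Section Nakayama.
Variables (k : fieldType) (A : algType k) (G : int -> A -> Prop).

Definition bilinear_map (U V W : lmodType k) (f : U -> V -> W) : Prop :=
  (forall v, linear (f^~ v)) /\ (forall u, linear (f u)).

(* E is the algebra A (x) A^op and t a b is a (x) b: t is the universal bilinear
   map out of A x A. *)
Definition enveloping (E : algType k) (t : A -> A -> E) : Prop :=
  [/\ bilinear_map t,
      forall (W : lmodType k) (f : A -> A -> W), bilinear_map f ->
        exists h : {linear E -> W}, (forall a b, h (t a b) = f a b) /\
          forall h' : {linear E -> W}, (forall a b, h' (t a b) = f a b) ->
            h' =1 h,
      t 1 1 = 1
    & forall a b a' b', t a b * t a' b' = t (a * a') (b' * b)].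

Definition enveloping_grade (E : algType k) (t : A -> A -> E) (j : int)
    (z : E) : Prop :=
  exists (N : nat) (r : 'I_N -> int) (a b : 'I_N -> A),
    (forall l, G (r l) (a l) /\ G (j - r l) (b l)) /\
    z = \sum_l t (a l) (b l).

(* theta identifies the left E-module M with the bimodule A. *)
Definition diagonal_bimodule (E : algType k) (t : A -> A -> E)
    (M : lmodType E) (theta : A -> M) : Prop :=
  [/\ bijective theta, {morph theta : x y / x + y}
    & forall a b x, t a b *: theta x = theta (a * x * b)].

(* The isomorphism phi maps Ext^d_E(A, E) onto A with right E-action
   x . (a (x) b) = nu(b) x a and with degrees shifted by l. *)
Definition nakayama_automorphism (d : nat) (nu : {lrmorphism A -> A}) : Prop :=
  [/\ bijective nu, forall j a, G j a -> G j (nu a)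
    & exists (E : algType k) (t : A -> A -> E) (M : lmodType E)
        (theta : A -> M) (P : proj_resolution M)
        (GP : forall i, int -> P i -> Prop)
        (l : int) (phi : (P d -> E^o) -> A),
      let GE : int -> E^o -> Prop := enveloping_grade t in
      [/\ enveloping t, diagonal_bimodule t theta,
          graded_resolution GE
            (fun j y => exists2 x, G j x & theta x = y) GP,
          ext_iso GP GE (fun j x => G (j + l) x) phi
        & forall f a b, cocycle GP GE f ->
            phi (fun x => (f x : E) * t a b) = nu b * phi f * a]].

End Nakayama.

(* Main.v *)
(* Write u_i = d_i w, N_ai = d_a u_i, Om = u_1, and let tau be the automorphism
   x_i |-> p_i x_i of TV.  In D one has u_i = 0 for i <> 1 and x_i Om = p_i Om x_i
   for all i (as p_1 = q_1), so that Om is normal and A = D / Om D.  The vanishing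
   of Ext^0(k, A) and Ext^1(k, A) makes the maps given by the x_i and the N_ai
   exact modulo Om D.  As Ext^4(k, D) = k and Ext^3(k, D) = 0, the relations of D
   have a nontrivial syzygy killed by (x_1, ..., x_n), which forces
   tau(u_i) = (p_1 / p_i) u_i; then Om is a nonzerodivisor.

   Noncommutative Fox derivatives now give an explicit complex of free bimodules
   of length 4 resolving D: by filtering by left degree, its exactness reduces to the
   exactness statements above.  Its last map has the entries
   x_i (x) 1 - p_i q_i 1 (x) x_i and 1 (x) Om - p_1 Om (x) 1.  The image of the
   generator of the last term in Ext^4(D, D (x) D^op) = D is an element y with
   y x_i = p_i q_i nu(x_i) y.  It is homogeneous and generates the Ext group, so
   that y is a nonzero scalar. *)
From HB Require Import structures.
Require Import Defs.
From mathcomp Require Import all_boot all_order all_algebra.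
From mathcomp Require Import finmap.
From mathcomp.multinomials Require Import monalg.
From mathcomp Require Import boolp ring zify.
From mathcomp Require classical_sets.

Set Implicit Arguments.
Unset Strict Implicit.
Unset Printing Implicit Defensive.

Import Order.TTheory GRing.Theory Num.Theory.
Local Open Scope ring_scope.

(** * The tensor algebra through its basis of words *)

(** Normality of Om comes for free; cancelling Om does not. If Om can be cancelled, u_i Om = Om
    tau(u_i) gives tau(u_i) = 0 in D for i <> 1; conversely these identities drive the induction
    that cancels Om. Since each follows from the other, one must come from the homology of D. The
    circle is broken by degrees: below degree m, Om can be cancelled without any knowledge of tau,
    and the bound on the degree of the syzygies, which comes from Ext^3 = 0, keeps every
    cancellation needed in that range.

    The resolutions in the hypotheses are arbitrary graded projective ones, possibly neither free
    nor minimal nor finitely generated, so nothing can be read off from their generators. Every Ext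
    statement is carried along chain maps and homotopies to explicit matrices. Minimality is
    replaced by one element y of P 4 whose boundary lies in the span of the x_i P 3 and on which a
    cocycle takes a nonzero scalar value.

    A fact used twice: w is, up to a scalar, the only element of the form \sum_a u_a y_a, with y_a
    linear, whose left parts are all relations of A. *)

Lemma linear_pred0 (R : nzRingType) (U V : lmodType R) (f : U -> V) :
  linear f -> f 0 = 0.
Proof. by move=> lf; have := lf (-1) 0 0; rewrite scaler0 addr0 scaleN1r addNr. Qed.

(* The tensor algebra, known only through its basis of words: computations in
   the concrete type of finitely supported functions are needlessly slow. *)
Record word_algebra (k : fieldType) (n : nat) := WordAlgebra {
  wa_alg :> algType k;
  wa_word : seq 'I_n -> wa_alg;
  wa_ext : forall V : lmodType k, (seq 'I_n -> V) -> {linear wa_alg -> V};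
  wa_extE : forall (V : lmodType k) (F : seq 'I_n -> V) s,
    wa_ext F (wa_word s) = F s;
  wa_ind : forall P : wa_alg -> Prop, P 0 ->
    (forall c s f, P f -> P (c *: wa_word s + f)) -> forall f, P f;
  wa_cat : forall s t, wa_word (s ++ t) = wa_word s * wa_word t;
  wa_nil : wa_word [::] = 1
}.

Section Words.
Variables (k : fieldType) (n : nat) (T : word_algebra k n).
Implicit Types (f g : T) (s t : seq 'I_n) (i j : 'I_n).

Local Notation W := (@wa_word k n T).
Definition wgen i : T := W [:: i].
Local Notation x := wgen.

Lemma wa_cons i s : W (i :: s) = x i * W s.
Proof. by rewrite -cat1s wa_cat. Qed.

Lemma wa_rcons i s : W (rcons s i) = W s * x i.
Proof. by rewrite -cats1 wa_cat. Qed.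

Lemma eq_on_words (V : lmodType k) (f g : T -> V) :
  linear f -> linear g -> (forall s, f (W s) = g (W s)) -> f =1 g.
Proof.
move=> lf lg eqw; apply: wa_ind => [|c s h IH]; last by rewrite lf lg eqw IH.
by rewrite (linear_pred0 lf) (linear_pred0 lg).
Qed.

Lemma eq_on_words2 (V : lmodType k) (f g : T -> T -> V) :
  (forall h, linear (f^~ h)) -> (forall h, linear (f h)) ->
  (forall h, linear (g^~ h)) -> (forall h, linear (g h)) ->
  (forall s t, f (W s) (W t) = g (W s) (W t)) ->
  forall a b, f a b = g a b.
Proof.
move=> lf1 lf2 lg1 lg2 eqw a b; apply: (@eq_on_words _ (f^~ b) (g^~ b)) => // s.
by apply: (@eq_on_words _ (f (W s)) (g (W s))).
Qed.

Definition aug : T -> k^o := wa_ext T (fun s => (s == [::])%:R : k^o).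
HB.instance Definition _ := GRing.Linear.on aug.

Lemma aug_word s : aug (W s) = (s == [::])%:R.
Proof. by rewrite /aug wa_extE. Qed.

Lemma aug1 : aug 1 = 1.
Proof. by rewrite -wa_nil aug_word eqxx. Qed.

Lemma aug_gen i : aug (x i) = 0.
Proof. by rewrite aug_word. Qed.

Definition lpart i : T -> T := wa_ext T (fun s =>
  if s is j :: v then (if j == i then W v else 0) else 0).
HB.instance Definition _ i := GRing.Linear.on (lpart i).

Definition rpart i : T -> T := wa_ext T (fun s =>
  if rev s is j :: v then (if j == i then W (rev v) else 0) else 0).
HB.instance Definition _ i := GRing.Linear.on (rpart i).

Lemma lpart_cons i j s : lpart i (W (j :: s)) = (j == i)%:R *: W s.
Proof. by rewrite /lpart wa_extE; case: eqP; rewrite ?scale1r ?scale0r. Qed.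

Lemma rpart_rcons i j s : rpart i (W (rcons s j)) = (j == i)%:R *: W s.
Proof.
rewrite /rpart wa_extE rev_rcons revK.
by case: eqP; rewrite ?scale1r ?scale0r.
Qed.

Lemma lpart1 i : lpart i 1 = 0. Proof. by rewrite -wa_nil /lpart wa_extE. Qed.
Lemma rpart1 i : rpart i 1 = 0. Proof. by rewrite -wa_nil /rpart wa_extE. Qed.

Lemma lpart_genM i j f : lpart i (x j * f) = (j == i)%:R *: f.
Proof.
move: f; apply: (@eq_on_words _ (fun f => lpart i (x j * f))) => [c f g|c f g|s].
- by rewrite mulrDr -scalerAr linearP.
- by rewrite scalerDr !scalerA mulrC.
- by rewrite -wa_cons lpart_cons.
Qed.

Lemma rpart_Mgen i j f : rpart i (f * x j) = (j == i)%:R *: f.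
Proof.
move: f; apply: (@eq_on_words _ (fun f => rpart i (f * x j))) => [c f g|c f g|s].
- by rewrite mulrDl -scalerAl linearP.
- by rewrite scalerDr !scalerA mulrC.
- by rewrite -wa_rcons rpart_rcons.
Qed.

Lemma sum_delta (V : lmodType k) i (F : 'I_n -> V) :
  \sum_j (i == j)%:R *: F j = F i.
Proof.
rewrite (bigD1 i) //= eqxx scale1r big1 ?addr0 // => j /negbTE.
by rewrite eq_sym => ->; rewrite scale0r.
Qed.

Lemma lpart_decomp f : f = (aug f)%:A + \sum_i x i * lpart i f.
Proof.
move: f; apply: (@eq_on_words _ idfun) => [//|c f g|s] /=.
  rewrite linearP /= scalerDr scalerDl scalerA.
  under eq_bigr => i _ do rewrite linearP mulrDr -scalerAr.
  by rewrite big_split /= -scaler_sumr addrACA.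
rewrite aug_word; case: s => [|i s].
  rewrite wa_nil scale1r big1 ?addr0 // => i _.
  by rewrite lpart1 mulr0.
rewrite scale0r add0r.
under eq_bigr => j _ do rewrite lpart_cons -scalerAr.
by rewrite (sum_delta i (fun j => x j * W s)) wa_cons.
Qed.

Lemma rpart_decomp f : f = (aug f)%:A + \sum_i rpart i f * x i.
Proof.
move: f; apply: (@eq_on_words _ idfun) => [//|c f g|s] /=.
  rewrite linearP /= scalerDr scalerDl scalerA.
  under eq_bigr => i _ do rewrite linearP mulrDl -scalerAl.
  by rewrite big_split /= -scaler_sumr addrACA.
rewrite aug_word; case: (lastP s) => [|t i].
  rewrite wa_nil scale1r big1 ?addr0 // => i _.
  by rewrite rpart1 mul0r.
rewrite -size_eq0 size_rcons scale0r add0r.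
under eq_bigr => j _ do rewrite rpart_rcons -scalerAl.
by rewrite (sum_delta i (fun j => W t * x j)) wa_rcons.
Qed.

Lemma lpart_sum (F : 'I_n -> T) i : lpart i (\sum_j x j * F j) = F i.
Proof.
rewrite linear_sum /=; under eq_bigr => j _ do rewrite lpart_genM eq_sym.
exact: sum_delta.
Qed.

Lemma rpart_sum (F : 'I_n -> T) i : rpart i (\sum_j F j * x j) = F i.
Proof.
rewrite linear_sum /=; under eq_bigr => j _ do rewrite rpart_Mgen eq_sym.
exact: sum_delta.
Qed.

Lemma lpartM i f g : lpart i (f * g) = lpart i f * g + aug f *: lpart i g.
Proof.
rewrite {1}(lpart_decomp f) mulrDl linearD /= addrC -scalerAl mul1r linearZ /=.
congr (_ + _); rewrite mulr_suml.
under eq_bigr => j _ do rewrite -mulrA.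
exact: (lpart_sum (fun j => lpart j f * g)).
Qed.

Lemma rpartM i f g : rpart i (f * g) = f * rpart i g + aug g *: rpart i f.
Proof.
rewrite {1}(rpart_decomp g) mulrDr linearD /= addrC -scalerAr mulr1 linearZ /=.
congr (_ + _); rewrite mulr_sumr.
under eq_bigr => j _ do rewrite mulrA.
exact: (rpart_sum (fun j => f * rpart j g)).
Qed.

Definition hcomp (d : int) : T -> T :=
  wa_ext T (fun s => if (size s)%:Z == d then W s else 0).
HB.instance Definition _ d := GRing.Linear.on (hcomp d).

Definition hgrade (d : int) f := hcomp d f = f.

Lemma hcomp_word d s : hcomp d (W s) = ((size s)%:Z == d)%:R *: W s.
Proof. by rewrite /hcomp wa_extE; case: eqP; rewrite ?scale1r ?scale0r. Qed.

Lemma hcomp_comp d e f : hcomp d (hcomp e f) = (d == e)%:R *: hcomp d f.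
Proof.
move: f; apply: (@eq_on_words _ (fun f => hcomp d (hcomp e f))) => [c f g|c f g|s].
- by rewrite !linearP.
- by rewrite linearP scalerDr !scalerA mulrC.
- rewrite !hcomp_word linearZ /= hcomp_word !scalerA; congr (_ *: _).
  by case: (altP ((size s)%:Z =P d)) => [->|_]; rewrite ?mulr0 ?mulr1 ?mul0r ?mul1r.
Qed.

Lemma hcomp_grade d e f : hgrade e f -> hcomp d f = (d == e)%:R *: f.
Proof. by move=> hf; rewrite -{1}hf hcomp_comp; case: eqP => [->|_]; rewrite ?scale0r // hf. Qed.

Lemma hgrade_linear d c f g : hgrade d f -> hgrade d g -> hgrade d (c *: f + g).
Proof. by rewrite /hgrade linearP /= => -> ->. Qed.

Lemma hgrade0 d : hgrade d 0. Proof. exact: linear0. Qed.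
Lemma hgradeD d f g : hgrade d f -> hgrade d g -> hgrade d (f + g).
Proof. by rewrite /hgrade linearD /= => -> ->. Qed.
Lemma hgradeB d f g : hgrade d f -> hgrade d g -> hgrade d (f - g).
Proof. by rewrite /hgrade linearB /= => -> ->. Qed.
Lemma hgradeZ d c f : hgrade d f -> hgrade d (c *: f).
Proof. by rewrite /hgrade linearZ /= => ->. Qed.
Lemma hgrade_sum d (I : Type) (r : seq I) (P : pred I) (F : I -> T) :
  (forall a, P a -> hgrade d (F a)) -> hgrade d (\sum_(a <- r | P a) F a).
Proof. by move=> h; apply: big_ind => //; [exact: hgrade0 | exact: hgradeD]. Qed.

Lemma hgrade_word s : hgrade (size s) (W s).
Proof. by rewrite /hgrade hcomp_word eqxx scale1r. Qed.

Lemma hgrade_gen i : hgrade 1 (x i). Proof. exact: hgrade_word. Qed.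

Lemma hgrade_ind d (P : T -> Prop) : P 0 ->
  (forall c s f, (size s)%:Z = d -> P f -> P (c *: W s + f)) ->
  forall f, hgrade d f -> P f.
Proof.
move=> P0 PD f <-; move: f; apply: wa_ind => [|c s f IH]; first by rewrite linear0.
rewrite linearP /= hcomp_word; case: eqP => [e|_].
  by rewrite scale1r; apply: PD.
by rewrite scale0r scaler0 add0r.
Qed.

Lemma hgradeM d e f g : hgrade d f -> hgrade e g -> hgrade (d + e) (f * g).
Proof.
move=> hf hg; move: f hf; apply: hgrade_ind => [|c s f sd IH].
  by rewrite mul0r; exact: hgrade0.
rewrite mulrDl -scalerAl; apply: hgrade_linear => //.
move: g hg {IH}; apply: hgrade_ind => [|c' s' g sd' IH].
  by rewrite mulr0; exact: hgrade0.
rewrite mulrDr -scalerAr; apply: hgrade_linear => //.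
by rewrite -wa_cat -sd -sd' -PoszD -size_cat; exact: hgrade_word.
Qed.

Lemma hgrade_lpart d i f : hgrade (d + 1) f -> hgrade d (lpart i f).
Proof.
move: f; apply: hgrade_ind => [|c s f sd IH]; first by rewrite linear0; exact: hgrade0.
rewrite linearP; apply: hgrade_linear => //; case: s sd => [|j s] /= sd.
  by rewrite wa_nil lpart1; exact: hgrade0.
rewrite lpart_cons; apply: hgradeZ.
suff <- : (size s)%:Z = d by exact: hgrade_word.
by move: sd; rewrite -addn1 PoszD => /addIr.
Qed.

Lemma hgrade_rpart d i f : hgrade (d + 1) f -> hgrade d (rpart i f).
Proof.
move: f; apply: hgrade_ind => [|c s f sd IH]; first by rewrite linear0; exact: hgrade0.
rewrite linearP; apply: hgrade_linear => //; case/lastP: s sd => [|s j] /= sd.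
  by rewrite wa_nil rpart1; exact: hgrade0.
rewrite rpart_rcons; apply: hgradeZ.
suff <- : (size s)%:Z = d by exact: hgrade_word.
by move: sd; rewrite size_rcons -addn1 PoszD => /addIr.
Qed.

Lemma hgrade_neg d f : d < 0 -> hgrade d f -> f = 0.
Proof.
move=> dlt0; move: f; apply: hgrade_ind => // c s f sd.
by move: dlt0; rewrite -sd.
Qed.

Lemma hgrade_aug d f : d != 0 -> hgrade d f -> aug f = 0.
Proof.
move=> d0; move: f; apply: hgrade_ind => [|c s f sd IH]; first by rewrite linear0.
rewrite linearP /= IH aug_word addr0; case: s sd => [sd|*]; last by rewrite scaler0.
by rewrite -sd in d0.
Qed.

Lemma hgrade0P f : hgrade 0 f -> f = (aug f)%:A.
Proof.
move: f; apply: hgrade_ind => [|c s f sd {1}->]; first by rewrite linear0 scale0r.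
rewrite linearP /= aug_word; case: s sd => // _.
by rewrite wa_nil /= scalerDl; congr (_ *: _ + _); rewrite /GRing.scale /= mulr1.
Qed.

End Words.

(** * The tensor algebra of the statement as a word algebra *)

Section Concrete.
Variables (k : fieldType) (n : nat).
Local Notation TV := (tensor_alg k n).
Implicit Types (f g : TV) (s t : seq 'I_n).

Lemma scale_word c s : c *: word k s = << c *g FMonom s >> :> TV.
Proof. by apply/malgP => u; rewrite mcoeffZ mcoeffU1 mcoeffU mulr_natr. Qed.

Lemma word_decomp f : f = \sum_(u <- msupp f) f@_u *: word k u.
Proof.
rewrite {1}(monalgE f); apply: eq_bigr => u _.
by rewrite scale_word fmK.
Qed.

Lemma word_cat s t : word k (s ++ t) = word k s * word k t.
Proof.
rewrite /word malgM_def fgmulUU mulr1; congr (<< _ >>).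
by apply/val_inj; rewrite /= fmM.
Qed.

Lemma word_nil : word k [::] = 1 :> TV.
Proof.
by rewrite -[1]/(<< mone >>) /word; congr (<< _ >>); apply/val_inj; rewrite /= fm1.
Qed.

Lemma tv_ind (P : TV -> Prop) :
  P 0 -> (forall c s f, P f -> P (c *: word k s + f)) -> forall f, P f.
Proof.
move=> P0 PD f; rewrite (word_decomp f).
by elim: (enum_fset (msupp f)) => [|u r IH]; rewrite ?big_nil // big_cons; apply: PD.
Qed.

Definition word_ext (V : lmodType k) (F : seq 'I_n -> V) f : V :=
  \sum_(u <- msupp f) f@_u *: F u.

Lemma word_extE (V : lmodType k) (F : seq 'I_n -> V) (d : {fset {fmonom 'I_n}}) f :
  (msupp f `<=` d)%fset -> word_ext F f = \sum_(u <- d) f@_u *: F u.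
Proof.
move=> le; rewrite /word_ext (big_fset_incl _ le) // => u _ /mcoeff_outdom ->.
by rewrite scale0r.
Qed.

Lemma word_ext_is_linear (V : lmodType k) (F : seq 'I_n -> V) : linear (word_ext F).
Proof.
move=> c f g; pose d := (msupp f `|` msupp g `|` msupp (c *: f + g))%fset.
rewrite (@word_extE _ F d); last exact: fsubsetUr.
rewrite (@word_extE _ F d f); last by rewrite /d -fsetUA fsubsetUl.
rewrite (@word_extE _ F d g); last first.
  by rewrite /d -fsetUA fsetUCA fsubsetUl.
rewrite scaler_sumr -big_split /=; apply: eq_bigr => u _.
by rewrite mcoeffD mcoeffZ scalerDl scalerA.
Qed.

HB.instance Definition _ (V : lmodType k) (F : seq 'I_n -> V) :=
  GRing.isLinear.Build k TV V *:%R (word_ext F) (word_ext_is_linear F).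

Lemma word_ext_word (V : lmodType k) (F : seq 'I_n -> V) s :
  word_ext F (word k s) = F s.
Proof. by rewrite /word_ext /word msuppU1 big_seq_fset1 mcoeffUU scale1r. Qed.

Lemma tv_scalerAr (c : k) f g : c *: (f * g) = f * (c *: g).
Proof.
rewrite -!mul_malgC !mulrA; congr (_ * g); rewrite mul_malgC malgM_def fgmulgU malgZ_def.
apply: eq_bigr => u _; rewrite mulrC; congr (<< _ *g _ >>).
by apply/val_inj; rewrite /= fmM fm1 cats0.
Qed.

Definition tv_alg : algType k :=
  HB.pack_for (algType k) TV (GRing.Lalgebra_isAlgebra.Build k TV tv_scalerAr).

Definition tv_words : word_algebra k n :=
  @WordAlgebra k n tv_alg (@word k n) (fun V F => word_ext F) word_ext_word
    tv_ind word_cat word_nil.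

Lemma tensor_gradeP d f : tensor_grade d f <-> @hgrade k n tv_words d f.
Proof.
split=> [h|<-].
  rewrite (word_decomp f) big_seq; apply: (@hgrade_sum _ _ tv_words) => u uf.
  by apply: hgradeZ; rewrite -(h u uf); apply: (@hgrade_word _ _ tv_words).
rewrite /hcomp /= /word_ext /tensor_grade.
elim: (enum_fset (msupp f)) => [|v r IH] u.
  by rewrite big_nil msupp0 in_fset0.
rewrite big_cons => /(fsubsetP (msuppD_le _ _)); rewrite in_fsetU.
case/orP=> [/(fsubsetP (msuppZ_le _ _))|]; last exact: IH.
case: eqP => [<-|_]; last by rewrite msupp0 in_fset0.
by rewrite msuppU1 in_fset1 => /eqP->.
Qed.

End Concrete.

(** * Rotation by a diagonal twist *)

Section Rotation.
Variables (k : fieldType) (n : nat) (T : word_algebra k n).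

Definition rotation (Q : 'M[k]_n) : T -> T :=
  wa_ext T (fun s => if rev s is i :: v
                     then \sum_j invmx Q j i *: wa_word T (j :: rev v) else 1).
HB.instance Definition _ Q := GRing.Linear.on (rotation Q).

Lemma rotationE (Q : 'M[k]_n) f :
  rotation Q f = (aug f : k) *: 1 + \sum_i \sum_j invmx Q j i *: (wgen T j * rpart i f).
Proof.
move: f; apply: (@eq_on_words _ _ _ _ (rotation Q)
  (fun f => (aug f : k) *: 1 + \sum_i \sum_j invmx Q j i *: (wgen T j * rpart i f))).
- exact: linearP.
- move=> c f g; rewrite linearP /= scalerDr scalerDl scalerA.
  rewrite addrACA; congr (_ + _).
  rewrite scaler_sumr -big_split; apply: eq_bigr => i _ /=.
  rewrite scaler_sumr -big_split; apply: eq_bigr => j _ /=.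
  by rewrite linearP mulrDr -scalerAr scalerDr !scalerA mulrC.
move=> s; rewrite aug_word /rotation wa_extE; case/lastP: s => [|s i].
  rewrite /= scale1r big1 ?addr0 // => i _; rewrite big1 // => j _.
  by rewrite wa_nil rpart1 mulr0 scaler0.
rewrite rev_rcons revK -size_eq0 size_rcons scale0r add0r.
rewrite [RHS](bigD1 i) //= [Z in _ + Z]big1 ?addr0 => [|a /negbTE ai].
  by apply: eq_bigr => j _; rewrite rpart_rcons eqxx scale1r wa_cons.
by apply: big1 => j _; rewrite rpart_rcons eq_sym ai scale0r mulr0 scaler0.
Qed.

(** As w is the sum of the (rpart_i w) x_i, its rotation is the sum of the q_i^-1 x_i (rpart_i w).
    Taking left parts in the invariance equation compares the two. *)
Lemma rotation_parts (q : 'rV[k]_n) (m : nat) w i :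
  diag_mx q \in unitmx -> hgrade m.+1 w -> rotation (diag_mx q) w = w ->
  q 0 i != 0 /\ rpart i w = q 0 i *: lpart i w.
Proof.
move=> Qu wd rot; split.
  rewrite unitmxE det_diag unitfE in Qu; move: Qu; rewrite (bigD1 i) //=.
  by rewrite mulf_eq0 negb_or => /andP[].
have auw : aug w = 0 by apply: hgrade_aug wd.
have := congr1 (lpart i) rot; rewrite rotationE auw scale0r add0r.
rewrite (linear_sum (lpart i)) /= => <-.
rewrite scaler_sumr (bigD1 i) //= [Z in _ + Z]big1 ?addr0 => [|a ai].
  under eq_bigr => j _ do rewrite scalerAr.
  rewrite (lpart_sum (fun j => invmx (diag_mx q) j i *: rpart i w)).
  rewrite scalerA; have := congr1 (fun M : 'M_n => M i i) (mulmxV Qu).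
  by rewrite mul_diag_mx !mxE eqxx => ->; rewrite scale1r.
under eq_bigr => j _ do rewrite scalerAr.
rewrite (lpart_sum (fun j => invmx (diag_mx q) j a *: rpart a w)).
rewrite scalerA; have := congr1 (fun M : 'M_n => M i a) (mulmxV Qu).
by rewrite mul_diag_mx !mxE eq_sym (negbTE ai) => ->; rewrite scale0r.
Qed.

End Rotation.

(** * Comparison of resolutions *)

Definition mklin (R : nzRingType) (U V : lmodType R) (f : U -> V) (lf : linear f) :
  {linear U -> V} := HB.pack f (GRing.isLinear.Build R U V *:%R f lf).

(** Submodules given by Prop-valued predicates. They serve twice: for the fibre product in
    [projective_lift] and for the span of the pure tensors in [env_span]. *)
Record submod (R : nzRingType) (V : lmodType R) := Submod {
  submod_mem : V -> Prop;
  submod0 : submod_mem 0;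
  submodP : forall a x y, submod_mem x -> submod_mem y -> submod_mem (a *: x + y)
}.

Section Submodule.
Variables (R : nzRingType) (V : lmodType R) (S : submod V).

Definition submod_pred : {pred V} := fun x => `[< submod_mem S x >].
Definition submod_sort := {x : V | x \in submod_pred}.
HB.instance Definition _ := SubType.on submod_sort.
HB.instance Definition _ := [Choice of submod_sort by <:].

Lemma submod_pred_closed : subsemimod_closed submod_pred.
Proof.
have S0 : 0 \in submod_pred by apply/asboolP; exact: submod0.
split; first split=> // x y /asboolP Sx /asboolP Sy.
  by apply/asboolP; rewrite -[x]scale1r; apply: submodP.
move=> a x /asboolP Sx; apply/asboolP; rewrite -[_ *: _]addr0.
by apply: submodP => //; exact: submod0.
Qed.

HB.instance Definition _ :=
  GRing.SubChoice_isSubLmodule.Build R V submod_pred submod_sort submod_pred_closed.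

Definition submod_lmod : lmodType R := submod_sort.
Definition submod_incl : {linear submod_lmod -> V} := mklin (GRing.linearP (val : submod_sort -> V)).

Lemma submod_inclP u : submod_mem S (submod_incl u).
Proof. by apply/asboolP; exact: (valP (u : submod_sort)). Qed.

End Submodule.

(** [projective] lifts along surjections only, while a differential merely hits the next kernel. The
    fibre product of X and P over Y maps onto P, so the identity of P lifts to it. *)
Lemma projective_lift (R : nzRingType) (P X Y : lmodType R)
    (g : {linear X -> Y}) (f : P -> Y) :
  projective P -> linear f -> (forall z, exists x, g x = f z) ->
  exists h : {linear P -> X}, forall z, g (h z) = f z.
Proof.
move=> projP lf gf; pose V : lmodType R := (X * P)%type.
pose S (v : V) := g v.1 = f v.2.
have S0 : S 0 by rewrite /S /= linear0 (linear_pred0 lf).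
have SP a u v : S u -> S v -> S (a *: u + v).
  by rewrite /S /= linearP lf => -> ->.
pose SM := Submod S0 SP.
have sndl : linear (fun u => (submod_incl SM u).2) by move=> a u v; rewrite linearP.
have fstl : linear (fun u => (submod_incl SM u).1) by move=> a u v; rewrite linearP.
have idl : linear (idfun : P -> P) by [].
have [z|h hE] := projP _ _ (mklin sndl) (mklin idl).
  have [x gx] := gf z; have Sxz : `[< S (x, z) >] by apply/asboolP.
  by exists (exist _ (x, z) Sxz).
exists (mklin (GRing.linearP (mklin fstl \o h))) => z /=.
have /= := submod_inclP (h z); rewrite /S => ->.
by congr f; exact: hE.
Qed.

Record aug_complex (R : nzRingType) (M : lmodType R) := AugComplex {
  ac_mod :> nat -> lmodType R;
  ac_diff : forall i, {linear ac_mod i.+1 -> ac_mod i};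
  ac_aug : {linear ac_mod 0%N -> M};
  ac_augd : forall x, ac_aug (ac_diff 0 x) = 0;
  ac_dd : forall i x, ac_diff i (ac_diff i.+1 x) = 0
}.

(** The bound N allows for explicit complexes of which only the first terms are known to be exact:
    it covers the places [Y j] with j < N. *)
Definition exact_below (R : nzRingType) (M : lmodType R) (Y : aug_complex M) (N : nat) :=
  [/\ forall x, exists y, ac_aug Y y = x,
      (0 < N)%N -> forall y, ac_aug Y y = 0 -> exists z, ac_diff Y 0 z = y
    & forall i, (i.+1 < N)%N -> forall y, ac_diff Y i y = 0 ->
        exists z, ac_diff Y i.+1 z = y].

Section Comparison.
Variables (R : nzRingType) (M : lmodType R).

Lemma res_augd (P : proj_resolution M) x : pr_aug P (pr_diff P 0 x) = 0.
Proof. by apply/pr_exact0; exists x. Qed.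

Lemma res_dd (P : proj_resolution M) i x : pr_diff P i (pr_diff P i.+1 x) = 0.
Proof. by apply/pr_exactS; exists x. Qed.

Definition complex_of_res (P : proj_resolution M) : aug_complex M :=
  AugComplex (@res_augd P) (@res_dd P).

Lemma res_exact (P : proj_resolution M) N : exact_below (complex_of_res P) N.
Proof.
by split=> [x|_ y /pr_exact0 //|i _ y /pr_exactS //]; exact: pr_surj.
Qed.

Variables (X Y : aug_complex M) (N : nat).
Hypothesis projX : forall i, projective (X i).

Definition chain_map (f : forall i, {linear X i -> Y i}) :=
  (forall x, ac_aug Y (f 0%N x) = ac_aug X x) /\
  forall i, (i < N)%N -> forall x, ac_diff Y i (f i.+1 x) = f i (ac_diff X i x).

Definition zero_lin (U V : lmodType R) : {linear U -> V} := [the {linear U -> V} of \0].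

Lemma chain_lift : exact_below Y N -> exists f, chain_map f.
Proof.
case=> surj ex0 exS.
(* The maps are chosen recursively, together with the invariant that makes the next lift possible;
   past degree N the zero map is taken. *)
pose good i (f : {linear X i -> Y i}) := (i < N)%N ->
  forall x, exists z, ac_diff Y i z = f (ac_diff X i x).
have start : {f : {linear X 0%N -> Y 0%N} |
    good 0%N f /\ forall x, ac_aug Y (f x) = ac_aug X x}.
  apply: cid; have [x|h hE] := @projective_lift _ _ _ _ (ac_aug Y) (ac_aug X)
    (@projX 0) (linearP _); first exact: surj.
  exists h; split=> // N0 x; apply: ex0 => //; rewrite hE; exact: ac_augd.
have step i (f : {f : {linear X i -> Y i} | good i f}) :
    {g : {linear X i.+1 -> Y i.+1} | good i.+1 g /\
       ((i < N)%N -> forall x, ac_diff Y i (g x) = projT1 f (ac_diff X i x))}.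
  apply: cid; case: (ltnP i N) => [iN|Ni]; last first.
    exists (zero_lin _ _); split=> // iN; by move: Ni; rewrite leqNgt (ltnW iN).
  case: f => f gf /=.
  have lf : linear (fun x => f (ac_diff X i x)) by move=> a x y; rewrite !linearP.
  have [|h hE] := @projective_lift _ _ _ _ (ac_diff Y i) _ (@projX i.+1) lf.
    exact: gf.
  exists h; split=> // iN1 x; apply: exS => //; rewrite hE ac_dd; exact: linear0.
pose F := fix F i : {f : {linear X i -> Y i} | good i f} :=
  match i with
  | 0%N => exist _ (projT1 start) (projT2 start).1
  | j.+1 => exist _ (projT1 (step j (F j))) (projT2 (step j (F j))).1
  end.
exists (fun i => projT1 (F i)); split; first exact: (projT2 start).2.
by move=> i iN x; exact: (projT2 (step i (F i))).2.
Qed.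

Definition homotopy_of (phi : forall i, X i -> Y i)
    (s : forall i, {linear X i -> Y i.+1}) :=
  ((0 < N)%N -> forall x, phi 0%N x = ac_diff Y 0 (s 0%N x)) /\
  forall i, (i.+1 < N)%N -> forall x,
    phi i.+1 x = ac_diff Y i.+1 (s i.+1 x) + s i (ac_diff X i x).

(** [phi] is a bare family of functions because it is applied to differences such as a round trip
    minus the identity. *)
Lemma chain_homotopy (phi : forall i, X i -> Y i) : exact_below Y N ->
  (forall i, linear (phi i)) -> (forall x, ac_aug Y (phi 0%N x) = 0) ->
  (forall i, (i.+1 < N)%N ->
     forall x, ac_diff Y i (phi i.+1 x) = phi i (ac_diff X i x)) ->
  exists s, homotopy_of phi s.
Proof.
case=> surj ex0 exS lphi aug0 comm.
pose good i (s : {linear X i -> Y i.+1}) := (i.+1 < N)%N ->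
  forall x, ac_diff Y i (s (ac_diff X i x)) = phi i (ac_diff X i x).
have start : {s : {linear X 0%N -> Y 1%N} |
    good 0%N s /\ ((0 < N)%N -> forall x, phi 0%N x = ac_diff Y 0 (s x))}.
  apply: cid; case: (posnP N) => [N0|N0].
    by exists (zero_lin _ _); rewrite /good N0.
  have [x|h hE] := @projective_lift _ _ _ _ (ac_diff Y 0) (phi 0%N) (@projX 0) (lphi _).
    by apply: ex0.
  by exists h; split=> [_ x|_ x]; rewrite hE.
have step i (s : {s : {linear X i -> Y i.+1} | good i s}) :
    {g : {linear X i.+1 -> Y i.+2} | good i.+1 g /\
       ((i.+1 < N)%N -> forall x, phi i.+1 x =
          ac_diff Y i.+1 (g x) + projT1 s (ac_diff X i x))}.
  apply: cid; case: (ltnP i.+1 N) => [iN|Ni]; last first.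
    exists (zero_lin _ _); split=> // iN; by move: Ni; rewrite leqNgt (ltnW iN).
  case: s => s gs /=.
  have lf : linear (fun x => phi i.+1 x - s (ac_diff X i x)).
    move=> a x y; rewrite lphi [ac_diff _ _ _]linearP [s _]linearP opprD scalerBr addrACA.
    by [].
  have [x|h hE] := @projective_lift _ _ _ _ (ac_diff Y i.+1) _ (@projX i.+1) lf.
    by apply: exS => //; rewrite linearB /= comm // gs // subrr.
  exists h; split=> [iN1 x|_ x]; rewrite hE.
    by rewrite ac_dd linear0 subr0.
  by rewrite subrK.
pose F := fix F i : {s : {linear X i -> Y i.+1} | good i s} :=
  match i with
  | 0%N => exist _ (projT1 start) (projT2 start).1
  | j.+1 => exist _ (projT1 (step j (F j))) (projT2 (step j (F j))).1
  end.
exists (fun i => projT1 (F i)); split; first exact: (projT2 start).2.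
by move=> i iN x; exact: (projT2 (step i (F i))).2.
Qed.

End Comparison.

Lemma row_projective (R : nzRingType) (p : nat) : projective ('rV[R]_p : lmodType R).
Proof.
move=> X Y g f gs.
have /choice[c cE] : forall i : 'I_p, exists x, g x = f (delta_mx 0 i) by move=> i.
have lh : linear (fun z : 'rV[R]_p => \sum_i z 0 i *: c i).
  move=> a y z; rewrite scaler_sumr -big_split; apply: eq_bigr => i _ /=.
  by rewrite !mxE scalerDl scalerA.
exists (mklin lh) => z /=; rewrite linear_sum [z in RHS]row_sum_delta linear_sum.
by apply: eq_bigr => i _; rewrite !linearZ /= cE.
Qed.

(** * Graded modules and graded Ext *)

Section Grading.
Variables (V : zmodType) (G : int -> V -> Prop).
Hypothesis hG : is_grading G.

Lemma grade0 j : G j 0. Proof. by case: hG. Qed.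
Lemma gradeB j x y : G j x -> G j y -> G j (x - y).
Proof. by case: hG => _ + _ _; apply. Qed.
Lemma gradeN j x : G j x -> G j (- x).
Proof. by move=> Gx; rewrite -sub0r; apply: gradeB => //; exact: grade0. Qed.
Lemma gradeD j x y : G j x -> G j y -> G j (x + y).
Proof. by move=> Gx Gy; rewrite -[y]opprK; apply: gradeB => //; exact: gradeN. Qed.
Lemma grade_sum (I : Type) (r : seq I) (P : pred I) (F : I -> V) j :
  (forall i, P i -> G j (F i)) -> G j (\sum_(i <- r | P i) F i).
Proof. by move=> h; apply: big_ind => //; [exact: grade0 | exact: gradeD]. Qed.

Lemma big_seq_undup (s : seq int) (c : int -> V) :
  \sum_(j <- s) c j = \sum_(j <- undup s) c j *+ count_mem j s.
Proof.
by rewrite -big_undup_iterop_count.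
Qed.

Lemma grading_decomp x : exists (s : seq int) (c : int -> V),
  [/\ uniq s, forall j, G j (c j), forall j, j \notin s -> c j = 0
    & x = \sum_(j <- s) c j].
Proof.
case: (hG) => _ _ /(_ x)[s [c [Gc ->]]] _.
exists (undup s), (fun j => c j *+ count_mem j s); split.
- exact: undup_uniq.
- move=> j; elim: (count_mem j s) => [|p IH]; first by rewrite mulr0n; exact: grade0.
  by rewrite mulrS; apply: gradeD.
- by move=> j; rewrite mem_undup => /count_memPn->.
- exact: big_seq_undup.
Qed.

Lemma big_extend (s u : seq int) (c : int -> V) : uniq s -> uniq u ->
  {subset s <= u} -> (forall j, j \notin s -> c j = 0) ->
  \sum_(j <- s) c j = \sum_(j <- u) c j.
Proof.
move=> us uu su c0; rewrite [RHS](bigID (mem s)) /= [X in _ + X]big1 ?addr0.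
  rewrite -[RHS]big_filter; apply: perm_big; apply: uniq_perm => //.
    exact: filter_uniq.
  by move=> j; rewrite mem_filter; case: (boolP (j \in s)) => [/su|].
by move=> j /c0.
Qed.

Lemma grading_unique (s s' : seq int) (c c' : int -> V) : uniq s -> uniq s' ->
  (forall j, G j (c j)) -> (forall j, G j (c' j)) ->
  (forall j, j \notin s -> c j = 0) -> (forall j, j \notin s' -> c' j = 0) ->
  \sum_(j <- s) c j = \sum_(j <- s') c' j -> c =1 c'.
Proof.
move=> us us' Gc Gc' c0 c'0 eqs; pose u := undup (s ++ s').
have su : {subset s <= u} by move=> j; rewrite mem_undup mem_cat => ->.
have s'u : {subset s' <= u} by move=> j; rewrite mem_undup mem_cat orbC => ->.
have uu : uniq u by exact: undup_uniq.
move: eqs; rewrite (big_extend us uu su c0) (big_extend us' uu s'u c'0) => /eqP.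
rewrite -subr_eq0 -sumrB => /eqP eq0.
case: (hG) => _ _ _ /(_ u (fun j => c j - c' j) uu) H.
have {H} eqc j : j \in u -> c j = c' j.
  move=> ju; apply/eqP; rewrite -subr_eq0; apply/eqP; apply: H => // i.
  exact: gradeB.
move=> j; case: (boolP (j \in u)) => [/eqc //|].
by rewrite mem_undup mem_cat negb_or => /andP[/c0-> /c'0->].
Qed.

Let decomp := fun x => cid (grading_decomp x).
(** A decomposition picked by choice: [gsupp] may list degrees whose component is zero, but [gpr]
    does not depend on the choice, by [grading_unique]. *)
Definition gsupp x : seq int := projT1 (decomp x).
Definition gpr j x : V := projT1 (cid (projT2 (decomp x))) j.

Lemma gprP x : [/\ uniq (gsupp x), forall j, G j (gpr j x),
  forall j, j \notin gsupp x -> gpr j x = 0 & x = \sum_(j <- gsupp x) gpr j x].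
Proof. exact: (projT2 (cid (projT2 (decomp x)))). Qed.

Lemma gpr_grade j x : G j (gpr j x). Proof. by case: (gprP x). Qed.

Lemma gpr_sum x : x = \sum_(j <- gsupp x) gpr j x. Proof. by case: (gprP x). Qed.

Lemma gpr_char (s : seq int) (c : int -> V) : uniq s -> (forall j, G j (c j)) ->
  (forall j, j \notin s -> c j = 0) -> forall j, gpr j (\sum_(j <- s) c j) = c j.
Proof.
move=> us Gc c0; have [ux Gx x0 xE] := gprP (\sum_(j <- s) c j).
by apply: (grading_unique ux us); rewrite -?xE.
Qed.

Lemma gpr_id j i x : G i x -> gpr j x = if j == i then x else 0.
Proof.
move=> Gx; have := @gpr_char [:: i] (fun j => if j == i then x else 0).
rewrite big_seq1 eqxx; apply=> // [l|l]; first by case: eqP => [->//|_]; exact: grade0.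
by rewrite inE => /negbTE->.
Qed.

Lemma gprB j : {morph gpr j : x y / x - y}.
Proof.
move=> x y; have [ux Gx x0 xE] := gprP x; have [uy Gy y0 yE] := gprP y.
pose u := undup (gsupp x ++ gsupp y).
have uu : uniq u by exact: undup_uniq.
have sx : {subset gsupp x <= u} by move=> i; rewrite mem_undup mem_cat => ->.
have sy : {subset gsupp y <= u} by move=> i; rewrite mem_undup mem_cat orbC => ->.
rewrite {1}xE {1}yE (big_extend ux uu sx x0) (big_extend uy uu sy y0) -sumrB.
apply: (@gpr_char u (fun j => gpr j x - gpr j y)) => // [i|i].
  exact: gradeB.
by rewrite mem_undup mem_cat negb_or => /andP[/x0-> /y0->]; rewrite subrr.
Qed.

HB.instance Definition _ j := GRing.isZmodMorphism.Build V V (gpr j) (gprB j).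

Lemma gpr_eq0 x : (forall j, gpr j x = 0) -> x = 0.
Proof. by move=> h; rewrite (gpr_sum x) big1. Qed.

Lemma gpr_eq x y : (forall j, gpr j x = gpr j y) -> x = y.
Proof.
move=> h; apply/eqP; rewrite -subr_eq0; apply/eqP; apply: gpr_eq0 => j.
by rewrite raddfB /= h subrr.
Qed.

Lemma gpr_big (s : seq int) x : uniq s -> (forall j, j \notin s -> gpr j x = 0) ->
  x = \sum_(j <- s) gpr j x.
Proof.
move=> us x0; have [ux Gx x0' xE] := gprP x.
apply: gpr_eq => j; symmetry; apply: gpr_char => //; exact: gpr_grade.
Qed.

Lemma gpr_supp x j : j \notin gsupp x -> gpr j x = 0.
Proof. by case: (gprP x) => _ _ + _; apply. Qed.

Lemma gpr_gradeP i x : G i x <-> gpr i x = x.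
Proof. by split=> [/gpr_id->|<-]; rewrite ?eqxx //; exact: gpr_grade. Qed.

End Grading.

Lemma gpr_degree (U V : zmodType) (GU : int -> U -> Prop) (GV : int -> V -> Prop)
    (hU : is_grading GU) (hV : is_grading GV) (f : U -> V) d :
  {morph f : x y / x - y} -> (forall l x, GU l x -> GV (l + d) (f x)) ->
  forall j x, gpr hV (j + d) (f x) = f (gpr hU j x).
Proof.
move=> fB fd j x; pose fa := HB.pack_for {additive U -> V} f (GRing.isZmodMorphism.Build U V f fB).
rewrite {1}(gpr_sum hU x) -[f _]/(fa _) raddf_sum /= raddf_sum /=.
have [jx|jx] := boolP (j \in gsupp hU x).
  rewrite (bigD1_seq j) //=; last by case: (gprP hU x).
  rewrite (gpr_id hV _ (fd _ _ (gpr_grade hU j x))) eqxx big1 ?addr0 // => i ij.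
  rewrite (gpr_id hV _ (fd _ _ (gpr_grade hU i x))).
  by rewrite (inj_eq (addIr d)) eq_sym (negbTE ij).
rewrite (gpr_supp jx) -[f 0]/(fa 0) raddf0 big1_seq // => i /andP[_ ix].
rewrite (gpr_id hV _ (fd _ _ (gpr_grade hU i x))) (inj_eq (addIr d)).
by case: eqP => // ij; rewrite ij ix in jx.
Qed.

Lemma is_grading_of_proj (V : zmodType) (G : int -> V -> Prop) (pr : int -> V -> V) :
  (forall j, G j 0) -> (forall j x y, G j x -> G j y -> G j (x - y)) ->
  (forall j, {morph pr j : x y / x - y}) ->
  (forall i j x, G i x -> pr j x = if j == i then x else 0) ->
  (forall j x, G j (pr j x)) ->
  (forall x, exists s : seq int, x = \sum_(j <- s) pr j x) -> is_grading G.
Proof.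
move=> G0 GB prB pr_id Gpr prs; split=> //.
  by move=> x; have [s ->] := prs x; exists s, (fun j => pr j x).
move=> s c us Gc c0 j js; pose f := HB.pack_for {additive V -> V} (pr j) (GRing.isZmodMorphism.Build V V (pr j) (prB j)).
have := congr1 f c0; rewrite raddf_sum raddf0 /= (bigD1_seq j) //= (pr_id _ _ _ (Gc j)) eqxx.
rewrite big1 ?addr0 // => i ij.
by rewrite (pr_id _ _ _ (Gc i)) eq_sym (negbTE ij).
Qed.

Lemma eq_on_homog (U V : zmodType) (GU : int -> U -> Prop) (f g : U -> V) :
  is_grading GU -> {morph f : x y / x - y} -> {morph g : x y / x - y} ->
  (forall l x, GU l x -> f x = g x) -> f =1 g.
Proof.
move=> hU fB gB eqfg x.
pose fa := HB.pack_for {additive U -> V} f (GRing.isZmodMorphism.Build U V f fB).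
pose ga := HB.pack_for {additive U -> V} g (GRing.isZmodMorphism.Build U V g gB).
rewrite (gpr_sum hU x) -[f _]/(fa _) -[g _]/(ga _) !raddf_sum; apply: eq_bigr => j _.
exact: eqfg (gpr_grade hU j x).
Qed.

Section GradedMaps.
Variables (R : nzRingType) (G : int -> R -> Prop) (hG : is_grading G).
Variables (U V : lmodType R) (GU : int -> U -> Prop) (GV : int -> V -> Prop).
Hypotheses (gU : graded_module G GU) (gV : graded_module G GV).
Let hU : is_grading GU := proj1 gU.
Let hV : is_grading GV := proj1 gV.

(** The part of degree d of a map. It turns lifts and cochains obtained without regard to degrees
    into homogeneous ones. *)
Definition gcomp (d : int) (f : U -> V) (x : U) : V :=
  \sum_(j <- gsupp hU x) gpr hV (j + d) (f (gpr hU j x)).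

Variable f : U -> V.
Hypothesis lf : linear f.
Let fl := mklin lf.

Lemma gcompE d x (s : seq int) : uniq s -> {subset gsupp hU x <= s} ->
  gcomp d f x = \sum_(j <- s) gpr hV (j + d) (f (gpr hU j x)).
Proof.
move=> us sub; apply: big_extend => // [|j jx]; first by case: (gprP hU x).
by rewrite (gpr_supp jx) (linear_pred0 lf) raddf0.
Qed.

Lemma gcompB d : {morph gcomp d f : x y / x - y}.
Proof.
move=> x y; pose u := undup (gsupp hU x ++ gsupp hU y ++ gsupp hU (x - y)).
rewrite !(@gcompE d _ u) ?undup_uniq //;
  try by (move=> j jx; rewrite mem_undup !mem_cat jx ?orbT).
rewrite -sumrB; apply: eq_bigr => j _.
by rewrite raddfB -[f _]/(fl _) linearB raddfB.
Qed.

Lemma gcomp_homog d l x : GU l x -> gcomp d f x = gpr hV (l + d) (f x).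
Proof.
move=> Gx; rewrite (@gcompE d x (undup (l :: gsupp hU x))) ?undup_uniq //.
  rewrite (bigD1_seq l) ?undup_uniq ?mem_undup ?inE ?eqxx //=.
  rewrite (gpr_id hU _ Gx) eqxx big1 ?addr0 // => j jl.
  by rewrite (gpr_id hU _ Gx) (negbTE jl) (linear_pred0 lf) raddf0.
by move=> j jx; rewrite mem_undup inE jx orbT.
Qed.

HB.instance Definition _ d := GRing.isZmodMorphism.Build U V (gcomp d f) (gcompB d).

(** By additivity it is enough to treat homogeneous vectors and then homogeneous scalars, for which
    the degrees on both sides agree. *)
Lemma gcomp_linear d : linear (gcomp d f).
Proof.
move=> a x y; rewrite raddfD /=; congr (_ + _); move: x {y}.
apply: (@eq_on_homog _ _ _ _ _ hU) => [x y|x y|j z Gz].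
- by rewrite scalerBr raddfB.
- by rewrite raddfB scalerBr.
move: a; apply: (@eq_on_homog _ _ _ _ _ hG) => [a b|a b|i b Gb].
- by rewrite scalerBl raddfB.
- by rewrite scalerBl.
have Gbz : GU (i + j) (b *: z) by case: gU => _; apply.
rewrite (gcomp_homog d Gbz) (gcomp_homog d Gz) -[f _]/(fl _) linearZ /=.
rewrite -addrA addrC.
apply: (@gpr_degree _ _ _ _ hV hV (fun x => b *: x)) => [u v|l u Gu].
  by rewrite scalerBr.
by rewrite addrC; case: gV => _; apply.
Qed.

Lemma gcomp_deg d l x : GU l x -> GV (l + d) (gcomp d f x).
Proof. by move=> Gx; rewrite (gcomp_homog d Gx); exact: gpr_grade. Qed.

End GradedMaps.

Lemma linear_subr (R : nzRingType) (U V : lmodType R) (f : U -> V) : linear f -> {morph f : x y / x - y}.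
Proof. by move=> lf x y; rewrite -[f]/(mklin lf : U -> V) linearB. Qed.

Section GradedComponents.
Variables (R : nzRingType) (G : int -> R -> Prop) (hG : is_grading G).
Variables (U V : lmodType R) (GU : int -> U -> Prop) (GV : int -> V -> Prop).
Hypotheses (gU : graded_module G GU) (gV : graded_module G GV).

Lemma gcomp_id d (f : U -> V) : linear f -> (forall l x, GU l x -> GV (l + d) (f x)) ->
  gcomp gU gV d f =1 f.
Proof.
move=> lf fd; apply: (eq_on_homog (proj1 gU)).
- exact: linear_subr (gcomp_linear hG gU gV lf d).
- exact: linear_subr.
- by move=> l x Gx; rewrite (gcomp_homog gU gV lf d Gx) (gpr_id _ _ (fd _ _ Gx)) eqxx.
Qed.

Lemma gcomp_pre (U' : lmodType R) (GU' : int -> U' -> Prop) (gU' : graded_module G GU')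
    (f : U -> V) (h : U' -> U) d : linear f -> linear h ->
  (forall l x, GU' l x -> GU l (h x)) ->
  gcomp gU' gV d (fun x => f (h x)) =1 (fun x => gcomp gU gV d f (h x)).
Proof.
move=> lf lh hd; have lfh : linear (fun x => f (h x)) by move=> a x y; rewrite lh lf.
apply: (eq_on_homog (proj1 gU')).
- exact: linear_subr (gcomp_linear hG gU' gV lfh d).
- by move=> x y; rewrite (linear_subr lh) (linear_subr (gcomp_linear hG gU gV lf d)).
- by move=> l x Gx; rewrite (gcomp_homog gU' gV lfh d Gx) (gcomp_homog gU gV lf d (hd _ _ Gx)).
Qed.

Lemma gcomp_post (W : lmodType R) (GW : int -> W -> Prop) (gW : graded_module G GW)
    (f : U -> V) (h : V -> W) d e : linear f -> linear h ->
  (forall l x, GV l x -> GW (l + e) (h x)) ->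
  gcomp gU gW (d + e) (fun x => h (f x)) =1 (fun x => h (gcomp gU gV d f x)).
Proof.
move=> lf lh hd; have lhf : linear (fun x => h (f x)) by move=> a x y; rewrite lf lh.
apply: (eq_on_homog (proj1 gU)).
- exact: linear_subr (gcomp_linear hG gU gW lhf (d + e)).
- by move=> x y; rewrite (linear_subr (gcomp_linear hG gU gV lf d)) (linear_subr lh).
- move=> l x Gx; rewrite (gcomp_homog gU gW lhf (d + e) Gx) (gcomp_homog gU gV lf d Gx) addrA.
  exact: (gpr_degree (proj1 gV) (proj1 gW) (linear_subr lh) hd).
Qed.

(* Same as [gcomp_post], for maps such as right multiplications, which are
   linear only along [f]. *)
Lemma gcomp_post_add (W : lmodType R) (GW : int -> W -> Prop) (gW : graded_module G GW)
    (f : U -> V) (h : V -> W) d e : linear f -> linear (fun x => h (f x)) ->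
  {morph h : x y / x - y} -> (forall l x, GV l x -> GW (l + e) (h x)) ->
  gcomp gU gW (d + e) (fun x => h (f x)) =1 (fun x => h (gcomp gU gV d f x)).
Proof.
move=> lf lhf hB hd; apply: (eq_on_homog (proj1 gU)).
- exact: linear_subr (gcomp_linear hG gU gW lhf (d + e)).
- by move=> x y; rewrite (linear_subr (gcomp_linear hG gU gV lf d)) hB.
- move=> l x Gx; rewrite (gcomp_homog gU gW lhf (d + e) Gx) (gcomp_homog gU gV lf d Gx) addrA.
  exact: (gpr_degree (proj1 gV) (proj1 gW) hB hd).
Qed.

End GradedComponents.

Lemma gcomp_sum (R : nzRingType) (G : int -> R -> Prop) (U V : lmodType R)
    (GU : int -> U -> Prop) (GV : int -> V -> Prop)
    (gU : graded_module G GU) (gV : graded_module G GV) (I : Type) (s : seq I)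
    (f : I -> U -> V) d x :
  gcomp gU gV d (fun x => \sum_(i <- s) f i x) x = \sum_(i <- s) gcomp gU gV d (f i) x.
Proof.
rewrite /gcomp exchange_big /=; apply: eq_bigr => j _.
exact: raddf_sum.
Qed.

Section GradedExt.
Variables (R : nzRingType) (G : int -> R -> Prop) (hG : is_grading G).
Variables (M : lmodType R) (P : proj_resolution M) (GP : forall i, int -> P i -> Prop).
Variables (N : lmodType R) (GN : int -> N -> Prop).
Hypotheses (gP : forall i, graded_module G (@GP i)) (gN : graded_module G GN).
Hypothesis dP : forall i j x, GP j x -> GP j (pr_diff P i x).

Local Notation gc i := (gcomp (gP i) gN).

Lemma hom_deg_gcomp i (f : P i -> N) d : linear f -> hom_deg GP GN d (gc i d f).
Proof.
move=> lf; split; first exact: (gcomp_linear hG (gP i) gN lf d).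
by move=> l x; apply: gcomp_deg.
Qed.

Lemma hom_deg_graded i (f : P i -> N) d : hom_deg GP GN d f -> graded_hom GP GN f.
Proof.
move=> hf; exists [:: d], (fun j => if j == d then f else (fun _ => 0)); split.
  move=> j; case: eqP => [->//|_]; split; first by move=> a x y; rewrite scaler0 addr0.
  by move=> l x _; apply: grade0; exact: (proj1 gN).
by move=> x; rewrite big_seq1 eqxx.
Qed.

Lemma graded_hom_linear i (f : P i -> N) : graded_hom GP GN f -> linear f.
Proof.
case=> s [c [cd fE]] a x y; rewrite !fE scaler_sumr -big_split.
by apply: eq_bigr => j _; have [-> _] := cd j.
Qed.

Lemma graded_homD i (f g : P i -> N) :
  graded_hom GP GN f -> graded_hom GP GN g -> graded_hom GP GN (f \+ g).
Proof.
move=> [s [c [cd fE]]] [s' [c' [cd' gE]]].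
pose e j x := c j x *+ count_mem j s + c' j x *+ count_mem j s'.
exists (undup (s ++ s')), e; split.
  move=> j; have [lc dc] := cd j; have [lc' dc'] := cd' j; split.
    move=> a x y; rewrite /e lc lc' !mulrnDl scalerDr -!scalerMnr.
    by rewrite !addrA; congr (_ + _); rewrite -!addrA; congr (_ + _); rewrite addrC.
  move=> l x Gx; have [hN _] := gN.
  have gm y p : GN (l + j) y -> GN (l + j) (y *+ p).
    move=> Gy; elim: p => [|p IH]; first by rewrite mulr0n; exact: grade0.
    by rewrite mulrS; apply: gradeD.
  by apply: gradeD => //; apply: gm; [exact: dc | exact: dc'].
move=> x; rewrite /e big_split /= fE gE; congr (_ + _).
  rewrite big_seq_undup; apply: big_extend; rewrite ?undup_uniq //.
    by move=> j; rewrite !mem_undup mem_cat => ->.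
  by move=> j; rewrite mem_undup => /count_memPn->.
rewrite big_seq_undup; apply: big_extend; rewrite ?undup_uniq //.
  by move=> j; rewrite !mem_undup mem_cat orbC => ->.
by move=> j; rewrite mem_undup => /count_memPn->.
Qed.

Lemma cocycleD i (f g : P i -> N) :
  cocycle GP GN f -> cocycle GP GN g -> cocycle GP GN (f \+ g).
Proof.
move=> [gf fd] [gg gd]; split; first exact: graded_homD.
by move=> x; rewrite /= fd gd addr0.
Qed.

Lemma cocycle0 i : cocycle GP GN (fun _ : P i => 0).
Proof.
split=> //; apply: (@hom_deg_graded i _ 0); split=> [a x y|l x _].
  by rewrite scaler0 addr0.
by apply: grade0; exact: (proj1 gN).
Qed.

Lemma coboundary0 i : coboundary GP GN (fun _ : P i.+1 => 0).
Proof. by exists (fun=> 0) => //; case: (cocycle0 i). Qed.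

Lemma ext_class_sum i (X : zmodType) (phi : (P i.+1 -> N) -> X) :
  (forall f, cocycle GP GN f -> (phi f = 0 <-> coboundary GP GN f)) ->
  (forall f g, cocycle GP GN f -> cocycle GP GN g -> phi (f \+ g) = phi f + phi g) ->
  forall (I : Type) (s : seq I) (c : I -> P i.+1 -> N), (forall l, cocycle GP GN (c l)) ->
  cocycle GP GN (fun x => \sum_(l <- s) c l x) /\
  phi (fun x => \sum_(l <- s) c l x) = \sum_(l <- s) phi (c l).
Proof.
move=> phi0 phiD I s c cc; elim: s => [|l s [IH1 IH2]].
  rewrite big_nil (_ : (fun x => _) = (fun=> 0)); last first.
    by apply: funext => x; rewrite big_nil.
  split; first exact: cocycle0.
  by apply/phi0; [exact: cocycle0 | exact: coboundary0].
rewrite (_ : (fun x => _) = c l \+ (fun x => \sum_(l <- s) c l x)); last first.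
  by apply: funext => x; rewrite big_cons.
by split; [exact: cocycleD | rewrite big_cons -IH2; exact: phiD].
Qed.

Lemma graded_hom_sum i (s : seq int) (c : int -> P i -> N) :
  (forall j, hom_deg GP GN j (c j)) -> graded_hom GP GN (fun x => \sum_(j <- s) c j x).
Proof. by move=> cd; exists s, c. Qed.

Lemma graded_hom_gcomp i (f : P i -> N) : graded_hom GP GN f ->
  exists2 s : seq int, uniq s & forall x, f x = \sum_(j <- s) gc i j f x.
Proof.
move=> gf; have lf := graded_hom_linear gf.
case: gf => s [c [cd fE]]; exists (undup s); first exact: undup_uniq.
pose h x := \sum_(j <- undup s) gc i j f x.
suff : f =1 h by [].
apply: (eq_on_homog (proj1 (gP i))).
- exact: linear_subr.
- move=> x y; rewrite /h -sumrB; apply: eq_bigr => j _.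
  exact: (linear_subr (gcomp_linear hG (gP i) gN lf j)).
move=> l x Gx; rewrite /h; under eq_bigr => j _ do rewrite (gcomp_homog _ _ lf j Gx).
rewrite -(big_map (fun j => l + j) xpredT (fun j => gpr (proj1 gN) j (f x))).
apply: gpr_big => [|j].
  by rewrite map_inj_uniq ?undup_uniq //; exact: addrI.
move=> /mapP jn; rewrite fE raddf_sum /= big1_seq // => e /andP[_ es].
have [_ dc] := cd e; rewrite (gpr_id _ _ (dc _ _ Gx)).
by case: eqP => // je; case: jn; exists e; rewrite ?mem_undup.
Qed.

(** A graded [f] has finitely many homogeneous parts. The parts of [g] in the same degrees already
    bound it, and their finite sum is graded. *)
Lemma cobound_ungraded i (f : P i.+1 -> N) (g : P i -> N) :
  graded_hom GP GN f -> linear g -> (forall x, f x = g (pr_diff P i x)) ->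
  coboundary GP GN f.
Proof.
move=> gf lg fE; have [s us sE] := graded_hom_gcomp gf.
exists (fun x => \sum_(j <- s) gc i j g x).
  by apply: graded_hom_sum => j; exact: hom_deg_gcomp.
move=> x; rewrite sE; apply: eq_bigr => j _.
rewrite -(gcomp_pre hG (gP i) gN (gP i.+1) j lg (GRing.linearP (pr_diff P i)) (@dP i)).
by congr (gcomp _ _ _ _ x); apply: funext.
Qed.

Lemma cobound_homog i (f : P i.+1 -> N) d : hom_deg GP GN d f ->
  coboundary GP GN f ->
  exists2 g : P i -> N, hom_deg GP GN d g & forall x, f x = g (pr_diff P i x).
Proof.
case=> lf fd [g gg fE]; have lg := graded_hom_linear gg.
exists (gc i d g); first exact: hom_deg_gcomp.
move=> x; rewrite -(gcomp_pre hG (gP i) gN (gP i.+1) d lg (GRing.linearP (pr_diff P i)) (@dP i)).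
rewrite -[LHS](gcomp_id hG (gP i.+1) gN lf fd x).
by congr (gcomp _ _ _ _ x); apply: funext.
Qed.

Lemma cocycle_gcomp i (f : P i -> N) d : linear f ->
  (forall x, f (pr_diff P i x) = 0) -> cocycle GP GN (gc i d f).
Proof.
move=> lf fd; split.
  exact: hom_deg_graded (hom_deg_gcomp d lf).
move=> x; rewrite -(gcomp_pre hG (gP i) gN (gP i.+1) d lf (GRing.linearP (pr_diff P i)) (@dP i)).
rewrite (_ : (fun x => _) = (fun=> 0)); last by apply: funext.
by rewrite /gcomp big1 // => j _; rewrite raddf0.
Qed.

End GradedExt.

Section GradedComplex.
Variables (R : nzRingType) (G : int -> R -> Prop) (hG : is_grading G).
Variables (M : lmodType R) (GM : int -> M -> Prop) (gM : graded_module G GM).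

Definition graded_complex (X : aug_complex M) (GX : forall i, int -> X i -> Prop) :=
  [/\ forall i, graded_module G (GX i),
      forall j x, GX 0%N j x -> GM j (ac_aug X x)
    & forall i j x, GX i.+1 j x -> GX i j (ac_diff X i x)].

(** The degree 0 parts of an ungraded lift still commute with the differentials, which are
    homogeneous of degree 0. *)
Lemma chain_lift_graded (X Y : aug_complex M) (GX : forall i, int -> X i -> Prop)
    (GY : forall i, int -> Y i -> Prop) N :
  (forall i, projective (X i)) -> graded_complex GX -> graded_complex GY ->
  exact_below Y N ->
  exists2 f : forall i, {linear X i -> Y i}, chain_map N f &
    forall i j x, GX i j x -> GY i j (f i x).
Proof.
move=> pX [gX aX dX] [gY aY dY] exY; have [f [augf df]] := chain_lift pX exY.
have linf i : linear (f i) by exact: linearP.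
pose g i := mklin (gcomp_linear hG (gX i) (gY i) (linf i) 0).
exists g; last first.
  by move=> i j x Gx; rewrite -[j in GY _ j]addr0; exact: gcomp_deg.
split=> [x|i iN x] /=.
  have := @gcomp_post _ _ hG _ _ _ _ (gX 0%N) (gY 0%N) _ _ gM (f 0%N) (ac_aug Y) 0 0
    (linf _) (GRing.linearP _).
  move=> <-; last by move=> l y Gy; rewrite addr0; exact: aY.
  rewrite addr0 (_ : (fun x => _) = ac_aug X); last by apply: funext.
  by rewrite (gcomp_id hG) //; [exact: linearP | move=> l y Gy; rewrite addr0; exact: aX].
have := @gcomp_post _ _ hG _ _ _ _ (gX i.+1) (gY i.+1) _ _ (gY i) (f i.+1) (ac_diff Y i) 0 0
  (linf _) (GRing.linearP _).
move=> <-; last by move=> l y Gy; rewrite addr0; exact: dY.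
rewrite addr0 -(@gcomp_pre _ _ hG _ _ _ _ (gX i) (gY i) _ _ (gX i.+1) (f i) (ac_diff X i) 0
  (linf i) (GRing.linearP _)); last by move=> l y; exact: dX.
by congr (gcomp _ _ _ _ x); apply: funext => y; rewrite df.
Qed.

Lemma exact_of_homog (U V W : lmodType R) (GU : int -> U -> Prop)
    (GV : int -> V -> Prop) (GW : int -> W -> Prop)
    (gU : graded_module G GU) (gV : graded_module G GV) (gW : graded_module G GW)
    (f : {linear U -> V}) (g : {linear V -> W}) :
  (forall j x, GV j x -> GW j (g x)) ->
  (forall j x, GV j x -> g x = 0 -> exists y, f y = x) ->
  forall x, g x = 0 -> exists y, f y = x.
Proof.
move=> gd ex x gx.
have /choice[c cE] : forall j, exists y, f y = gpr (proj1 gV) j x.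
  move=> j; apply: (ex j); first exact: gpr_grade.
  have gd' l y : GV l y -> GW (l + 0) (g y) by rewrite addr0; exact: gd.
  have <- := gpr_degree (proj1 gV) (proj1 gW) (linear_subr (GRing.linearP g)) gd' j x.
  by rewrite gx raddf0.
exists (\sum_(j <- gsupp (proj1 gV) x) c j).
by rewrite linear_sum [RHS](gpr_sum (proj1 gV) x); apply: eq_bigr => j _.
Qed.

End GradedComplex.

Section Rows.
Variables (R : nzRingType) (G : int -> R -> Prop) (hG : graded_ring G).
Let gG : is_grading G. Proof. by case: hG. Qed.

(** The grading of a free module whose i-th basis row sits in degree [dg i]. *)
Definition row_grade (p : nat) (dg : 'I_p -> int) (j : int) (z : 'rV[R]_p) : Prop :=
  forall i, G (j - dg i) (z 0 i).

Lemma row_graded p (dg : 'I_p -> int) :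
  graded_module G (row_grade dg : int -> ('rV[R]_p : lmodType R) -> Prop).
Proof.
split; last first.
  move=> i j a x Ga Gx l; rewrite mxE -addrA.
  by case: hG => _ _; apply.
pose pr j (z : 'rV[R]_p) : 'rV[R]_p := \row_i gpr gG (j - dg i) (z 0 i).
apply: (@is_grading_of_proj _ _ pr).
- by move=> j i; rewrite mxE; exact: grade0.
- by move=> j x y Gx Gy i; rewrite !mxE; exact: gradeB.
- by move=> j x y; apply/rowP => i; rewrite !mxE raddfB.
- move=> i j x Gx; apply/rowP => l; rewrite !mxE (gpr_id gG _ (Gx l)).
  by rewrite (inj_eq (addIr _)); case: eqP => // _; rewrite mxE.
- by move=> j x i; rewrite mxE; exact: gpr_grade.
- move=> x; pose s := undup (flatten [seq [seq j + dg i | j <- gsupp gG (x 0 i)] | i <- enum 'I_p]).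
  exists s; apply/rowP => i; rewrite summxE.
  under eq_bigr => j _ do rewrite mxE.
  rewrite -(big_map (fun j => j - dg i) xpredT (fun j => gpr gG j (x 0 i))).
  apply: gpr_big; first by rewrite map_inj_uniq ?undup_uniq //; exact: addIr.
  move=> j jn; apply: gpr_supp; apply: contra jn => js.
  apply/mapP; exists (j + dg i); last by rewrite addrK.
  rewrite mem_undup; apply/flattenP; exists [seq j + dg i | j <- gsupp gG (x 0 i)].
    by apply/mapP; exists i; rewrite ?mem_enum.
  by apply/mapP; exists j.
Qed.

Lemma row_mul_grade p q (dp : 'I_p -> int) (dq : 'I_q -> int) (A : 'M[R]_(p, q)) j z :
  (forall i l, G (dp i - dq l) (A i l)) ->
  row_grade dp j z -> row_grade dq j (z *m A).
Proof.
move=> GA Gz l; rewrite mxE; apply: (grade_sum gG) => i _.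
rewrite (_ : j - dq l = (j - dp i) + (dp i - dq l)); last by rewrite addrA subrK.
by case: hG => _ _; apply.
Qed.

End Rows.

Section TrivialModule.
Variables (k : fieldType) (A : algType k) (G : int -> A -> Prop).
Variables (K : lmodType A) (e : K).
Hypothesis hK : trivial_module G e.

Lemma trivial_graded : graded_module G (@trivial_grade K : int -> K -> Prop).
Proof.
split; last first.
  case: hK => e0 span kill i j a x Ga [->|->]; last by right; rewrite scaler0.
  have [->|i0] := eqVneq i 0; first by left; rewrite addr0.
  right; have [c ->] := span x; rewrite scalerA mulr_algr -mulr_algl.
  by rewrite -scalerA (kill i a i0 Ga) scaler0.
apply: (@is_grading_of_proj _ _ (fun j x => if j == 0 then x else 0)).
- by move=> j; right.
- by move=> j x y [->|->] [|->]; rewrite ?subr0; [left|left|left|right].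
- by move=> j x y; case: ifP => // _; rewrite subr0.
- move=> i j x [->|->]; first by [].
  by rewrite !if_same.
- by move=> j x; rewrite /trivial_grade; case: eqP; [left|right].
- by move=> x; exists [:: 0]; rewrite big_seq1 eqxx.
Qed.

Lemma trivial_scal c : c%:A *: e = 0 -> c = 0.
Proof.
case: hK => e0 _ _ h; apply/eqP; apply: contraNT e0 => c0.
have : (c^-1)%:A *: (c%:A *: e) = 0 by rewrite h scaler0.
by rewrite scalerA -scalerAl mul1r scalerA mulVf // !scale1r => ->.
Qed.

End TrivialModule.

(** * Connected graded algebras given by generators and relations *)

(** The common interface of A and D: finitely many homogeneous relations, each with its own degree,
    since those of D live in degrees m and m + 1. *)
Record presented (k : fieldType) (n p : nat) (T : word_algebra k n) (B : algType k)
    (pi : {lrmorphism T -> B}) (r : 'I_p -> T) (dr : 'I_p -> int)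
    (G : int -> B -> Prop) : Prop := Presented {
  pres_surj : forall b, exists f, pi f = b;
  pres_ker : forall f, pi f = 0 <-> exists (N : nat) (a b : 'I_N -> T) (l : 'I_N -> 'I_p),
    f = \sum_i a i * r (l i) * b i;
  pres_deg : forall i, hgrade (dr i) (r i);
  pres_pos : forall i, 0 < dr i;
  pres_G : forall j b, G j b <-> exists2 f, hgrade j f & pi f = b;
  pres_conn : connected_graded G
}.

Section Presentation.
Variables (k : fieldType) (n p : nat) (T : word_algebra k n) (B : algType k).
Variables (pi : {lrmorphism T -> B}) (r : 'I_p -> T) (dr : 'I_p -> int).
Variable G : int -> B -> Prop.
Hypothesis hP : presented pi r dr G.
Local Notation x := (wgen T).
Local Notation X i := (pi (wgen T i)).

Lemma pres_ring : graded_ring G. Proof. by case: (pres_conn hP). Qed.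
Lemma pres_grading : is_grading G. Proof. by case: pres_ring. Qed.
Lemma pres_mul i j a b : G i a -> G j b -> G (i + j) (a * b).
Proof. by case: pres_ring => _ _; apply. Qed.
Lemma pres_neg j a : j < 0 -> G j a -> a = 0.
Proof. by case: (pres_conn hP) => _ + _; apply. Qed.
Lemma pres_zero a : G 0 a -> exists c, a = c%:A.
Proof. by case: (pres_conn hP) => _ _ /(_ a)[+ _]. Qed.
Lemma pres_scal c : G 0 c%:A.
Proof. by case: (pres_conn hP) => _ _ /(_ c%:A)[_]; apply; exists c. Qed.
Lemma pres_pi j f : hgrade j f -> G j (pi f).
Proof. by move=> hf; apply/(pres_G hP); exists f. Qed.
Lemma pres_gen i : G 1 (X i).
Proof. by apply: pres_pi; exact: hgrade_gen. Qed.
Lemma pres_lift j b : G j b -> exists2 f, hgrade j f & pi f = b.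
Proof. by move/(pres_G hP). Qed.
Lemma pres_scale j c b : G j b -> G j (c *: b).
Proof.
move=> Gb; rewrite -mulr_algl -[j]add0r; apply: pres_mul => //; exact: pres_scal.
Qed.

(** Multiplication by a nonempty word raises the degree, so up to the degree of f only the constant
    terms of a and b contribute. *)
Lemma hcomp_mul3 (j d : int) (a b f : T) : j <= d -> hgrade d f ->
  hcomp j (a * f * b) = ((j == d)%:R * (aug a * aug b)) *: f.
Proof.
move=> jd hf; move: a b; apply: (@eq_on_words2 _ _ _ _ (fun a b => hcomp j (a * f * b))
  (fun a b => ((j == d)%:R * (aug a * aug b)) *: f)).
- by move=> h c a b; rewrite !mulrDl -!scalerAl linearP.
- by move=> h c a b; rewrite !mulrDr -!scalerAr linearP.
- by move=> h c a b; rewrite linearP scalerA -scalerDl; congr (_ *: _);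
    rewrite /= /GRing.scale /=; ring.
- by move=> h c a b; rewrite linearP scalerA -scalerDl; congr (_ *: _);
    rewrite /= /GRing.scale /=; ring.
move=> s t; have hst := hgradeM (hgradeM (hgrade_word T s) hf) (hgrade_word T t).
rewrite (hcomp_grade _ hst) !aug_word.
case: s hst => [|i s] hst; last first.
  rewrite mul0r mulr0 scale0r lt_eqF ?scale0r //= (le_lt_trans jd) //.
  rewrite -addrA [_ + (d + _)]addrCA -[ltLHS]addr0 ltrD2l.
  by rewrite -PoszD ltz_nat addSn.
case: t hst => [|i t] hst; last first.
  rewrite !mulr0 scale0r lt_eqF ?scale0r //= (le_lt_trans jd) //.
  by rewrite add0r -[ltLHS]addr0 ltrD2l ltz_nat.
by rewrite /= add0r addr0 !mulr1 wa_nil mul1r mulr1.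
Qed.

(** Up to the smallest degree of a relation, the ideal is just the linear span of the relations:
    multiples by words of positive length lie higher. *)
Lemma pres_low j f : (forall i, j <= dr i) -> hgrade j f -> pi f = 0 ->
  exists c : 'I_p -> k, f = \sum_i c i *: r i /\ forall i, j < dr i -> c i = 0.
Proof.
move=> jd hf /(pres_ker hP)[N [a [b [l fE]]]].
exists (fun i => \sum_(t < N | l t == i) (j == dr i)%:R * (aug (a t) * aug (b t))); split.
  rewrite -hf fE linear_sum /=.
  under eq_bigr => t _ do rewrite (hcomp_mul3 _ _ (jd (l t)) (pres_deg hP (l t))).
  rewrite (partition_big l xpredT) //=; apply: eq_bigr => i _.
  by rewrite scaler_suml; apply: eq_bigr => t /eqP->.
by move=> i ji; rewrite big1 // => t _; rewrite lt_eqF // mul0r.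
Qed.

Lemma pres_inj j f : (forall i, j < dr i) -> hgrade j f -> pi f = 0 -> f = 0.
Proof.
move=> jd hf pf; have [|c [-> c0]] := pres_low _ hf pf; first by move=> i; apply/ltW.
by rewrite big1 // => i _; rewrite c0 // scale0r.
Qed.

(** In a term a r b of the ideal, the right part of b comes with the factor a r, which is 0 in B.
    Only the constant term of b and the right parts of r survive. *)
Lemma pres_rpart f : pi f = 0 ->
  exists c : 'I_p -> B, forall j, pi (rpart j f) = \sum_i c i * pi (rpart j (r i)).
Proof.
move/(pres_ker hP) => [N [a [b [l ->]]]].
exists (fun i => \sum_(t < N | l t == i) (aug (b t) : k) *: pi (a t)) => j.
rewrite !linear_sum /= (partition_big l xpredT) //=; apply: eq_bigr => i _.
rewrite mulr_suml; apply: eq_bigr => t /eqP lt.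
rewrite !rpartM linearD linearZ /= rmorphM /=.
have -> : pi (a t * r (l t)) = 0.
  rewrite rmorphM /=; have -> : pi (r (l t)) = 0; last by rewrite mulr0.
  by apply/(pres_ker hP); exists 1%N, (fun=> 1), (fun=> 1), (fun=> l t); rewrite big_ord1 mul1r mulr1.
rewrite mul0r add0r; have -> : aug (r (l t)) = 0.
  by apply: hgrade_aug (pres_deg hP _); rewrite gt_eqF // (pres_pos hP).
by rewrite scale0r addr0 lt rmorphM /= scalerAl.
Qed.

Lemma pres_lpart f : pi f = 0 ->
  exists c : 'I_p -> B, forall j, pi (lpart j f) = \sum_i pi (lpart j (r i)) * c i.
Proof.
move/(pres_ker hP) => [N [a [b [l ->]]]].
exists (fun i => \sum_(t < N | l t == i) (aug (a t) : k) *: pi (b t)) => j.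
rewrite !linear_sum /= (partition_big l xpredT) //=; apply: eq_bigr => i _.
rewrite mulr_sumr; apply: eq_bigr => t /eqP lt.
rewrite -mulrA lpartM linearD linearZ /= rmorphM /=.
have -> : pi (r (l t) * b t) = 0.
  rewrite rmorphM /=; have -> : pi (r (l t)) = 0; last by rewrite mul0r.
  by apply/(pres_ker hP); exists 1%N, (fun=> 1), (fun=> 1), (fun=> l t); rewrite big_ord1 mul1r mulr1.
rewrite mulr0 add0r lpartM; have -> : aug (r (l t)) = 0.
  by apply: hgrade_aug (pres_deg hP _); rewrite gt_eqF // (pres_pos hP).
by rewrite scale0r addr0 lt rmorphM /= scalerAr.
Qed.

(** Lifting the b_i to f_i, the element \sum_i x_i f_i is in the ideal and its left parts are the
    f_i, so [pres_lpart] applies. The coefficients are then cut down to the required degree. *)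
Lemma pres_right d (b : 'I_n -> B) : (forall i, G d (b i)) -> \sum_i X i * b i = 0 ->
  exists2 c : 'I_p -> B, forall i, G (d + 1 - dr i) (c i) &
    forall j, b j = \sum_i pi (lpart j (r i)) * c i.
Proof.
move=> Gb sum0; have /choice[f fE] : forall i, exists f, pi f = b i by move=> i; exact: (pres_surj hP).
have [|c cE] := @pres_lpart (\sum_i x i * f i).
  by rewrite linear_sum /= -[RHS]sum0; apply: eq_bigr => i _; rewrite rmorphM /= fE.
exists (fun i => gpr pres_grading (d + 1 - dr i) (c i)); first by move=> i; exact: gpr_grade.
move=> j; have := cE j; rewrite lpart_sum fE => bE.
have /(gpr_gradeP pres_grading) <- := Gb j; rewrite bE raddf_sum /=.
apply: eq_bigr => i _.
have Gp : G (dr i - 1) (pi (lpart j (r i))).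
  by apply: pres_pi; apply: hgrade_lpart; rewrite subrK; exact: pres_deg hP i.
have mB : {morph (fun z => pi (lpart j (r i)) * z) : u v / u - v}.
  by move=> u v; rewrite mulrBr.
have md l y : G l y -> G (l + (dr i - 1)) (pi (lpart j (r i)) * y).
  by move=> Gy; rewrite addrC; exact: pres_mul.
rewrite -(gpr_degree pres_grading pres_grading mB md (d + 1 - dr i) (c i)).
by rewrite addrA subrK addrK.
Qed.

Lemma pres_pos_gen d b : 0 < d -> G d b ->
  exists2 c : 'I_n -> B, forall i, G (d - 1) (c i) & b = \sum_i X i * c i.
Proof.
move=> d0 /pres_lift[f hf <-]; exists (fun i => pi (lpart i f)).
  by move=> i; apply: pres_pi; apply: hgrade_lpart; rewrite subrK.
rewrite {1}(lpart_decomp f) (hgrade_aug _ hf) ?gt_eqF // scale0r add0r linear_sum.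
by apply: eq_bigr => i _; rewrite rmorphM.
Qed.

Section PartialResolution.
Variables (K : lmodType B) (e : K).
Hypothesis hK : trivial_module G e.

(** The start of a free resolution of the trivial module by rows: one generator, then the x_i, then
    the relations. It is continued by 0, being exact only in places 0 and 1. *)
Definition lres_rk (i : nat) : nat :=
  match i with 0 => 1 | 1 => n | 2 => p | _ => 0 end%N.

Definition lres_deg (i : nat) : 'I_(lres_rk i) -> int :=
  match i return 'I_(lres_rk i) -> int with
  | 0%N => fun=> 0 | 1%N => fun=> 1 | 2%N => dr | _ => fun=> 0 end.

Definition lres_gens : 'M[B]_(n, 1) := \matrix_(i, j) X i.
Definition lres_rels : 'M[B]_(p, n) := \matrix_(i, j) pi (rpart j (r i)).

Definition lres_mat (i : nat) : 'M[B]_(lres_rk i.+1, lres_rk i) :=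
  match i return 'M[B]_(lres_rk i.+1, lres_rk i) with
  | 0%N => lres_gens | 1%N => lres_rels | _ => 0 end.

Lemma row_mul_linear (u v : nat) (A : 'M[B]_(u, v)) :
  linear (fun z : 'rV[B]_u => z *m A : ('rV[B]_v : lmodType B)).
Proof. by move=> a y z; rewrite mulmxDl scalemxAl. Qed.

Definition lres_mod (i : nat) : lmodType B := 'rV[B]_(lres_rk i).
Definition lres_diff i : {linear lres_mod i.+1 -> lres_mod i} :=
  mklin (row_mul_linear (lres_mat i)).
Definition lres_aug_fun (z : lres_mod 0) : K := (z 0 0 : B) *: e.
Lemma lres_aug_linear : linear lres_aug_fun.
Proof. by move=> a y z; rewrite /lres_aug_fun !mxE scalerDl scalerA. Qed.
Definition lres_aug : {linear lres_mod 0 -> K} := mklin lres_aug_linear.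

Lemma pi_rel i : pi (r i) = 0.
Proof.
by apply/(pres_ker hP); exists 1%N, (fun=> 1), (fun=> 1), (fun=> i); rewrite big_ord1 mul1r mulr1.
Qed.

Lemma rel_decomp i : \sum_j pi (rpart j (r i)) * X j = 0.
Proof.
rewrite -[RHS](pi_rel i) {2}(rpart_decomp (r i)).
rewrite (hgrade_aug _ (pres_deg hP i)) ?gt_eqF ?(pres_pos hP) // scale0r add0r linear_sum.
by apply: eq_bigr => j _; rewrite rmorphM.
Qed.

Lemma lres_augd z : lres_aug (lres_diff 0 z) = 0.
Proof.
rewrite /= /lres_aug_fun mxE scaler_suml big1 // => i _.
rewrite mxE -scalerA; case: hK => _ _ kill.
by rewrite (kill 1) ?scaler0 //; exact: pres_gen.
Qed.

Lemma lres_dd i z : lres_diff i (lres_diff i.+1 z) = 0.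
Proof.
rewrite /= -mulmxA; case: i z => [|i] z; last by rewrite mul0mx mulmx0.
suff -> : lres_mat 1 *m lres_mat 0 = 0 by rewrite mulmx0.
apply/matrixP => i j; rewrite !mxE -[RHS](rel_decomp i).
by apply: eq_bigr => t _; rewrite !mxE.
Qed.

Definition lres : aug_complex K := AugComplex lres_augd lres_dd.

Definition lres_grade i : int -> lres i -> Prop := row_grade G (@lres_deg i).

Lemma lres_graded : graded_complex G (@trivial_grade K) lres_grade.
Proof.
split.
- by move=> i; exact: (row_graded pres_ring).
- move=> j z /(_ ord0) /=; rewrite subr0 => Gz; rewrite /trivial_grade /lres_aug_fun.
  have [->|j0] := eqVneq j 0; first by left.
  by right; case: hK => _ _ kill; exact: kill Gz.
- case=> [|[|i]] j z Gz; apply: (row_mul_grade pres_ring _ Gz) => u v /=.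
  + by rewrite subr0 mxE; exact: pres_gen.
  + by rewrite mxE; apply: pres_pi; apply: hgrade_rpart; rewrite subrK; exact: pres_deg hP u.
  + by rewrite mxE; exact: grade0 pres_grading _.
Qed.

Lemma lres_proj i : projective (lres i).
Proof. exact: row_projective. Qed.

(** Place 0: an element killing [e] has no constant term, hence is a left combination of the
    generators. Place 1 is [pres_rpart]. *)
Lemma lres_exact : exact_below lres 2.
Proof.
have [e0 span kill] := hK.
split=> [y|_ z /=|i]; last (case: i => // _ z /=; rewrite -[z *m _]/(z *m lres_gens)).
- have [c ->] := span y; exists (\row_i c%:A); by rewrite /= /lres_aug_fun mxE.
- have [f fE] := pres_surj hP (z 0 0); rewrite /lres_aug_fun -fE {1}(rpart_decomp f).
  rewrite linearD scalerDl linear_sum /= scaler_suml big1 ?addr0; last first.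
    move=> i _; rewrite rmorphM /= -scalerA (kill 1) ?scaler0 //; exact: pres_gen.
  rewrite linearZ /= rmorph1 => /(trivial_scal hK) f0.
  exists (\row_i pi (rpart i f)); apply/rowP => j; rewrite ord1 mxE -fE.
  rewrite [in RHS](rpart_decomp f) f0 scale0r add0r linear_sum.
  by apply: eq_bigr => i _; rewrite !mxE rmorphM.
move=> zx0; have /choice[f fE] : forall i, exists f, pi f = z 0 i by move=> i; exact: (pres_surj hP).
have [|c cE] := @pres_rpart (\sum_i f i * x i).
  have := congr1 (fun M : 'rV_1 => M 0 0) zx0; rewrite !mxE => <-.
  by rewrite linear_sum; apply: eq_bigr => i _; rewrite rmorphM /= fE mxE.
exists (\row_i c i); apply/rowP => j; rewrite mxE -fE -(rpart_sum f j) cE.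
by apply: eq_bigr => i _; rewrite !mxE.
Qed.

End PartialResolution.
End Presentation.

Lemma regular_graded (R : nzRingType) (G : int -> R -> Prop) :
  graded_ring G -> graded_module G (G : int -> R^o -> Prop).
Proof. by case=> hG _ GM; split=> // i j a x; exact: GM. Qed.

(** * Consequences of Ext^0 = 0 and Ext^1 = 0 *)

Section LowExt.
Variables (k : fieldType) (n p : nat) (T : word_algebra k n) (B : algType k).
Variables (pi : {lrmorphism T -> B}) (r : 'I_p -> T) (dr : 'I_p -> int).
Variable G : int -> B -> Prop.
Hypothesis hP : presented pi r dr G.
Variables (K : lmodType B) (e : K) (P : proj_resolution K).
Variable GP : forall i, int -> P i -> Prop.
Arguments GP : clear implicits.
Hypotheses (hK : trivial_module G e) (gP : graded_resolution G (@trivial_grade K) GP).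
Local Notation X i := (pi (wgen T i)).
Local Notation L := (lres hP hK).
Local Notation LP := (complex_of_res P).
Local Notation GB := (G : int -> B^o -> Prop).

Let gK := trivial_graded hK.
Let gG : is_grading G := pres_grading hP.

Lemma to_lres : exists2 f : forall i, {linear P i -> L i}, @chain_map _ _ LP L 2 f &
  forall i j x, GP i j x -> lres_grade (hP := hP) (hK := hK) j (f i x).
Proof.
apply: (chain_lift_graded gG gK (X := LP)).
- by move=> i; exact: pr_proj.
- exact: gP.
- exact: lres_graded.
- exact: lres_exact.
Qed.

(** P is exact everywhere, so the bound 5 is only a convenient large number; in the other direction
    2 is the limit set by [lres_exact]. *)
Lemma from_lres : exists2 f : forall i, {linear L i -> P i}, @chain_map _ _ L LP 5 f &
  forall i j x, lres_grade (hP := hP) (hK := hK) j x -> GP i j (f i x).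
Proof.
apply: (chain_lift_graded gG gK (Y := LP)).
- exact: lres_proj.
- exact: lres_graded.
- exact: gP.
- exact: res_exact.
Qed.

Lemma lres_homotopy (f : forall i, {linear P i -> L i}) (g : forall i, {linear L i -> P i}) :
  @chain_map _ _ LP L 2 f -> @chain_map _ _ L LP 5 g ->
  exists s, @homotopy_of _ _ L L 2 (fun i x => f i (g i x) - x) s.
Proof.
move=> [fa fd] [ga gd]; apply: chain_homotopy.
- exact: lres_proj.
- exact: lres_exact.
- by move=> i a x y; rewrite (linearP (g i)) (linearP (f i)) scalerBr opprD addrACA.
- by move=> x; rewrite linearB fa ga subrr.
- move=> i i2 x; rewrite linearB fd 1?ltnW // gd //.
  by case: i i2 {x}.
Qed.

Let gB : graded_module G GB := regular_graded (pres_ring hP).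

(** Ext^0(k, B) consists of the elements killed by all generators. Such a [c] gives the cocycle z
    |-> z c on [lres]. Pulled back to P it vanishes, and the homotopy from the round trip to the
    identity brings this back to [lres]. *)
Lemma ext0_socle c d : ext_vanishes GP GB 0 -> G d c -> (forall i, X i * c = 0) -> c = 0.
Proof.
move=> ext0 Gc Xc; have [f fch fg] := to_lres; have [g gch _] := from_lres.
have [s [s0 _]] := lres_homotopy fch gch.
pose h (z : L 0%N) : B^o := z 0 0 * c.
have lh : linear h by move=> a y z; rewrite /h !mxE mulrDl -mulrA.
have hd z : h (ac_diff L 0 z) = 0.
  rewrite /h /= !mxE mulr_suml big1 // => i _; by rewrite mxE -mulrA Xc mulr0.
have hfd : hom_deg GP GB d (fun x => h (f 0%N x)).
  split=> [a y z|l y Gy]; first by rewrite linearP lh.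
  apply: (pres_mul hP) => //; have := fg _ _ _ Gy ord0; by rewrite subr0.
have coc : cocycle GP GB (fun x => h (f 0%N x)).
  split; first exact: (hom_deg_graded gB hfd).
  by move=> y; have [_ /(_ 0%N isT y)] := fch => /= <-; exact: hd.
have f0 := ext0 _ coc.
pose z : L 0%N := const_mx 1.
have := s0 isT z => /(congr1 h); rewrite hd.
rewrite -[h _]/(mklin lh _) linearB /= f0 sub0r /h mxE mul1r => /eqP.
by rewrite oppr_eq0 => /eqP.
Qed.

(** A column killed by the relation matrix is a 1-cocycle on [lres]. Transporting it to P and back
    exhibits it as a coboundary, that is, as the column of generators times one element. *)
Lemma ext1_column (a : 'I_n -> B) d : ext_vanishes GP GB 1 -> (forall i, G d (a i)) ->
  (forall t, \sum_j pi (rpart j (r t)) * a j = 0) ->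
  exists2 c, G (d - 1) c & forall j, a j = X j * c.
Proof.
move=> ext1 Ga ra; have [f fch fg] := to_lres; have [g gch _] := from_lres.
have [s [s0 s1]] := lres_homotopy fch gch.
pose h (z : L 1%N) : B^o := \sum_j z 0 j * a j.
have lh : linear h.
  move=> b y z; rewrite /h scaler_sumr -big_split; apply: eq_bigr => j _ /=.
  by rewrite !mxE mulrDl -mulrA.
have hd z : h (ac_diff L 1 z) = 0.
  rewrite /h /=; under eq_bigr => j _ do rewrite mxE mulr_suml.
  rewrite exchange_big big1 //= => t _; under eq_bigr => j _ do rewrite mxE -mulrA.
  by rewrite -mulr_sumr ra mulr0.
have hfd : hom_deg GP GB (d - 1) (fun x => h (f 1%N x)).
  split=> [b y z|l y Gy]; first by rewrite linearP lh.
  apply: (grade_sum gG) => j _; rewrite addrA.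
  have -> : l + d - 1 = (l - 1) + d by rewrite addrAC.
  by apply: (pres_mul hP) => //; exact: (fg _ _ _ Gy).
have coc : cocycle GP GB (fun x => h (f 1%N x)).
  split; first exact: (hom_deg_graded gB hfd).
  by move=> y; have [_ /(_ 1%N isT y)] := fch => /= <-; exact: hd.
have [u gu uE] := ext1 _ coc; have lu := graded_hom_linear gu.
pose h0 z := mklin lu (g 0%N z) - mklin lh (s 0%N z).
have h0l : linear h0.
  move=> b y z; rewrite /h0 (linearP (g 0%N)) (linearP (s 0%N)).
    by rewrite (linearP (mklin lu)) (linearP (mklin lh)) scalerBr opprD addrACA.
have key z : h z = h0 (ac_diff L 0 z).
  have := s1 0%N isT z => /(congr1 (mklin lh)); rewrite linearB linearD /= hd add0r uE.
  have [_ /(_ 0%N isT z)] := gch => /= -> /eqP; rewrite subr_eq => /eqP E.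
  by rewrite /h0 /= E addrC addKr.
exists (gpr gG (d - 1) (h0 (const_mx 1))); first exact: gpr_grade.
move=> j; have := key (delta_mx 0 j).
have -> : h (delta_mx 0 j) = a j.
  rewrite /h (bigD1 j) //= mxE !eqxx mul1r big1 ?addr0 // => i /negbTE ij.
  by rewrite mxE ij andbF mul0r.
have -> : ac_diff L 0 (delta_mx 0 j) = X j *: (const_mx 1 : L 0%N).
  by apply/rowP => i; rewrite /= -rowE !mxE mulr1.
rewrite -[h0 _]/(mklin h0l _) linearZ /= => aE.
have /(gpr_gradeP gG) <- := Ga j; rewrite aE.
have mB : {morph (fun z => X j * z) : y z / y - z} by move=> y z; rewrite mulrBr.
have md l y : G l y -> G (l + 1) (X j * y).
  by move=> Gy; rewrite addrC; apply: (pres_mul hP) => //; exact: pres_gen hP _.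
by rewrite -(gpr_degree gG gG mB md (d - 1)) subrK.
Qed.

End LowExt.

(** * The top Ext group of the trivial module *)

(** The d-th syzygy is projective. Indeed the round trip through a resolution of length d kills
    boundaries in P d, because it factors through the zero term of degree d + 1 there; correcting it
    by the homotopy gives [rho]. *)
Lemma syzygy_retraction (R : nzRingType) (M : lmodType R) (P : proj_resolution M) d :
  pd_le M d -> exists rho : {linear P d -> P d},
    (forall x, rho (pr_diff P d x) = 0) /\
    forall x, exists y, rho x - x = pr_diff P d y.
Proof.
case=> Q Q0; pose LP := complex_of_res P; pose LQ := complex_of_res Q.
have [al [ala ald]] := @chain_lift _ _ LP LQ d.+2 (@pr_proj _ _ P) (res_exact Q _).
have [be [bea bed]] := @chain_lift _ _ LQ LP d.+2 (@pr_proj _ _ Q) (res_exact P _).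
have [|||s [s0 sS]] := @chain_homotopy _ _ LP LP d.+2 (@pr_proj _ _ P)
    (fun i x => be i (al i x) - x) (res_exact P _).
- by move=> i a x y; rewrite (linearP (al i)) (linearP (be i)) scalerBr opprD addrACA.
- by move=> x; rewrite linearB /= bea ala subrr.
- move=> i i2 x; rewrite linearB /= -[pr_diff P i]/(ac_diff LP i).
  by rewrite bed 1?ltnW // ald // ltnW.
have lr : linear (fun x => x + pr_diff P d (s d x)).
  by move=> a x y; rewrite (linearP (s d)) (linearP (pr_diff P d)) scalerDr addrACA.
exists (mklin lr); split=> [x|x] /=; last first.
  by exists (s d x); rewrite addrC addKr.
have bal : be d (al d (pr_diff P d x)) = 0.
  rewrite -[pr_diff P d x]/(ac_diff LP d x) -ald //.
  by rewrite (Q0 d.+1 _ (al d.+1 x)) // linear0 linear0.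
case: d Q0 s s0 sS lr x bal ald bed => [|d] Q0 s s0 sS lr x bal ald bed.
  by have := s0 isT (pr_diff P 0 x); rewrite bal sub0r /= => <-; rewrite addrN.
have := sS d (leqnSn d.+2) (pr_diff P d.+1 x); rewrite bal sub0r /=.
by rewrite res_dd linear0 addr0 => <-; rewrite addrN.
Qed.

Section TopExt.
Variables (k : fieldType) (n p : nat) (T : word_algebra k n) (B : algType k).
Variables (pi : {lrmorphism T -> B}) (r : 'I_p -> T) (dr : 'I_p -> int).
Variable G : int -> B -> Prop.
Hypothesis hP : presented pi r dr G.
Variables (K : lmodType B) (e : K) (P : proj_resolution K).
Variable GP : forall i, int -> P i -> Prop.
Arguments GP : clear implicits.
Hypotheses (hK : trivial_module G e) (gP : graded_resolution G (@trivial_grade K) GP).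
Local Notation X i := (pi (wgen T i)).
Local Notation L := (lres hP hK).
Local Notation LP := (complex_of_res P).
Local Notation GB := (G : int -> B^o -> Prop).
Variables (d : nat) (phi : (P d.+1 -> B^o) -> k).
Hypothesis phi0 : forall f, cocycle GP GB f -> (phi f = 0 <-> coboundary GP GB f).
Hypothesis phiD : forall f g, cocycle GP GB f -> cocycle GP GB g ->
  phi (f \+ g) = phi f + phi g.
Hypothesis phiM : forall f j a, cocycle GP GB f -> j != 0 -> G j a ->
  phi (fun x => (f x : B) * a) = 0.
Hypothesis pdK : pd_le K d.+1.

Let gG : is_grading G := pres_grading hP.
Let gB : graded_module G GB := regular_graded (pres_ring hP).
Let gP1 i : graded_module G (GP i). Proof. by case: gP. Qed.
Let gPd i j x : GP i.+1 j x -> GP i j (pr_diff P i x). Proof. by case: gP => _ _; apply. Qed.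

Lemma killed_by_gens (b : B) : b *: e = 0 -> exists c : 'I_n -> B, b = \sum_j c j * X j.
Proof.
move=> be; have [_ ex0 _] := lres_exact hP hK.
have [|z zE] := ex0 isT (const_mx b); first by rewrite /= /lres_aug_fun mxE.
exists (fun j => z 0 j); move/rowP: zE => /(_ 0); rewrite !mxE => <-.
by apply: eq_bigr => j _; rewrite mxE.
Qed.

(** If f composed with B -> k is a coboundary, then f minus a coboundary has values in the left
    ideal of the x_j. So the class of f is a sum of classes multiplied on the right by x_j, and
    [phiM] kills those. *)
Lemma phi_eq0_of_trivial (f : P d.+1 -> B^o) D (th : P d -> K) :
  hom_deg GP GB D f -> cocycle GP GB f -> linear th ->
  (forall x, (f x : B) *: e = th (pr_diff P d x)) -> phi f = 0.
Proof.
move=> [lf fD] [gf fd] lth thE.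
have lmul : linear (fun b : B^o => (b : B) *: e).
  by move=> a x y; rewrite scalerDl scalerA.
have [z|t tE] := @projective_lift _ _ _ _ (mklin lmul) th (@pr_proj _ _ P d) lth.
  by have [_ span _] := hK; have [c ->] := span (th z); exists c%:A.
pose f' x := f x - t (pr_diff P d x).
have lf' : linear f'.
  by move=> a x y; rewrite /f' lf (linearP (pr_diff P d)) (linearP t) scalerBr opprD addrACA.
have lrow : linear (fun z : 'rV[B]_n => \sum_j z 0 j * X j : B^o).
  move=> a y z; rewrite scaler_sumr -big_split; apply: eq_bigr => j _ /=.
  by rewrite !mxE mulrDl -mulrA.
have [x|F FE] := @projective_lift _ _ _ _ (mklin lrow) f' (@pr_proj _ _ P d.+1) lf'.
  have [|c cE] := killed_by_gens (b := f' x).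
    rewrite /f' scalerBl thE; have /= -> := tE (pr_diff P d x).
    exact: subrr.
  exists (\row_j c j); rewrite /= -[RHS]/(f' x : B) cE.
  by apply: eq_bigr => j _; rewrite mxE.
(* The coordinates of F need not be cocycles. Composed with [rho] they are, and f' is unaffected
   because it vanishes on boundaries. *)
have [rho [rd rx]] := syzygy_retraction P pdK.
pose c j := fun x => F (rho x) 0 j : B^o.
have lc j : linear (c j) by move=> a x y; rewrite /c (linearP rho) (linearP F) !mxE.
have fE x : f x = t (pr_diff P d x) + \sum_j (c j x : B) * X j.
  have [y yE] := rx x; have -> : \sum_j (c j x : B) * X j = f' (rho x) by exact: FE.
  have rE : rho x = x + pr_diff P d.+1 y by rewrite -yE addrC subrK.
  rewrite /f' rE -[f (x + _)]/(mklin lf (x + _)) linearD /= fd addr0.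
  by rewrite linearD /= res_dd addr0 addrC subrK.
have lt : linear (fun x => t (pr_diff P d x)).
  by move=> a x y; rewrite (linearP (pr_diff P d)) (linearP t).
pose gc i := gcomp (gP1 i) gB.
pose cc j := gc d.+1 (D - 1) (c j).
have ccc j : cocycle GP GB (cc j).
  apply: (cocycle_gcomp gG gP1 gB gPd) => // x.
  by rewrite /c rd linear0 mxE.
have mX j : {morph (fun b : B^o => (b : B) * X j : B^o) : x y / x - y}.
  by move=> x y; rewrite mulrBl.
have mXd j l x : G l x -> G (l + 1) (x * X j).
  by move=> Gx; apply: (pres_mul hP) => //; exact: pres_gen hP _.
have lcX j : linear (fun x => (c j x : B) * X j : B^o).
  by move=> a x y; rewrite lc mulrDl -mulrA.
have cX j x : gc d.+1 D (fun x => (c j x : B) * X j) x = (cc j x : B) * X j.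
  have := @gcomp_post_add _ _ gG _ _ _ _ (gP1 d.+1) gB _ _ gB (c j) (fun b : B^o => (b : B) * X j) (D - 1) 1 (lc j) (lcX j) (mX j) (mXd j) x.
  by rewrite subrK.
have fE2 : f = (fun x => gc d D t (pr_diff P d x)) \+
             (fun x => \sum_j (cc j x : B) * X j).
  apply: funext => x; rewrite -[LHS](gcomp_id gG (gP1 d.+1) gB lf fD) /=.
  rewrite /gc -(gcomp_pre gG (gP1 d) gB (gP1 d.+1) D (GRing.linearP t) (GRing.linearP (pr_diff P d)) (@gPd d)).
  under eq_bigr => j _ do rewrite -cX.
  rewrite /gc -(@gcomp_sum _ _ _ _ _ _ (gP1 d.+1) gB _ (index_enum 'I_n)
    (fun j x => (c j x : B) * X j) D x) /gcomp -big_split /=; apply: eq_bigr => j _.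
  by rewrite fE raddfD.
have cob : coboundary GP GB (fun x => gc d D t (pr_diff P d x)).
  exists (gc d D t) => //; apply: (@hom_deg_graded _ _ _ _ GP _ _ gB _ _ D).
  by apply: (hom_deg_gcomp gG); exact: linearP.
have coc1 : cocycle GP GB (fun x => gc d D t (pr_diff P d x)).
  split; last first.
    move=> x; rewrite res_dd; exact: linear_pred0 (gcomp_linear gG _ _ (GRing.linearP t) D).
  apply: (@hom_deg_graded _ _ _ _ GP _ _ gB _ _ D); split.
    move=> a x y; rewrite (linearP (pr_diff P d)).
    by rewrite /gc (gcomp_linear gG (gP1 d) gB (GRing.linearP t) D).
  by move=> l x /gPd Gx; apply: gcomp_deg => //; exact: linearP.
have cccX j : cocycle GP GB (fun x => (cc j x : B) * X j).
  split; last by move=> x; rewrite (proj2 (ccc j)) mul0r.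
  apply: (@hom_deg_graded _ _ _ _ GP _ _ gB _ _ D); rewrite (_ : (fun x => _) = gc d.+1 D (fun x => (c j x : B) * X j)).
    exact: (hom_deg_gcomp gG).
  by apply: funext => x; rewrite cX.
have [coc2 phis] := ext_class_sum gB phi0 phiD (index_enum _) cccX.
rewrite fE2 (phiD coc1 coc2) phis.
rewrite ((phi0 coc1).2 cob) add0r big1 // => j _.
apply: (phiM (ccc j) (j := 1)) => //; exact: pres_gen hP _.
Qed.

Lemma act_split (U : lmodType B) (b : B) (x : U) :
  exists (c : k) (z : 'I_n -> U), b *: x = c%:A *: x + \sum_i X i *: z i /\
    b *: e = c%:A *: e.
Proof.
have [f <-] := pres_surj hP b; exists (aug f), (fun i => pi (lpart i f) *: x).
have fE : pi f = (aug f : k)%:A + \sum_i X i * pi (lpart i f).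
  rewrite {1}(lpart_decomp f) linearD linearZ /= rmorph1 linear_sum.
  by congr (_ + _); apply: eq_bigr => i _; rewrite rmorphM.
split.
  rewrite {1}fE scalerDl scaler_suml; congr (_ + _).
  by apply: eq_bigr => i _; rewrite scalerA.
have [f' f'E] : exists f', f = (aug f : k) *: 1 + \sum_i rpart i f' * wgen T i.
  by exists f; exact: rpart_decomp.
rewrite [in LHS]f'E linearD linearZ /= rmorph1 scalerDl linear_sum scaler_suml big1 ?addr0 //.
move=> i _; rewrite rmorphM /= -scalerA; have [_ _ kill] := hK.
by rewrite (kill 1) ?scaler0 //; exact: pres_gen hP _.
Qed.

(* A Zorn argument: a k-subspace of U that contains B_+ U, the image of the
   kernel of ph, and is maximal for avoiding dd y0, is a hyperplane. *)
Lemma trivial_extension (U V : lmodType B) (dd : {linear V -> U}) (ph : {linear V -> K}) :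
  (forall y z, dd y = \sum_i X i *: (z i : U) -> ph y = 0) ->
  exists th : {linear U -> K}, forall y, ph y = th (dd y).
Proof.
move=> ph0; have [e0 span kill] := hK.
have [allz|] := pselect (forall y, ph y = 0).
  exists (zero_lin _ _) => y; exact: allz.
move=> /existsNP[y0 /eqP phy0].
have [c0 c0E] := span (ph y0).
have c00 : c0 != 0 by apply: contraNneq phy0 => c00; rewrite c0E c00 scale0r scale0r.
pose S0 : U -> Prop := fun u => exists y z, ph y = 0 /\ u = dd y + \sum_i X i *: z i.
pose lin (A : U -> Prop) := forall c u v, A u -> A v -> A (c%:A *: u + v).
pose good (A : U -> Prop) := [/\ forall u, S0 u -> A u, lin A & ~ A (dd y0)].
have S0good : good S0.
  split=> //.
    move=> c u v [y [z [py ->]]] [y' [z' [py' ->]]].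
    exists (c%:A *: y + y'), (fun i => c%:A *: z i + z' i); split.
      by rewrite linearP py py' scaler0 addr0.
    rewrite linearP scalerDr addrACA; congr (_ + _).
    rewrite scaler_sumr -big_split; apply: eq_bigr => i _ /=.
    by rewrite scalerDr !scalerA mulr_algr mulr_algl.
  case=> y [z [py E]]; move: phy0; have : ph (y0 - y) = 0.
    by apply: (ph0 _ z); rewrite linearB /= E addrC addKr.
  by rewrite linearB /= py subr0 => ->; rewrite eqxx.
have S00 : S0 0.
  exists 0, (fun=> 0); rewrite !linear0 add0r big1 // => i _; exact: scaler0.
have [F FQ Ftot|A [Agood Amax]] := @classical_sets.Zorn_bigcup U
    (fun A => A = classical_sets.set0 \/ good A).
  have [allE|/existsNP[A0 /not_implyP[FA0 A0n]]] :=
      pselect (forall A, F A -> A = classical_sets.set0).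
    left; apply: funext => u; apply: propext; split=> // -[A FA Au].
    by rewrite (allE A FA) in Au.
  have gA A : F A -> (exists u, A u) -> good A.
    by move=> FA [u Au]; case: (FQ A FA) => // AE; rewrite AE in Au.
  have A0g : good A0 by case: (FQ A0 FA0).
  right; split.
  - by move=> u Su; exists A0 => //; case: A0g => + _ _; apply.
  - move=> c u v [A FA Au] [A' FA' Av].
    have gA1 : good A by apply: gA => //; exists u.
    have gA2 : good A' by apply: gA => //; exists v.
    case: (Ftot A A' FA FA') => sub.
      by exists A' => //; case: gA2 => _ + _; apply=> //; exact: sub.
    by exists A => //; case: gA1 => _ + _; apply=> //; exact: sub.
  - move=> [A FA Ay]; have [|_ _ /(_ Ay)//] := gA A FA; by exists (dd y0).
have {Agood} [A0 linA Ay0] : good A.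
  case: Agood => // AE; case: (Amax S0); last by right.
  split; first by rewrite AE => u.
  by move=> sub; have := sub 0 S00; rewrite AE.
have A00 : A 0 by exact: A0.
have AD u v : A u -> A v -> A (u + v).
  by move=> Au Av; have := linA 1 u v Au Av; rewrite !scale1r.
have AZ c u : A u -> A (c%:A *: u).
  by move=> Au; rewrite -[_ *: u]addr0; exact: linA.
have /choice[c cE] : forall u, exists c : k, A (u - c%:A *: dd y0).
  move=> u; have [Au|Au] := pselect (A u).
    by exists 0; rewrite !scale0r subr0.
  (* A' is A + k u. Either it contains dd y0, and then u is a multiple of dd y0 modulo A, or it
     contradicts the maximality of A. *)
  pose A' v := exists2 c : k, True & A (v - c%:A *: u).
  have [A'y|A'y] := pselect (A' (dd y0)).
    case: A'y => c _ Ac; have c1 : c != 0.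
      by apply: contra_notN Ay0 => /eqP c1; move: Ac; rewrite c1 !scale0r subr0.
    exists c^-1; have := AZ (- c^-1) _ Ac.
    rewrite scalerBr scalerA mulr_algl scalerA mulNr mulVf //.
    by rewrite !scaleN1r opprK !scaleNr addrC.
  case: (Amax A').
    split.
      by move=> v Av; exists 0 => //; rewrite !scale0r subr0.
    move=> sub; apply: Au; apply: sub; exists 1 => //.
    by rewrite scale1r scale1r subrr.
  right; split=> //.
    by move=> v /A0 Av; exists 0 => //; rewrite !scale0r subr0.
  move=> b v v' [c1 _ Ac1] [c2 _ Ac2]; exists (b * c1 + c2) => //.
  have -> : b%:A *: v + v' - (b * c1 + c2)%:A *: u =
      b%:A *: (v - c1%:A *: u) + (v' - c2%:A *: u).
    rewrite scalerBr !scalerA mulr_algl scalerA addrACA -opprD -scalerDl -scalerDl.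
    by [].
  exact: linA.
have cu u b : A (u - b%:A *: dd y0) -> c u = b.
  move=> Ab; apply/eqP; rewrite -subr_eq0; apply: contra_notT Ay0 => cb.
  have : A ((c u - b)^-1%:A *: ((u - b%:A *: dd y0) + (- (1 : k))%:A *: (u - (c u)%:A *: dd y0))).
    by apply: (AZ); apply: AD => //; exact: AZ.
  have -> : u - b%:A *: dd y0 + (- (1 : k))%:A *: (u - (c u)%:A *: dd y0) =
      (c u - b)%:A *: dd y0.
    by rewrite !scaleN1r opprB addrC addrA subrK !scalerBl.
  by rewrite scalerA mulr_algl scalerA mulVf // !scale1r.
(* c(u) is the coordinate of u along dd y0 modulo the hyperplane A, and ph y0 = c0 e fixes the
   scale. Linearity over B holds because A contains B_+ U. *)
have lth : linear (fun u => (c u * c0)%:A *: e).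
  move=> b u v; have [c' [z [bu be]]] := act_split b u.
  have bE t : b *: (t%:A *: e) = (t * c')%:A *: e.
    by rewrite scalerA mulr_algr -(mulr_algl t b) -[LHS]scalerA be scalerA mulr_algl scalerA.
  rewrite bE -scalerDl -scalerDl.
  congr (_ *: _ *: _).
  rewrite [c u * c0 * c']mulrC mulrA -mulrDl; congr (_ * _); apply: cu.
  have -> : b *: u + v - (c' * c u + c v)%:A *: dd y0 =
     (c'%:A *: (u - (c u)%:A *: dd y0) + (v - (c v)%:A *: dd y0)) + \sum_i X i *: z i.
    rewrite bu scalerBr scalerA mulr_algl scalerA scalerDl scalerDl opprD.
    rewrite !addrA -!(addrAC _ _ (\sum_i X i *: z i)); congr (_ + _).
    by rewrite -!addrA; congr (_ + _); rewrite addrCA.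
  apply: AD; first exact: linA.
  by apply: A0; exists 0, z; rewrite !linear0 add0r.
exists (mklin lth) => y /=; have [c' c'E] := span (ph y).
rewrite c'E; congr (_ *: _ *: _).
have -> : c (dd y) = c' / c0; last by rewrite mulfVK.
apply: cu; apply: A0; exists (y - (c' / c0)%:A *: y0), (fun=> 0); split.
  by rewrite linearB linearZ /= c'E c0E scalerA mulr_algl scalerA mulfVK // subrr.
have -> : dd (y - (c' / c0)%:A *: y0) = dd y - (c' / c0)%:A *: dd y0.
  by rewrite linearB; congr (_ - _); exact: linearZ.
by rewrite big1 ?addr0 // => i _; exact: scaler0.
Qed.

(** Otherwise f composed with B -> k would vanish on every y whose boundary lies in B_+ P_d. By
    [trivial_extension] it would extend over P_d, and [phi_eq0_of_trivial] would make the class of f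
    zero. *)
Lemma top_cycle : (exists2 f, cocycle GP GB f & phi f != 0) ->
  exists (D : int) (f : P d.+1 -> B^o) (y : P d.+1) (z : 'I_n -> P d) (c : k),
    [/\ hom_deg GP GB D f, cocycle GP GB f, GP d.+1 (- D) y & forall i, GP d (- D - 1) (z i)] /\
    [/\ pr_diff P d y = \sum_i X i *: z i, f y = c%:A & c != 0].
Proof.
move=> [f0 cf0 phi_f0]; have lf0 := graded_hom_linear (proj1 cf0).
have [s us fE] := graded_hom_gcomp gG gP1 gB (proj1 cf0).
pose fj j := gcomp (gP1 d.+1) gB j f0.
have cfj j : cocycle GP GB (fj j) by apply: (cocycle_gcomp gG gP1 gB gPd) => //; case: cf0.
have [_ phiE] := ext_class_sum gB phi0 phiD s cfj.
have [D phiD0] : exists D, phi (fj D) != 0.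
  apply: contrapT => none; move: phi_f0.
  rewrite (_ : f0 = (fun x => \sum_(j <- s) fj j x)); last by apply: funext.
  rewrite phiE big1 ?eqxx // => j _; apply/eqP; apply: contra_notT none => nz; by exists j.
pose f := fj D; have hf : hom_deg GP GB D f by exact: (hom_deg_gcomp gG).
have [lf df] := hf.
have lph : linear (fun x => (f x : B) *: e) by move=> a x y; rewrite lf scalerDl scalerA.
have [[y [z [yE phy]]]|none] := pselect (exists y z,
    pr_diff P d y = \sum_i X i *: (z i : P d) /\ (f y : B) *: e <> 0); last first.
  have [|th thE] := @trivial_extension _ _ (pr_diff P d) (mklin lph).
    move=> y z yE; apply: contrapT => ne; apply: none; by exists y, z.
  case/negP: phiD0; apply/eqP.
  exact: (phi_eq0_of_trivial hf (cfj D) (GRing.linearP th) thE).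
have hPd1 := proj1 (gP1 d.+1); have hPd := proj1 (gP1 d).
(* In degree -D the value of f has degree 0 and is a scalar. The other components of y contribute
   nothing modulo the augmentation ideal. *)
pose y' := gpr hPd1 (- D) y.
have Gy' : GP d.+1 (- D) y' by exact: gpr_grade.
have [c cE] : exists c : k, f y' = c%:A.
  by apply: (pres_zero hP); rewrite -(addNr D); exact: df.
exists D, f, y', (fun i => gpr hPd (- D - 1) (z i)), c; split.
  by split=> [|||i] //; [exact: cfj | exact: gpr_grade].
have fy' : (f y : B) *: e = (f y' : B) *: e.
  rewrite {1}(gpr_sum hPd1 y) -[f _]/(mklin lf _) linear_sum scaler_suml.
  have kill j : j != - D -> (mklin lf (gpr hPd1 j y) : B) *: e = 0.
    move=> jD; have [_ _ kill] := hK; apply: (kill (j + D)).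
      by rewrite addr_eq0.
    exact: (df _ _ (gpr_grade hPd1 j y)).
  have [js|js] := boolP (- D \in gsupp hPd1 y).
    rewrite (bigD1_seq (- D)) //=; last by case: (gprP hPd1 y).
    by rewrite big1 ?addr0 // => j; exact: kill.
  rewrite big1_seq => [|j /andP[_ jin]].
    by rewrite /y' (gpr_supp js) (linear_pred0 lf) scale0r.
  by apply: kill; apply: contraNneq js => <-.
split=> //; last first.
  by apply/eqP => c0; apply: phy; rewrite fy' cE c0 !scale0r.
have dB : {morph pr_diff P d : u v / u - v} by exact: linearB.
have dd l u : GP d.+1 l u -> GP d (l + 0) (pr_diff P d u) by rewrite addr0; exact: gPd.
rewrite /y' -(gpr_degree hPd1 hPd dB dd) addr0 yE raddf_sum; apply: eq_bigr => i _.
rewrite -[- D in LHS](subrK 1).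
apply: (gpr_degree hPd hPd (f := fun u => X i *: u)) => [u v|l u Gu]; first by rewrite scalerBr.
by rewrite addrC; have [_] := gP1 d; apply => //; exact: pres_gen hP _.
Qed.

End TopExt.

Section TopSyzygy.
Variables (k : fieldType) (n p : nat) (T : word_algebra k n) (B : algType k).
Variables (pi : {lrmorphism T -> B}) (r : 'I_p -> T) (dr : 'I_p -> int).
Variable G : int -> B -> Prop.
Hypothesis hP : presented pi r dr G.
Variables (K : lmodType B) (e : K) (P : proj_resolution K).
Variable GP : forall i, int -> P i -> Prop.
Arguments GP : clear implicits.
Hypotheses (hK : trivial_module G e) (gP : graded_resolution G (@trivial_grade K) GP).
Local Notation X i := (pi (wgen T i)).
Local Notation L := (lres hP hK).
Local Notation LP := (complex_of_res P).
Local Notation GB := (G : int -> B^o -> Prop).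
Variable l : int.
Hypothesis extR : ext_trivial_regular_iso G GP 4 l.
Hypothesis ext3 : ext_vanishes GP GB 3.
Hypothesis pdK : pd_le K 4.
Variables (rho Dm : int) (y0 : 'I_n -> B).
Hypotheses (rho0 : rho != 0) (rho_low : forall t, rho < dr t) (Dm_high : forall t, dr t <= Dm).
Hypotheses (Gy0 : forall j, G rho (y0 j)) (y0X : \sum_j y0 j * X j = 0).
Hypothesis y0n : exists j, y0 j != 0.

Let gG : is_grading G := pres_grading hP.
Let gB : graded_module G GB := regular_graded (pres_ring hP).
Let gP1 i : graded_module G (GP i). Proof. by case: gP. Qed.
Let gPd i j x : GP i.+1 j x -> GP i j (pr_diff P i x). Proof. by case: gP => _ _; apply. Qed.

Lemma no_low_syzygy (z : 'I_n -> B) : (forall j, G (rho - 1) (z j)) ->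
  \sum_j z j * X j = 0 -> forall j, z j = 0.
Proof.
move=> Gz zX; have /choice[f fE] : forall j, exists f, hgrade (rho - 1) f /\ pi f = z j.
  by move=> j; have [f] := pres_lift hP (Gz j); exists f.
suff f0 : \sum_j f j * wgen T j = 0.
  by move=> j; have [_ <-] := fE j; rewrite -(rpart_sum f j) f0 linear0 linear0.
apply: (@pres_inj _ _ _ _ _ _ _ _ _ hP rho) => //.
  apply: hgrade_sum => j _; have [hf _] := fE j.
  by rewrite -[rho](subrK 1); apply: hgradeM => //; exact: hgrade_gen.
by rewrite linear_sum -[RHS]zX; apply: eq_bigr => j _; rewrite rmorphM /= (proj2 (fE j)).
Qed.

(* The generator of Ext^4 is detected on an element y of P 4 with
   dy = \sum_i x_i z_i; the z_i map to the syzygies kap i.  If their degree were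
   too high, Ext^3 = 0 would show that y kills y0. *)
Lemma top_syzygy : exists (delta : int) (kap : 'I_n -> 'rV[B]_p),
  [/\ delta < rho + 1 + Dm, forall i, row_grade G dr delta (kap i),
      forall i, kap i *m lres_rels pi r = 0,
      \sum_i X i *: kap i = 0 & exists i, kap i != 0].
Proof.
have [phi [[phiD phi0 phisurj _] _ phiM]] := extR.
have [D [f [y [z [c [[hf cf Gy Gz] [dy fy c0]]]]]]] :
    exists (D : int) (f : P 4 -> B^o) (y : P 4) (z : 'I_n -> P 3) (c : k),
    [/\ hom_deg GP GB D f, cocycle GP GB f, GP 4%N (- D) y & forall i, GP 3%N (- D - 1) (z i)] /\
    [/\ pr_diff P 3 y = \sum_i X i *: z i, f y = c%:A & c != 0].
  apply: (top_cycle hP hK gP phi0 phiD phiM pdK).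
  by have [f cf f1] := phisurj 1; exists f; rewrite // f1 oner_eq0.
have [lf fD] := hf; have [_ fd] := cf.
have [ga gach gag] := to_lres hP hK gP; have [de dech deg] := from_lres hP hK gP.
have [|||s [s0 sS]] := @chain_homotopy _ _ LP LP 3 (@pr_proj _ _ P)
    (fun i x => de i (ga i x) - x) (res_exact P _).
- by move=> i a u v; rewrite (linearP (ga i)) (linearP (de i)) scalerBr opprD addrACA.
- by move=> x; rewrite linearB /= (proj1 dech) (proj1 gach) subrr.
- move=> i i2 x; rewrite linearB; congr (_ - _).
  have e1 := proj2 dech i (leq_trans (ltnW i2) _) (ga i.+1 x).
  have e2 := proj2 gach i i2 x.
  by rewrite -e2; apply: e1.
have h2 x : de 2%N (ga 2%N x) - x = pr_diff P 2 (s 2%N x) + s 1%N (pr_diff P 1 x).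
  exact: sS 1%N isT x.
have dz i : row_grade G dr (- D - 1) (ga 2%N (pr_diff P 2 (z i))).
  exact: (gag 2%N _ _ (gPd (Gz i))).
exists (- D - 1), (fun i => ga 2%N (pr_diff P 2 (z i))); split=> //.
(* Suppose the degree is too high. Since y0 has nonzero degree, f y0_j is a coboundary g_j d, and
   then \sum_j g_j x_j is a 3-cocycle because y0 is a syzygy. Ext^3 = 0 writes it as w d. *)
- rewrite ltNge; apply/negP => le_s.
  have coc1 j : cocycle GP GB (fun x => (f x : B) * y0 j).
    split; last by move=> x; rewrite fd mul0r.
    apply: (@hom_deg_graded _ _ _ _ GP _ _ gB _ _ (D + rho)); split.
      by move=> a u v; rewrite lf mulrDl -mulrA.
    by move=> t u Gu; rewrite addrA; apply: (pres_mul hP) => //; exact: fD.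
  have hd1 j : hom_deg GP GB (D + rho) (fun x => (f x : B) * y0 j).
    split; first by move=> a u v; rewrite lf mulrDl -mulrA.
    by move=> t u Gu; rewrite addrA; apply: (pres_mul hP) => //; exact: fD.
  have /choice[g gE] : forall j, exists g : P 3 -> B^o, hom_deg GP GB (D + rho) g /\
      forall x, (f x : B) * y0 j = g (pr_diff P 3 x).
    move=> j; have /phi0 [+ _] := coc1 j; move=> /(_ (phiM _ _ _ cf rho0 (Gy0 j))).
    by case/(cobound_homog gG gP1 gB gPd (hd1 j)) => g; exists g.
  pose u (x : P 3) : B^o := \sum_j (g j x : B) * X j.
  have lg j : linear (g j) by have [[]] := gE j.
  have lu : linear u.
    move=> a v w; rewrite /u scaler_sumr -big_split; apply: eq_bigr => j _ /=.
    by rewrite lg mulrDl -mulrA.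
  have hu : hom_deg GP GB (D + rho + 1) u.
    split=> // t v Gv; apply: (grade_sum gG) => j _; rewrite addrA.
    apply: (pres_mul hP); last exact: pres_gen hP _.
    by have [[_ gd] _] := gE j; exact: gd.
  have [|w hw uE] := cobound_homog gG gP1 gB gPd hu.
    apply: ext3; split; first exact: (hom_deg_graded gB hu).
    move=> x; rewrite /u; under eq_bigr => j _ do rewrite -(proj2 (gE j)) -mulrA.
    by rewrite -mulr_sumr y0X mulr0.
  have [lw wd] := hw.
  (* The basis of the relation module has degrees at most Dm, so here the values of w have negative
     degree. *)
  have wde v : w (de 2%N v) = 0.
    rewrite (row_sum_delta v) linear_sum -[w _]/(mklin lw _) linear_sum big1 // => t _.
    rewrite linearZ linearZ /=; suff -> : w (de 2%N (delta_mx 0 t)) = 0 by rewrite scaler0.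
    have Gt : lres_grade (hP := hP) (hK := hK) (dr t) (delta_mx 0 t : L 2%N).
      move=> i /=; rewrite mxE eqxx /=; case: eqP => [->|_]; last exact: (grade0 gG).
      by rewrite subrr; have := pres_scal hP 1; rewrite scale1r.
    apply: (pres_neg hP _ (wd _ _ (deg 2%N _ _ Gt))).
    have := Dm_high t; lia.
  have wE x : w x = - u (s 2%N x) - w (s 1%N (pr_diff P 1 x)).
    have := congr1 (mklin lw) (h2 x); rewrite linearB linearD /= wde sub0r -uE => /eqP.
    by rewrite eqr_oppLR opprD => /eqP.
  have uz x : u (x + s 2%N (pr_diff P 2 x)) = 0.
    rewrite -[u _]/(mklin lu _) linearD /= uE wE res_dd (linear0 (s 1%N)) (linear_pred0 lw).
    by rewrite subr0 addNr.
  (* Since w vanishes on the image of L, the homotopy corrects the g_j to maps gg_j with \sum_j gg_j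
     x_j = 0 identically. *)
  pose gg j x := g j (x + s 2%N (pr_diff P 2 x)).
  have ggX x : \sum_j (gg j x : B) * X j = 0 by exact: uz.
  have y0E j : c%:A * y0 j = \sum_i X i * gg j (z i).
    have <- : gg j (pr_diff P 3 y) = c%:A * y0 j.
      by rewrite /gg res_dd linear0 addr0 -(proj2 (gE j)) fy.
    have lgg : linear (gg j).
      move=> a v w'; rewrite /gg (linearP (pr_diff P 2)) (linearP (s 2%N)) addrACA -scalerDr.
      exact: lg.
    by rewrite dy -[gg j _]/(mklin lgg _) linear_sum; apply: eq_bigr => i _; rewrite linearZ.
  (* These form syzygies of the generators in degree rho - 1, below all relations, hence vanish; so
     c y0_j = \sum_i x_i gg_j(z_i) = 0, against the choice of y0. *)
  pose zz j i := gpr gG (rho - 1) (gg j (z i)).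
  have zz0 j i : zz j i = 0.
    apply: (@no_low_syzygy (zz^~ i)); first by move=> j'; exact: gpr_grade.
    have mB j' : {morph (fun b => b * X j') : u v / u - v} by move=> ? ?; rewrite mulrBl.
    have md j' t b : G t b -> G (t + 1) (b * X j').
      by move=> Gb; apply: (pres_mul hP) => //; exact: pres_gen hP _.
    under eq_bigr => j' _ do rewrite -(gpr_degree gG gG (mB j') (md j')).
    by rewrite -raddf_sum ggX raddf0.
  have [j /eqP] := y0n; apply.
  have Gc : gpr gG rho (c%:A * y0 j) = c%:A * y0 j.
    by apply/(gpr_gradeP gG); rewrite mulr_algl; exact: (pres_scale hP).
  have : c%:A * y0 j = 0.
    rewrite -Gc y0E raddf_sum big1 // => i _ /=; rewrite -[rho](subrK 1).
    have mB : {morph (fun b => X i * b) : u v / u - v} by move=> ? ?; rewrite mulrBr.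
    have md t b : G t b -> G (t + 1) (X i * b).
      by move=> Gb; rewrite addrC; apply: (pres_mul hP) => //; exact: pres_gen hP _.
    by rewrite (gpr_degree gG gG mB md) -/(zz j i) zz0 mulr0.
  move/(congr1 (fun b => c^-1 *: b)); rewrite mulr_algl scalerA mulVf // scale1r => ->.
  exact: scaler0.
- move=> i; have := proj2 gach 1%N isT (pr_diff P 2 (z i)).
  by rewrite /= res_dd linear0.
- under eq_bigr => i _ do rewrite -linearZ -linearZ /=.
  by rewrite -linear_sum -linear_sum -dy res_dd linear0.
(* If all syzygies vanish, each z_i becomes a boundary d b_i after a correction that drops out of
   \sum_i x_i z_i. Then y - \sum_i x_i b_i is a boundary, so f y = \sum_i x_i f(b_i) would have no
   constant term. *)
apply: contrapT => none.
have kz i : ga 2%N (pr_diff P 2 (z i)) = 0.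
  by apply/eqP; apply: contra_notT none => nz; exists i.
have /choice[b bE] : forall i, exists b, pr_diff P 3 b = z i + s 2%N (pr_diff P 2 (z i)).
  move=> i; apply/pr_exactS; rewrite linearD.
  have := h2 (pr_diff P 2 (z i)); rewrite kz linear0 sub0r res_dd linear0 addr0 => <-.
  by rewrite addrN.
have : pr_diff P 3 (y - \sum_i X i *: b i) = 0.
  rewrite linearB linear_sum dy -sumrB.
  under eq_bigr => i _ do rewrite [pr_diff P 3 _]linearZ /= bE scalerDr opprD addrA subrr sub0r.
  rewrite sumrN -[RHS]oppr0; congr (- _).
  under eq_bigr => i _ do rewrite -linearZ -[X i *: pr_diff _ _ _]linearZ.
  by rewrite -linear_sum -linear_sum -dy res_dd linear0.
move/pr_exactS => [v vE]; have := fd v; rewrite vE -[f _]/(mklin lf _) linearB linear_sum /= fy.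
move=> /eqP; rewrite subr_eq0 => /eqP /(congr1 (fun b : B => b *: e)).
rewrite scaler_suml big1 => [/(trivial_scal hK) c00|i _]; first by rewrite c00 eqxx in c0.
rewrite -[f _]/(mklin lf _) linearZ /= -scalerA.
have [_ span kill] := hK; have [c' ->] := span ((f (b i) : B) *: e).
rewrite scalerA mulr_algr -mulr_algl -scalerA (kill 1) ?scaler0 //; exact: pres_gen hP _.
Qed.

End TopSyzygy.

(** * Twisted superpotentials *)

Lemma split_lshift m n (j : 'I_m) : split (lshift n j) = inl j.
Proof. exact: (unsplitK (inl j)). Qed.

Lemma split_rshift m n (j : 'I_n) : split (rshift m j) = inr j.
Proof. exact: (unsplitK (inr j)). Qed.

Lemma pres_gprMl (k : fieldType) (n p : nat) (T : word_algebra k n) (B : algType k)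
    (pi : {lrmorphism T -> B}) (r : 'I_p -> T) (dr : 'I_p -> int) (G : int -> B -> Prop)
    (hP : presented pi r dr G) d e a b :
  G e a -> gpr (pres_grading hP) d (a * b) = a * gpr (pres_grading hP) (d - e) b.
Proof.
move=> Ga; have mB : {morph (fun z => a * z) : u v / u - v} by move=> u v; rewrite mulrBr.
have md l y : G l y -> G (l + e) (a * y).
  by move=> Gy; rewrite addrC; exact: (pres_mul hP).
by rewrite -(gpr_degree (pres_grading hP) (pres_grading hP) mB md) subrK.
Qed.

Section Superpotential.
Variables (k : fieldType) (n : nat) (T : word_algebra k n.+1) (m : nat).
Variables (w : T) (q p : 'I_n.+1 -> k).
Hypotheses (hm : (2 <= m)%N) (wd : hgrade m.+1 w) (q0 : forall i, q i != 0).
Hypothesis rw : forall i, rpart i w = q i *: lpart i w.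
Hypotheses (p0 : forall i, p i != 0) (pq : p ord0 = q ord0).

Local Notation x := (wgen T).
Local Notation z0 := (ord0 : 'I_n.+1).
Definition sp_u i : T := lpart i w.
Definition sp_N a i : T := lpart a (sp_u i).
Local Notation u := sp_u.
Local Notation N := sp_N.

Lemma sp_u_deg i : hgrade m (u i).
Proof. by apply: hgrade_lpart; rewrite -PoszD addn1. Qed.

Lemma sp_N_deg a i : hgrade (m%:Z - 1) (N a i).
Proof. by apply: hgrade_lpart; rewrite subrK; exact: sp_u_deg. Qed.

Lemma sp_aug_u i : aug (u i) = 0.
Proof. by apply: hgrade_aug (sp_u_deg i); rewrite eqz_nat; case: m hm. Qed.

Lemma sp_aug_w : aug w = 0.
Proof. exact: hgrade_aug wd. Qed.

Lemma sp_w_left : w = \sum_i x i * u i.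
Proof. by rewrite {1}(lpart_decomp w) sp_aug_w scale0r add0r. Qed.

Lemma sp_w_right : w = \sum_i q i *: (u i * x i).
Proof.
rewrite {1}(rpart_decomp w) sp_aug_w scale0r add0r; apply: eq_bigr => i _.
by rewrite rw scalerAl.
Qed.

Lemma sp_u_left i : u i = \sum_a x a * N a i.
Proof. by rewrite {1}(lpart_decomp (u i)) sp_aug_u scale0r add0r. Qed.

(** The left part of w = \sum_i q_i u_i x_i at a. Together with [sp_u_left] it makes the single
    matrix N carry both the left and the right parts of the relations. *)
Lemma sp_u_right a : u a = \sum_i q i *: (N a i * x i).
Proof.
rewrite {1}/sp_u {1}sp_w_right linear_sum; apply: eq_bigr => i _.
by rewrite linearZ /= lpartM sp_aug_u scale0r addr0.
Qed.

Lemma sp_rpart a i : rpart i (u a) = q i *: N a i.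
Proof.
rewrite sp_u_right; under eq_bigr => j _ do rewrite scalerAl.
exact: (rpart_sum (fun j => q j *: N a j)).
Qed.

Lemma sum_delta0 (V : lmodType k) (F : 'I_n.+1 -> V) :
  \sum_i (i == z0)%:R *: F i = F z0.
Proof. by under eq_bigr => i _ do rewrite eq_sym; exact: sum_delta. Qed.

(* The twist by which Om = d_1 w is normal in D, see spD_tau. *)
Definition sp_tau : T -> T := wa_ext T (fun s => (\prod_(i <- s) p i) *: wa_word T s).
HB.instance Definition _ := GRing.Linear.on sp_tau.
Local Notation tau := sp_tau.

Lemma sp_tauW s : tau (wa_word T s) = (\prod_(i <- s) p i) *: wa_word T s.
Proof. exact: wa_extE. Qed.

Lemma sp_tau_gen i : tau (x i) = p i *: x i.
Proof. by rewrite sp_tauW big_seq1. Qed.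

Lemma sp_tau1 : tau 1 = 1.
Proof. by rewrite -(wa_nil T) sp_tauW big_nil scale1r. Qed.

Lemma sp_tauM f g : tau (f * g) = tau f * tau g.
Proof.
move: f g; apply: (@eq_on_words2 _ _ _ _ (fun f g => tau (f * g)) (fun f g => tau f * tau g)).
- by move=> h c f g; rewrite mulrDl -scalerAl linearP.
- by move=> h c f g; rewrite mulrDr -scalerAr linearP.
- by move=> h c f g; rewrite linearP mulrDl -scalerAl.
- by move=> h c f g; rewrite linearP mulrDr -scalerAr.
- by move=> s t; rewrite -wa_cat !sp_tauW -scalerAl -scalerAr scalerA -big_cat -wa_cat.
Qed.

Lemma sp_tau_deg d f : hgrade d f -> hgrade d (tau f).
Proof.
move: f; apply: hgrade_ind => [|c s f sd IH]; first by rewrite linear0; exact: hgrade0.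
rewrite linearP /=; apply: hgrade_linear => //; rewrite sp_tauW -sd.
by apply: hgradeZ; exact: hgrade_word.
Qed.

Lemma sp_lpart_tau i f : lpart i (tau f) = p i *: tau (lpart i f).
Proof.
rewrite {1}(lpart_decomp f) linearD linearZ /= sp_tau1 linearD linearZ /= lpart1 scaler0 add0r.
rewrite (linear_sum sp_tau) /=; under eq_bigr => j _ do rewrite sp_tauM sp_tau_gen -scalerAl scalerAr.
exact: (lpart_sum (fun j => p j *: tau (lpart j f))).
Qed.

Definition sp_rel (t : 'I_(n + n)) : T :=
  match split t with
  | inl j => u (lift z0 j)
  | inr j => x (lift z0 j) * u z0 - p (lift z0 j) *: (u z0 * x (lift z0 j))
  end.
Definition sp_reldeg (t : 'I_(n + n)) : int :=
  match split t with inl _ => m | inr _ => m.+1 end.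

(** * Exactness over A and uniqueness of the superpotential *)

Section OnA.
Variables (A : algType k) (pi : {lrmorphism T -> A}) (GA : int -> A -> Prop).
Hypothesis hA : presented pi u (fun=> m%:Z) GA.
Hypothesis A3 : forall c d, GA d c -> (forall i, pi (x i) * c = 0) -> c = 0.
Hypothesis A2' : forall (a : 'I_n.+1 -> A) d, (forall i, GA d (a i)) ->
  (forall t, \sum_j pi (rpart j (u t)) * a j = 0) ->
  exists2 c, GA (d - 1) c & forall j, a j = pi (x j) * c.

(** The vanishing of Ext^1 in terms of N. The q_i enter because the matrix of right parts of the
    relations is N with its i-th column scaled by q_i. *)
Lemma spA_exact (c : 'I_n.+1 -> A) d : (forall i, GA d (c i)) ->
  (forall a, \sum_i pi (N a i) * c i = 0) ->
  exists2 b, GA (d - 1) b & forall i, c i = q i *: (pi (x i) * b).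
Proof.
move=> Gc Nc; have [|t|b Gb bE] := @A2' (fun i => (q i)^-1 *: c i) d.
- by move=> i; exact: (pres_scale hA).
- rewrite -[RHS](Nc t); apply: eq_bigr => i _.
  by rewrite sp_rpart linearZ /= -scalerAl -scalerAr scalerA mulfV // scale1r.
by exists b => // i; rewrite -bE scalerA mulfV // scale1r.
Qed.

Lemma spA_inj j f : j < m%:Z -> hgrade j f -> pi f = 0 -> f = 0.
Proof. by move=> jm; apply: (pres_inj hA). Qed.

(** Scalars v_i with \sum_i v_i u_i = 0 form a column of degree 0 killed by N, so by exactness they
    are multiples of an element of degree -1. *)
Lemma sp_independent (v : 'I_n.+1 -> k) : \sum_i v i *: u i = 0 -> forall i, v i = 0.
Proof.
move=> sum0; have [|a|b Gb bE] := @spA_exact (fun i => (v i)%:A) 0.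
- by move=> i; exact: pres_scal hA _.
- transitivity (pi (lpart a (\sum_i v i *: u i))); last by rewrite sum0 !linear0.
  by rewrite !linear_sum; apply: eq_bigr => i _; rewrite !linearZ /= mulr_algr.
move=> i; have := bE i; rewrite (pres_neg hA _ Gb) // mulr0 scaler0.
move=> v0; apply/eqP; apply: contraT => vn; have := oner_neq0 A.
by rewrite -[1](scale1r (1 : A)) -(mulVf vn) -scalerA v0 scaler0 eqxx.
Qed.

(** With R the span of the u_i, the hypothesis says that \sum_a u_a y_a lies in V (x) R as well as
    in R (x) V. The conclusion makes it l times w. *)
Lemma sp_two_sided (y : 'I_n.+1 -> T) : (forall a, hgrade 1 (y a)) ->
  (forall i, pi (\sum_a N i a * y a) = 0) ->
  exists l, forall a, y a = (l * q a) *: x a.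
Proof.
move=> Gy Ny; have [|a|b Gb bE] := @spA_exact (fun a => pi (y a)) 1.
- by move=> a; exact: (pres_pi hA (Gy a)).
- by rewrite -[RHS](Ny a) linear_sum; apply: eq_bigr => i _; rewrite rmorphM.
have [l lE] := pres_zero hA Gb; exists l => a; apply/eqP; rewrite -subr_eq0; apply/eqP.
apply: (@spA_inj 1); first by rewrite ltz_nat.
  by apply: hgradeB => //; apply: hgradeZ; exact: hgrade_gen.
by rewrite linearB linearZ /= bE lE mulr_algr scalerA mulrC subrr.
Qed.

(** With a single generator x one has x N = u = 0 in A, so N = 0 by [A3] and u = 0, against
    independence. Hence D has a relation u_i = 0 with i <> ord0, which starts the argument of
    [spD_tau_u]. *)
Lemma sp_two_gens : (0 < n)%N.
Proof.
rewrite lt0n; apply/eqP => n0.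
have only (i : 'I_n.+1) : i = z0 by apply/val_inj; case: i => -[|i] //=; rewrite n0.
have N0 : N z0 z0 = 0.
  apply: (@spA_inj (m%:Z - 1)); [by rewrite ltrBlDr ltrDl | exact: sp_N_deg |].
  apply: (A3 (pres_pi hA (sp_N_deg z0 z0))) => i; rewrite (only i) -rmorphM.
  rewrite -[RHS](pi_rel hA z0) sp_u_left (bigD1 z0) //= big1 ?addr0 // => j.
  by rewrite (only j) eqxx.
have := @sp_independent (fun=> 1); rewrite big1 => [/(_ erefl z0)/eqP|i _].
  by rewrite oner_eq0.
rewrite (only i) sp_u_left big1 ?scaler0 // => j _.
by rewrite (only j) N0 mulr0.
Qed.

(** * Lifting exactness from A to D *)

Section OnD.
Variables (D : algType k) (pd : {lrmorphism T -> D}) (GD : int -> D -> Prop).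
Hypothesis hD : presented pd sp_rel sp_reldeg GD.
Local Notation X i := (pd (x i)).
Local Notation Om := (pd (u z0)).
Local Notation Nd a i := (pd (N a i)).
Local Notation Nt a i := (pd (tau (N a i))).
Local Notation Ut i := (pd (tau (u i))).
Let gD : is_grading GD := pres_grading hD.

Lemma spD_uE i : pd (u i) = (i == z0)%:R *: Om.
Proof.
case: (unliftP z0 i) => [j|] ->; last by rewrite eqxx scale1r.
rewrite eq_sym (negbTE (neq_lift _ _)) scale0r -[RHS](pi_rel hD (lshift n j)).
by rewrite /sp_rel split_lshift.
Qed.

Lemma spD_Om_deg : GD m Om. Proof. by apply: (pres_pi hD); exact: sp_u_deg. Qed.

(** For i = ord0 this is not a defining relation. It comes from w, whose two expressions reduce in D
    to x_1 Om and q_1 Om x_1. *)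
Lemma spD_comm i : X i * Om = p i *: (Om * X i).
Proof.
case: (unliftP z0 i) => [j|] ->.
  have := pi_rel hD (rshift n j); rewrite /sp_rel split_rshift linearB linearZ /= !rmorphM /=.
  by move=> /eqP; rewrite subr_eq0 => /eqP.
have := congr1 pd sp_w_left; rewrite {1}sp_w_right !linear_sum /=.
under eq_bigr => a _ do rewrite linearZ /= rmorphM /= spD_uE -scalerAl scalerA mulrC -scalerA.
rewrite sum_delta0; under eq_bigr => a _ do rewrite rmorphM /= spD_uE -scalerAr.
by rewrite sum_delta0 pq => ->.
Qed.

Lemma spD_tau f : pd f * Om = Om * pd (tau f).
Proof.
move: f; apply: (@eq_on_words _ _ _ _ (fun f => pd f * Om) (fun f => Om * pd (tau f))).
- by move=> c f g; rewrite linearP mulrDl -scalerAl.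
- by move=> c f g; rewrite !linearP mulrDr -scalerAr.
elim=> [|i s IH]; first by rewrite wa_nil sp_tau1 !rmorph1 mul1r mulr1.
rewrite wa_cons rmorphM /= -mulrA IH mulrA spD_comm -scalerAl -mulrA -rmorphM.
by rewrite sp_tauM sp_tau_gen -scalerAl linearZ /= -scalerAr.
Qed.

(** Normality collects every occurrence of u_1 on the left. Together with [spD_to_A] this is A = D /
    Om D, expressed through lifts to T so that no map from D to A has to be built. *)
Lemma spD_of_A d f : hgrade d f -> pi f = 0 -> exists2 v, GD (d - m%:Z) v & pd f = Om * v.
Proof.
move=> hf /(pres_ker hA)[M [a [b [l fE]]]].
pose v := \sum_(t < M | l t == z0) pd (tau (a t)) * pd (b t).
have pf : pd f = Om * v.
  rewrite fE linear_sum mulr_sumr [RHS]big_mkcond; apply: eq_bigr => t _ /=.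
  rewrite !rmorphM /= spD_uE; case: eqP => [lt|_]; last by rewrite scale0r mulr0 mul0r.
  by rewrite scale1r spD_tau mulrA.
exists (gpr gD (d - m%:Z) v); first exact: gpr_grade.
by rewrite -(pres_gprMl hD _ _ spD_Om_deg) -pf; apply/esym/(gpr_gradeP gD); exact: (pres_pi hD).
Qed.

Lemma spD_ker_A f : pd f = 0 -> pi f = 0.
Proof.
move/(pres_ker hD) => [M [a [b [l ->]]]]; rewrite linear_sum big1 // => t _.
rewrite !rmorphM /=; suff -> : pi (sp_rel (l t)) = 0 by rewrite mulr0 mul0r.
rewrite /sp_rel; case: split => j; first exact: (pi_rel hA).
by rewrite linearB linearZ /= !rmorphM /= (pi_rel hA) mulr0 mul0r scaler0 subrr.
Qed.

Lemma spD_to_A f b : pd f = Om * b -> pi f = 0.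
Proof.
have [g <-] := pres_surj hD b; rewrite -rmorphM => /eqP; rewrite -subr_eq0 -linearB => /eqP.
move/spD_ker_A; rewrite linearB rmorphM /= (pi_rel hA) mul0r subr0; exact.
Qed.

(** Exactness over A, read modulo Om D through lifts to T. The error terms Om v are kept with their
    degrees, since the later inductions and vanishing arguments run on them. *)
Lemma spD_exact1 (b : 'I_n.+1 -> D) d a : (forall i, GD d (b i)) ->
  \sum_i X i * b i = Om * a ->
  exists (c v : 'I_n.+1 -> D), [/\ forall i, GD (d + 1 - m%:Z) (c i), forall i, GD (d - m%:Z) (v i)
    & forall i, b i = \sum_j Nd i j * c j + Om * v i].
Proof.
move=> Gb bE; have /choice[f fE] : forall i, exists f, hgrade d f /\ pd f = b i.
  by move=> i; have [f] := pres_lift hD (Gb i); exists f.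
have [i||c Gc cE] := @pres_right _ _ _ _ _ _ _ _ _ hA d (fun i => pi (f i)).
- by apply: (pres_pi hA); exact: (proj1 (fE i)).
- rewrite -[LHS]/(\sum_i pi (x i) * pi (f i)).
  under eq_bigr => j _ do rewrite -rmorphM.
  rewrite -linear_sum; apply: (@spD_to_A _ a); rewrite -bE linear_sum.
  by apply: eq_bigr => j _; rewrite rmorphM /= (proj2 (fE j)).
have /choice[g gE] : forall i, exists g, hgrade (d + 1 - m%:Z) g /\ pi g = c i.
  by move=> i; have [g] := pres_lift hA (Gc i); exists g.
have /choice[v vE] : forall i, exists v, GD (d - m%:Z) v /\
    pd (f i - \sum_j N i j * g j) = Om * v.
  move=> i; have [||v Gv ve] := @spD_of_A d (f i - \sum_j N i j * g j); last by exists v.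
    apply: hgradeB; first exact: (proj1 (fE i)).
    apply: hgrade_sum => j _; rewrite (_ : d = (m%:Z - 1) + (d + 1 - m%:Z)); last by ring.
    by apply: hgradeM; [exact: sp_N_deg | exact: (proj1 (gE j))].
  rewrite linearB linear_sum /= cE; apply/eqP; rewrite subr_eq0; apply/eqP.
  by apply: eq_bigr => j _; rewrite rmorphM /= (proj2 (gE j)).
exists (fun i => pd (g i)), v; split=> [i|i|i].
- by apply: (pres_pi hD); exact: (proj1 (gE i)).
- exact: (proj1 (vE i)).
rewrite -(proj2 (vE i)) linearB linear_sum /= (proj2 (fE i)) addrC.
under [Z in _ - Z + _]eq_bigr => j _ do rewrite rmorphM /=.
by rewrite subrK.
Qed.

Lemma spD_exact2 (c : 'I_n.+1 -> D) d (b : 'I_n.+1 -> D) : (forall i, GD d (c i)) ->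
  (forall a, \sum_i Nd a i * c i = Om * b a) ->
  exists s v, [/\ GD (d - 1) s, forall i, GD (d - m%:Z) (v i)
    & forall i, c i = q i *: (X i * s) + Om * v i].
Proof.
move=> Gc cE; have /choice[f fE] : forall i, exists f, hgrade d f /\ pd f = c i.
  by move=> i; have [f] := pres_lift hD (Gc i); exists f.
have [i|a|s Gs sE] := @spA_exact (fun i => pi (f i)) d.
- by apply: (pres_pi hA); exact: (proj1 (fE i)).
- under eq_bigr => j _ do rewrite -rmorphM.
  rewrite -linear_sum; apply: (@spD_to_A _ (b a)); rewrite -cE linear_sum.
  by apply: eq_bigr => j _; rewrite rmorphM /= (proj2 (fE j)).
have [g hg gE] := pres_lift hA Gs.
have /choice[v vE] : forall i, exists v, GD (d - m%:Z) v /\ pd (f i - q i *: (x i * g)) = Om * v.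
  move=> i; have [||v Gv ve] := @spD_of_A d (f i - q i *: (x i * g)); last by exists v.
    apply: hgradeB; first exact: (proj1 (fE i)).
    apply: hgradeZ; rewrite -[d](subrK 1) addrC; apply: hgradeM => //; exact: hgrade_gen.
  by rewrite linearB linearZ /= rmorphM /= gE sE subrr.
exists (pd g), v; split=> [|i|i].
- exact: (pres_pi hD).
- exact: (proj1 (vE i)).
by rewrite -(proj2 (vE i)) linearB linearZ /= rmorphM /= (proj2 (fE i)) addrC subrK.
Qed.

Lemma spD_exact3 c d (b : 'I_n.+1 -> D) : GD d c -> (forall i, X i * c = Om * b i) ->
  exists2 v, GD (d - m%:Z) v & c = Om * v.
Proof.
move=> Gc cE; have [f hf fE] := pres_lift hD Gc; rewrite -fE.
apply: spD_of_A => //; apply: (A3 (pres_pi hA hf)) => i; rewrite -rmorphM.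
by apply: (@spD_to_A _ (b i)); rewrite rmorphM /= fE.
Qed.

(** The left part at a of x_j u_1 - p_j u_1 x_j is delta_ja u_1 - p_j N_a1 x_j. The first term gives
    Om t; the second is absorbed in the value of s at ord0. In this way all indices enter uniformly,
    although no relation of D has index ord0. *)
Lemma spD_right (b : 'I_n.+1 -> D) d : (forall i, GD d (b i)) -> \sum_i X i * b i = 0 ->
  exists s t : 'I_n.+1 -> D, [/\ forall i, GD (d + 1 - m%:Z) (s i), forall i, GD (d - m%:Z) (t i),
    t z0 = 0, s z0 + \sum_i p i *: (X i * t i) = 0
    & forall a, b a = \sum_i Nd a i * s i + Om * t a].
Proof.
move=> Gb bE; have [c Gc cE] := pres_right hD Gb bE.
pose t i := if unlift z0 i is Some j then c (rshift n j) else 0.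
have t0 : t z0 = 0 by rewrite /t unlift_none.
have tj j : t (lift z0 j) = c (rshift n j) by rewrite /t liftK.
pose s i := if unlift z0 i is Some j then c (lshift n j) else - \sum_j p j *: (X j * t j).
have s0 : s z0 = - \sum_j p j *: (X j * t j) by rewrite /s unlift_none.
have sj j : s (lift z0 j) = c (lshift n j) by rewrite /s liftK.
have Gt i : GD (d - m%:Z) (t i).
  rewrite /t; case: unliftP => [j _|_]; last exact: grade0.
  have := Gc (rshift n j); rewrite /sp_reldeg split_rshift.
  by rewrite (_ : d + 1 - (m.+1)%:Z = d - m%:Z) //; lia.
exists s, t; split=> //.
- move=> i; rewrite /s; case: unliftP => [j _|_].
    by have := Gc (lshift n j); rewrite /sp_reldeg split_lshift.
  apply: (gradeN gD); apply: (grade_sum gD) => j _; apply: (pres_scale hD).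
  rewrite (_ : d + 1 - m%:Z = 1 + (d - m%:Z)); last by ring.
  by apply: (pres_mul hD) => //; exact: pres_gen hD _.
- by rewrite s0 addNr.
move=> a; rewrite cE big_split_ord /= [\sum_i Nd a i * _]big_ord_recl /=.
rewrite s0 mulrN mulr_sumr big_ord_recl /= t0 mulr0 scaler0 mulr0 add0r.
rewrite [in RHS]addrC addrA [RHS]addrC; congr (_ + _).
  by apply: eq_bigr => j _; rewrite sj /sp_rel split_lshift.
have -> : Om * t a = \sum_j (lift z0 j == a)%:R *: (Om * c (rshift n j)).
  case: (unliftP z0 a) => [i|] ->.
    rewrite (bigD1 i) //= eqxx scale1r big1 ?addr0 ?tj // => j ji.
    by rewrite (inj_eq lift_inj) (negbTE ji) scale0r.
  rewrite t0 mulr0 big1 // => j _; rewrite eq_sym (negbTE (neq_lift _ _)) scale0r //.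
rewrite -sumrB; apply: eq_bigr => j _; rewrite /sp_rel split_rshift tj.
rewrite linearB linearZ /= lpart_genM lpartM sp_aug_u scale0r addr0.
have -> (c1 c2 : k) f g : pd (c1 *: f - c2 *: (g * x (lift z0 j))) =
    c1 *: pd f - c2 *: (pd g * X (lift z0 j)).
  rewrite linearB; congr (_ - _); first exact: linearZ.
  by rewrite linearZ /= rmorphM.
by rewrite mulrBl -!scalerAl -scalerAr mulrA.
Qed.

Lemma spD_N_left i : \sum_a X a * Nd a i = (i == z0)%:R *: Om.
Proof.
rewrite -spD_uE [in RHS]sp_u_left linear_sum; apply: eq_bigr => a _.
by rewrite rmorphM.
Qed.

Lemma spD_N_right a : \sum_i q i *: (Nd a i * X i) = (a == z0)%:R *: Om.
Proof.
rewrite -spD_uE [in RHS]sp_u_right linear_sum; apply: eq_bigr => i _.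
by rewrite linearZ /= rmorphM.
Qed.

Lemma spD_Nt_left i : \sum_a p a *: (X a * Nt a i) = Ut i.
Proof.
rewrite [in RHS]sp_u_left !linear_sum /=; apply: eq_bigr => a _.
by rewrite sp_tauM sp_tau_gen -scalerAl linearZ /= rmorphM.
Qed.

Lemma spD_inj j f : j < m%:Z -> hgrade j f -> pd f = 0 -> f = 0.
Proof. by move=> jm hf /spD_ker_A; exact: spA_inj hf. Qed.

Lemma spD_low (e : int) f : e <= m -> hgrade e f -> pd f = 0 ->
  exists2 c : 'I_n.+1 -> k, c z0 = 0 & f = \sum_i c i *: u i.
Proof.
move=> em hf pf; have [t|c [-> c0]] := pres_low hD _ hf pf.
  rewrite /sp_reldeg; case: split => // _; apply: (le_trans em).
  by rewrite lez_nat.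
exists (fun i => if unlift z0 i is Some j then c (lshift n j) else 0).
  by rewrite unlift_none.
rewrite big_split_ord [RHS]big_ord_recl unlift_none scale0r add0r /=.
rewrite [Z in _ + Z]big1 ?addr0 => [|j _].
  by apply: eq_bigr => j _; rewrite liftK /sp_rel split_lshift.
by rewrite c0 ?scale0r // /sp_reldeg split_rshift (le_lt_trans em) // ltz_nat.
Qed.

Lemma spD_Om_neq0 : Om != 0.
Proof.
apply/eqP => /(spD_low (lexx _) (sp_u_deg z0))[c c0 uE].
have /sp_independent/(_ z0) : \sum_i ((i == z0)%:R - c i) *: u i = 0.
  under eq_bigr => i _ do rewrite scalerBl.
  by rewrite sumrB sum_delta0 -uE subrr.
by rewrite eqxx c0 subr0 => /eqP; rewrite oner_eq0.
Qed.

Lemma spD_Nd_deg a i : GD (m%:Z - 1) (Nd a i).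
Proof. by apply: (pres_pi hD); exact: sp_N_deg. Qed.

Lemma spD_Nt_deg a i : GD (m%:Z - 1) (Nt a i).
Proof. by apply: (pres_pi hD); apply: sp_tau_deg; exact: sp_N_deg. Qed.

Lemma spD_scal_deg e d c z : GD e c%:A -> GD d z -> GD (e + d) (c *: z).
Proof. by move=> Gc Gz; rewrite -mulr_algl; exact: (pres_mul hD). Qed.

Lemma spD_scal_inj c : c%:A = 0 :> D -> c = 0.
Proof. by move/eqP; rewrite scaler_eq0 oner_eq0 orbF => /eqP. Qed.

Lemma spD_mul_N (c : 'I_n.+1 -> D) s v a : (forall i, c i = q i *: (X i * s) + Om * v i) ->
  \sum_i Nd a i * c i = Om * ((a == z0)%:R *: s + \sum_i Nt a i * v i).
Proof.
move=> cE; under eq_bigr => i _ do rewrite cE mulrDr -scalerAr !mulrA scalerAl spD_tau.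
rewrite big_split /= -mulr_suml spD_N_right mulrDr -scalerAl -scalerAr; congr (_ + _).
by rewrite mulr_sumr; apply: eq_bigr => i _; rewrite mulrA.
Qed.

(* For c = \sum_i x_i b_i, Om c = 0 is a relation \sum_i x_i (p_i^-1 Om b_i) = 0.
   The presentation of D, spD_exact2 and the induction on the degree yield
   c = \sum_k (tau(u_k) - delta_k1 Om) v_k with v_k of degree d - m. *)
Lemma spD_annihilator_nat (d : nat) c : GD d c -> Om * c = 0 ->
  (d < m)%N \/ (forall i, Ut i = (i == z0)%:R *: Om) -> c = 0.
Proof.
elim: d c => [|d IH] c Gc Oc cond.
  have [l lE] := pres_zero hD Gc; move: Oc; rewrite lE mulr_algr => /eqP.
  by rewrite scaler_eq0 (negbTE spD_Om_neq0) orbF => /eqP ->; rewrite scale0r.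
have [|b] := pres_pos_gen hD _ Gc; first by [].
rewrite (_ : d.+1%:Z - 1 = d) => [Gb cE|]; last by lia.
pose b' i := (p i)^-1 *: (Om * b i).
have Gb' i : GD (d%:Z + m) (b' i).
  apply: (pres_scale hD); rewrite addrC; apply: (pres_mul hD) => //; exact: spD_Om_deg.
have b'0 : \sum_i X i * b' i = 0.
  rewrite -[RHS]Oc cE mulr_sumr; apply: eq_bigr => i _.
  by rewrite /b' -scalerAr !mulrA spD_comm -!scalerAl scalerA mulVf // scale1r.
have [s [t [Gs Gt t0 s0 b'E]]] := spD_right Gb' b'0.
have NsE a : \sum_i Nd a i * s i = Om * ((p a)^-1 *: b a - t a).
  by rewrite mulrBr -scalerAr -/(b' a) b'E addrK.
have [s' [v [Gs' Gv sE]]] := spD_exact2 Gs NsE.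
have bE a : b a = p a *: (t a + ((a == z0)%:R *: s' + \sum_i Nt a i * v i)).
  apply/eqP; rewrite -subr_eq0 -(inj_eq (scalerI (invr_neq0 (p0 a)))) scaler0.
  rewrite scalerBr scalerA mulVf // scale1r opprD addrA; apply/eqP; apply: IH.
  - apply: (gradeB gD); first apply: (gradeB gD).
    + exact: (pres_scale hD).
    + by have := Gt a; rewrite addrK.
    + apply: (gradeD gD).
        apply: (pres_scale hD); rewrite (_ : d%:Z = d%:Z + m%:Z + 1 - m%:Z - 1) //; lia.
      apply: (grade_sum gD) => i _.
      rewrite (_ : d%:Z = m%:Z - 1 + (d%:Z + m%:Z + 1 - m%:Z - m%:Z)); last by lia.
      by apply: (pres_mul hD) => //; exact: spD_Nt_deg.
  - by rewrite mulrBr -NsE (spD_mul_N _ sE) subrr.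
  - by case: cond => [/ltnW|]; [left|right].
have cE2 : c = \sum_i Ut i * v i - Om * v z0.
  rewrite cE; under eq_bigr => a _ do rewrite bE -scalerAr mulrDr scalerDr mulrDr scalerDr.
  rewrite !big_split /=; have -> : \sum_i p i *: (X i * t i) = - s z0.
    by apply/eqP; rewrite -addr_eq0 addrC s0.
  under [Z in _ + (Z + _)]eq_bigr => a _ do rewrite -scalerAr scalerA mulrC -scalerA.
  rewrite (sum_delta0 (fun a => p a *: (X a * s'))) sE pq opprD addrA.
  rewrite [_ - Om * _ + _]addrAC addNr add0r addrC; congr (_ - _).
  under eq_bigr => a _ do rewrite mulr_sumr scaler_sumr.
  rewrite exchange_big; apply: eq_bigr => i _ /=.
  by rewrite -spD_Nt_left mulr_suml; apply: eq_bigr => a _; rewrite mulrA scalerAl.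
(* In degree less than m the v_i have negative degree. This case does not depend on tau, so it can
   be used in [tail_tau], where the identity for tau is established. *)
rewrite cE2; case: cond => [dm|UtE].
  have v0 i : v i = 0 by apply: (pres_neg hD _ (Gv i)); move: dm; lia.
  by rewrite big1 ?v0 ?mulr0 ?subrr // => i _; rewrite v0 mulr0.
under eq_bigr => i _ do rewrite UtE -scalerAl.
by rewrite sum_delta0 subrr.
Qed.

Lemma spD_annihilator (d : int) c : GD d c -> Om * c = 0 ->
  d < m \/ (forall i, Ut i = (i == z0)%:R *: Om) -> c = 0.
Proof.
case: d => [d|d] Gc Oc cond; last by apply: (pres_neg hD _ Gc).
apply: (spD_annihilator_nat Gc Oc); case: cond; [left|right] => //.
Qed.

Section Syzygy.
(* The entries of the syzygies kap i of top_syzygy at the relations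
   d_j w = 0 (al i j) and x_j (d_1 w) = p_j (d_1 w) x_j (be i j), extended by 0
   to j = ord0. *)
Variables (e : int) (al be : 'I_n.+1 -> 'I_n.+1 -> D).
Hypothesis e0 : e <= 0.
Hypothesis al0 : forall i, al i z0 = 0.
Hypothesis be0 : forall i, be i z0 = 0.
Hypothesis Gal : forall i j, GD (e + m) (al i j).
Hypothesis Gbe : forall i j, GD (e + m - 1) (be i j).
Hypothesis Xal : forall j, \sum_i X i * al i j = 0.
Hypothesis Xbe : forall j, \sum_i X i * be i j = 0.
Hypothesis albe : forall i l, \sum_j (al i j * (q l *: Nd j l) +
  be i j * (q l *: (X j * Nd z0 l) - ((j == l)%:R * p j) *: Om)) = 0.

(** As e <= 0, only scalars occur. Keeping [GD e c%:A] next to such a scalar c records that c = 0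
    when e < 0, so all e are treated together. *)
Lemma tail_scalar y : GD e y -> exists c : k, y = c%:A.
Proof.
move=> Gy; have [ez|en] := eqVneq e 0.
  by apply: (pres_zero hD); rewrite -ez.
by exists 0; rewrite scale0r; apply: (pres_neg hD _ Gy); rewrite lt_neqAle en.
Qed.

(** Each column of [be] is a right syzygy of the generators. In [spD_right] the term t has degree e
    - 1 < 0 and disappears, and s has degree e, hence is scalar. *)
Lemma tail_be : exists b : 'I_n.+1 -> 'I_n.+1 -> k, [/\ forall i j, GD e (b i j)%:A,
  forall i, b i z0 = 0, forall j, b z0 j = 0
  & forall i j, be i j = \sum_a b a j *: Nd i a].
Proof.
have step j : exists b : 'I_n.+1 -> k, [/\ forall i, GD e (b i)%:A,
    j == z0 -> forall i, b i = 0, b z0 = 0 & forall i, be i j = \sum_a b a *: Nd i a].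
  have [->|jz] := eqVneq j z0.
    exists (fun=> 0); split=> // [i|i]; first by rewrite scale0r; exact: (grade0 gD).
    by rewrite be0 big1 // => a _; rewrite scale0r.
  have [s [t [Gs Gt t0 s0 beE]]] := spD_right (fun i => Gbe i j) (Xbe j).
  have tz i : t i = 0.
    by apply: (pres_neg hD _ (Gt i)); move: e0; lia.
  have Gs' i : GD e (s i).
    by have := Gs i; rewrite (_ : e + m%:Z - 1 + 1 - m%:Z = e) //; lia.
  have /choice[b bE] : forall i, exists c : k, s i = c%:A by move=> i; exact: tail_scalar.
  exists b; split=> // [i||i]; first by rewrite -bE.
    apply: spD_scal_inj; rewrite -bE -[LHS]addr0 -[RHS]s0; congr (_ + _).
    by rewrite big1 // => i _; rewrite tz mulr0 scaler0.
  by rewrite beE tz mulr0 addr0; apply: eq_bigr => a _; rewrite bE mulr_algr.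
have /choice[b bP] := step; exists (fun i j => b j i); split=> [i j|i|j|i j].
- by have [+ _ _ _] := bP j; apply.
- by have [_ + _ _] := bP z0; apply.
- by have [_ _ + _] := bP j.
- by have [_ _ _ +] := bP j; apply.
Qed.

(** The same as for [be], one degree higher: now t is scalar and s is of degree e + 1. *)
Lemma tail_al : exists (a : 'I_n.+1 -> 'I_n.+1 -> k) (c : 'I_n.+1 -> 'I_n.+1 -> D),
  [/\ forall i j, GD e (a i j)%:A, forall i j, GD (e + 1) (c i j),
    forall j, a z0 j = 0, forall i, c i z0 = 0 /\ a i z0 = 0 &
    (forall j, c z0 j + \sum_i p i *: (a i j *: X i) = 0) /\
    forall i j, al i j = \sum_l Nd i l * c l j + a i j *: Om].
Proof.
have step j : exists (a : 'I_n.+1 -> k) (c : 'I_n.+1 -> D), [/\ forall i, GD e (a i)%:A,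
    forall i, GD (e + 1) (c i), a z0 = 0, j == z0 -> forall i, c i = 0 /\ a i = 0 &
    c z0 + \sum_i p i *: (a i *: X i) = 0 /\
    forall i, al i j = \sum_l Nd i l * c l + a i *: Om].
  have [->|jz] := eqVneq j z0.
    exists (fun=> 0), (fun=> 0); split=> // [i|i|].
    - by rewrite scale0r; exact: (grade0 gD).
    - exact: (grade0 gD).
    split; first by rewrite big1 ?addr0 // => i _; rewrite scale0r scaler0.
    by move=> i; rewrite al0 scale0r addr0 big1 // => l _; rewrite mulr0.
  have [s [t [Gs Gt t0 s0 alE]]] := spD_right (fun i => Gal i j) (Xal j).
  have Gt' i : GD e (t i).
    by have := Gt i; rewrite (_ : e + m%:Z - m%:Z = e) //; lia.
  have /choice[a aE] : forall i, exists c : k, t i = c%:A by move=> i; exact: tail_scalar.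
  exists a, s; split=> // [i|i||].
  - by rewrite -aE.
  - by have := Gs i; rewrite (_ : e + m%:Z + 1 - m%:Z = e + 1) //; lia.
  - by apply: spD_scal_inj; rewrite -aE.
  split; first by rewrite -[RHS]s0; congr (_ + _); apply: eq_bigr => i _; rewrite aE mulr_algr.
  by move=> i; rewrite alE aE mulr_algr.
have /choice[a /choice[c acP]] := step; exists (fun i j => a j i), (fun i j => c j i).
split=> [i j|i j|j|i|].
- by have [+ _ _ _ _] := acP j; apply.
- by have [_ + _ _ _] := acP j; apply.
- by have [_ _ + _ _] := acP j.
- by have [_ _ _ + _] := acP z0; apply.
- by split=> [j|i j]; have [_ _ _ _ []] := acP j.
Qed.

(* The scalars v below satisfy \sum_j v_jl tau(u_j) = v_1l Om and
   v_jl = - delta_jl p_j q_j la.  So the claim holds if la != 0, while la = 0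
   makes all al and be vanish. *)
Lemma tail_tau : (exists i j, al i j != 0 \/ be i j != 0) ->
  forall i, Ut i = (i == z0)%:R *: Om.
Proof.
move=> nz; have [b [Gb b_z0 bz0 beE]] := tail_be.
have [a [c [Ga Gc az0 ca_z0 [cz0 alE]]]] := tail_al.
(* With the shapes of [al] and [be] inserted, [albe] says that N maps each column of s into Om D, so
   that [spD_exact2] applies. *)
pose s i l := \sum_j (q l *: (c i j * Nd j l) +
  b i j *: (q l *: (X j * Nd z0 l) - ((j == l)%:R * p j) *: Om)).
have sN i l : \sum_j Nd i j * s j l = Om * - \sum_j (a i j * q l) *: Nd j l.
  apply/eqP; rewrite mulrN -addr_eq0; apply/eqP; rewrite -[RHS](albe i l).
  under eq_bigr => j _ do rewrite mulr_sumr.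
  rewrite exchange_big mulr_sumr -big_split; apply: eq_bigr => j _ /=.
  rewrite alE beE mulrDl !mulr_suml.
  under eq_bigr => t _ do rewrite mulrDr.
  rewrite big_split /= addrAC; congr (_ + _ + _).
  - by apply: eq_bigr => t _; rewrite -!scalerAr mulrA.
  - by rewrite -scalerAl -!scalerAr scalerA.
  - by apply: eq_bigr => t _; rewrite -scalerAr -scalerAl.
have Gs i l : GD (e + m) (s i l).
  apply: (grade_sum gD) => j _; apply: (gradeD gD).
    apply: (pres_scale hD); rewrite (_ : e + m%:Z = (e + 1) + (m%:Z - 1)); last by ring.
    by apply: (pres_mul hD) => //; exact: spD_Nd_deg.
  apply: spD_scal_deg => //; apply: (gradeB gD); apply: (pres_scale hD); last exact: spD_Om_deg.
  rewrite (_ : m%:Z = 1 + (m%:Z - 1)); last by ring.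
  by apply: (pres_mul hD); [exact: pres_gen hD _ | exact: spD_Nd_deg].
have /choice[et /choice[v svP]] : forall l, exists (et : D) (v : 'I_n.+1 -> k),
    [/\ GD (e + m - 1) et, forall i, GD e (v i)%:A &
      forall i, s i l = q i *: (X i * et) + v i *: Om].
  move=> l; have [et [v [Get Gv sE]]] := spD_exact2 (fun i => Gs i l) (sN ^~ l).
  have Gv' i : GD e (v i) by have := Gv i; rewrite (_ : e + m%:Z - m%:Z = e) //; lia.
  have /choice[v' vE] : forall i, exists c : k, v i = c%:A by move=> i; exact: tail_scalar.
  exists et, v'; split=> // i; first by rewrite -vE.
  by rewrite sE vE mulr_algr.
have Get l : GD (e + m - 1) (et l) by have [] := svP l.
have Gv l i : GD e (v l i)%:A by have [_ + _] := svP l; apply.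
have sE i l : s i l = q i *: (X i * et l) + v l i *: Om by have [_ _ +] := svP l; apply.
have em1 : e + m - 1 < m by move: e0; lia.
(* Om times this sum is [sN] rewritten by [spD_mul_N]. The degree e + m - 1 is below m, so Om can be
   cancelled unconditionally. *)
have star i l : (i == z0)%:R *: et l + \sum_j v l j *: Nt i j +
    \sum_j (a i j * q l) *: Nd j l = 0.
  apply: (spD_annihilator (d := e + m - 1)); last by left.
    apply: (gradeD gD); first apply: (gradeD gD).
    - exact: (pres_scale hD).
    - apply: (grade_sum gD) => j _; rewrite -addrA.
      by apply: spD_scal_deg => //; exact: spD_Nt_deg.
    - apply: (grade_sum gD) => j _; rewrite mulrC -scalerA -addrA; apply: (pres_scale hD).
      by apply: spD_scal_deg => //; exact: spD_Nd_deg.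
  rewrite mulrDr; apply/eqP; rewrite addr_eq0 -mulrN -sN; apply/eqP.
  rewrite (@spD_mul_N (s^~ l) (et l) (fun j => (v l j)%:A)) => [|j]; last first.
    by rewrite sE mulr_algr.
  by congr (_ * (_ + _)); apply: eq_bigr => j _; rewrite mulr_algr.
(* The row ord0 of s is computed both from [cz0] and from [sE]; [star] makes the two results
   comparable. *)
have star2 l : \sum_j v l j *: Ut j = v l z0 *: Om.
  have s0 : s z0 l = - \sum_i p i *: (X i * \sum_j (a i j * q l) *: Nd j l).
    rewrite /s; under eq_bigr => j _ do rewrite bz0 scale0r addr0.
    under [in RHS]eq_bigr => i _ do rewrite mulr_sumr scaler_sumr.
    rewrite exchange_big -sumrN /=; apply: eq_bigr => j _.
    have /eqP := cz0 j; rewrite addr_eq0 => /eqP ->; rewrite mulNr scalerN mulr_suml scaler_sumr.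
    congr (- _); apply: eq_bigr => i _.
    by rewrite -!scalerAl -scalerAr !scalerA; congr (_ *: _); ring.
  have := sE z0 l; rewrite s0.
  under eq_bigr => i _.
    have /eqP := star i l; rewrite addrC addr_eq0 => /eqP ->.
    rewrite mulrN scalerN mulrDr scalerDr -scalerAr scalerA mulrC -scalerA mulr_sumr scaler_sumr.
    over.
  rewrite sumrN opprK big_split /= (sum_delta0 (fun i => p i *: (X i * et l))) pq => /addrI <-.
  rewrite exchange_big; apply: eq_bigr => j _ /=; rewrite -spD_Nt_left scaler_sumr.
  by apply: eq_bigr => i _; rewrite -scalerAr !scalerA mulrC.
(* Multiplying s on the right by the column of the x_l gives 0, by [spD_N_right] and normality.
   Hence x_i et' is in Om D for all i, and [spD_exact3] makes et' a scalar multiple of Om. *)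
pose et' := \sum_l et l * X l.
have sX i : q i *: (X i * et') + Om * \sum_l v l i *: X l = 0.
  transitivity (\sum_l s i l * X l).
    rewrite mulr_sumr scaler_sumr mulr_sumr -big_split; apply: eq_bigr => l _ /=.
    by rewrite sE mulrDl -!scalerAl -scalerAr mulrA.
  under eq_bigr => l _ do rewrite mulr_suml.
  rewrite exchange_big big1 //= => j _.
  under eq_bigr => l _ do rewrite mulrDl -!scalerAl mulrBl -!scalerAl -!mulrA.
  rewrite big_split /=.
  under eq_bigr => l _ do rewrite scalerAr.
  rewrite -mulr_sumr spD_N_right -scaler_sumr sumrB.
  under [Z in _ + _ *: (Z - _)]eq_bigr => l _ do rewrite scalerAr.
  rewrite -mulr_sumr spD_N_right eqxx scale1r.
  under eq_bigr => l _ do rewrite -scalerA.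
  rewrite (sum_delta j (fun l => p j *: (Om * X l))) spD_comm subrr scaler0 addr0.
  by case: eqP => [->|_]; rewrite ?(proj1 (ca_z0 i)) ?mul0r // scale0r mulr0.
have Get' : GD (e + m) et'.
  apply: (grade_sum gD) => l _; rewrite -[e + m](subrK 1).
  by apply: (pres_mul hD) => //; exact: pres_gen hD _.
have [la etE] : exists la : k, et' = la *: Om.
  have [i|la Gla ->] := spD_exact3 (b := fun i => - ((q i)^-1 *: \sum_l v l i *: X l)) Get'.
    rewrite mulrN -scalerAr; apply/eqP; rewrite -addr_eq0 -(inj_eq (scalerI (q0 i))) scaler0.
    by rewrite scalerDr scalerA mulfV // scale1r sX.
  have [|la' ->] := @tail_scalar la; last by exists la'; rewrite mulr_algr.
  by move: Gla; rewrite (_ : e + m%:Z - m%:Z = e) //; lia.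
(* After substituting et' = la Om in [sX], cancelling Om in degree 1 < m leaves a linear relation
   between the generators, which are independent in D. *)
have vE l i : v l i = - ((i == l)%:R * (q i * p i * la)).
  have gd1 : hgrade 1 (\sum_l (v l i + (i == l)%:R * (q i * p i * la)) *: x l).
    by apply: hgrade_sum => j _; apply: hgradeZ; exact: hgrade_gen.
  have pd0 : pd (\sum_l (v l i + (i == l)%:R * (q i * p i * la)) *: x l) = 0.
    apply: (spD_annihilator (d := 1)); first exact: (pres_pi hD).
      rewrite -[RHS](sX i) addrC etE -scalerAr spD_comm linear_sum /=.
      under eq_bigr => j _ do rewrite linearZ /= scalerDl -scalerA.
      rewrite big_split mulrDr /=; congr (_ + _).
      by rewrite (sum_delta i (fun j => (q i * p i * la) *: X j)) -scalerAr !scalerA; congr (_ *: _); ring.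
    by left; rewrite ltz_nat.
  have := spD_inj _ gd1 pd0; rewrite ltz_nat => /(_ hm) /(congr1 (rpart l)).
  under eq_bigr => j _ do rewrite -[_ *: x j]mul1r -scalerAr scalerAl.
  rewrite rpart_sum linear0 => /eqP; rewrite scaler_eq0 oner_eq0 orbF addr_eq0.
  by move/eqP.
have [la0|la0] := eqVneq la 0; last first.
  move=> i; have := star2 i; rewrite (bigD1 i) //= big1 => [|j /negbTE ji]; last first.
    by rewrite vE ji mul0r oppr0 scale0r.
  rewrite addr0 !vE eqxx mul1r eq_sym; case: eqP => [->|_]; rewrite ?mul1r ?mul0r ?oppr0 ?scale0r ?scale1r.
    move=> /(scalerI _) -> //; by rewrite oppr_eq0 !mulf_neq0.
  move=> /eqP; rewrite scaler_eq0 oppr_eq0 !mulf_eq0 (negbTE (q0 _)) (negbTE (p0 _)) (negbTE la0).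
  by move=> /eqP.
have v0 l i : v l i = 0 by rewrite vE la0 !mulr0 oppr0.
have vs0 l (F : 'I_n.+1 -> D) : \sum_j v l j *: F j = 0.
  by rewrite big1 // => j _; rewrite v0 scale0r.
have et0 l : et l = 0.
  have := star z0 l; rewrite eqxx scale1r vs0 addr0 big1 ?addr0 // => j _.
  by rewrite az0 mul0r scale0r.
have s0 i l : s i l = 0 by rewrite sE et0 v0 mulr0 scaler0 scale0r addr0.
(* [star] now reduces to \sum_j a_ij N_jl = 0 in degree m - 1, where T and D agree. Multiplying by
   q_l x_l and summing over l gives \sum_j a_ij u_j = 0. *)
have a0 i j : a i j = 0.
  have f0 l : \sum_j a i j *: N j l = 0.
    apply: (@spD_inj (m%:Z - 1)); first by rewrite ltrBlDr ltrDl.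
      by apply: hgrade_sum => t _; apply: hgradeZ; exact: sp_N_deg.
    apply/eqP; rewrite -(inj_eq (scalerI (q0 l))) scaler0; apply/eqP.
    have := star i l; rewrite et0 scaler0 add0r vs0 add0r => <-.
    rewrite linear_sum scaler_sumr; apply: eq_bigr => t _.
    by rewrite linearZ scalerA mulrC.
  move: j; apply: sp_independent.
  under eq_bigr => t _ do rewrite sp_u_right scaler_sumr.
  rewrite exchange_big big1 //= => l _.
  under eq_bigr => t _ do rewrite scalerA mulrC -scalerA scalerAl.
  by rewrite -scaler_sumr -mulr_suml f0 mul0r scaler0.
have c_z0 j : c z0 j = 0.
  have := cz0 j; rewrite big1 ?addr0 // => i _.
  by rewrite a0 scale0r scaler0.
(* The identity s = 0 has degree e + m <= m, where the relations of D are known exactly. It is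
   therefore lifted to T, with C lifting c. *)
have /choice[C /all_and2[GC CE]] : forall ij : 'I_n.+1 * 'I_n.+1,
    exists C, hgrade (e + 1) C /\ pd C = c ij.1 ij.2.
  by move=> ij; have [C] := pres_lift hD (Gc ij.1 ij.2); exists C.
have e1 : e + 1 < m by move: e0 hm; lia.
have C0 i : C (i, z0) = 0.
  by apply: (spD_inj e1 (GC _)); rewrite CE (proj1 (ca_z0 i)).
have bcase i j : e < 0 -> b i j = 0.
  by move=> en; apply: spD_scal_inj; apply: (pres_neg hD en).
pose f i l := \sum_j (q l *: (C (i, j) * N j l) +
  b i j *: (q l *: (x j * N z0 l) - ((j == l)%:R * p j) *: u z0)).
have pf i l : pd (f i l) = 0.
  rewrite -[RHS](s0 i l) linear_sum; apply: eq_bigr => j _.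
  rewrite linearD /=; congr (_ + _); first by rewrite linearZ /= rmorphM /= CE.
  rewrite linearZ /=; congr (_ *: _); rewrite linearB /=; congr (_ - _).
    by rewrite linearZ /= rmorphM.
  by rewrite linearZ.
have Gf i l : hgrade (e + m) (f i l).
  apply: hgrade_sum => j _; apply: hgradeD.
    apply: hgradeZ; rewrite (_ : e + m%:Z = (e + 1) + (m%:Z - 1)); last by ring.
    by apply: hgradeM => //; exact: sp_N_deg.
  have [en|ep] := ltP e 0; first by rewrite bcase // scale0r; exact: hgrade0.
  have -> : e + m = m by have -> : e = 0 by apply/eqP; rewrite eq_le e0.
  apply: hgradeZ; apply: hgradeB; apply: hgradeZ; last exact: sp_u_deg.
  rewrite (_ : m%:Z = 1 + (m%:Z - 1)); last by ring.
  by apply: hgradeM; [exact: hgrade_gen | exact: sp_N_deg].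
have fX i : \sum_l f i l * x l =
    \sum_j (C (i, j) * u j + b i j *: (x j * u z0 - p j *: (u z0 * x j))).
  under eq_bigr => l _ do rewrite mulr_suml.
  rewrite exchange_big; apply: eq_bigr => j _ /=.
  under eq_bigr => l _ do rewrite mulrDl -!scalerAl mulrBl -!scalerAl -!mulrA.
  rewrite big_split /=; congr (_ + _).
    by rewrite sp_u_right mulr_sumr; apply: eq_bigr => l _; rewrite -scalerAr.
  rewrite -scaler_sumr sumrB; congr (_ *: (_ - _)).
    by rewrite sp_u_right mulr_sumr; apply: eq_bigr => l _; rewrite -scalerAr.
  under eq_bigr => l _ do rewrite -scalerA.
  exact: (sum_delta j (fun l => p j *: (u z0 * x l))).
have em : e + m <= m by move: e0; lia.
have key i j : b i j = 0 /\ C (i, j) = 0.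
  have [en|ep] := ltP e 0.
    split; first exact: bcase.
    have f0 l : f i l = 0 by apply: (spD_inj _ (Gf i l) (pf i l)); move: en; lia.
    have CS t : C (i, t) = (aug (C (i, t)) : k)%:A.
      have [e1n|e1p] := ltP (e + 1) 0.
        by rewrite (hgrade_neg e1n (GC (i, t))) linear0 scale0r.
      apply: hgrade0P; have := GC (i, t).
      by rewrite (_ : e + 1 = 0) //; move: en e1p; lia.
    rewrite CS; suff -> : aug (C (i, j)) = 0 by rewrite scale0r.
    move: j; apply: (@sp_independent (fun j => aug (C (i, j)))).
    transitivity (\sum_l f i l * x l); last by rewrite big1 // => l _; rewrite f0 mul0r.
    rewrite fX; apply: eq_bigr => t _.
    by rewrite bcase // scale0r addr0 CS linearZ /= aug1 /GRing.scale /= mulr1 -scalerAl mul1r.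
  have ez : e = 0 by apply/eqP; rewrite eq_le e0.
  have GC1 t : hgrade 1 (C (i, t)) by have := GC (i, t); rewrite ez add0r.
  have augC t : aug (C (i, t)) = 0 by apply: hgrade_aug (GC1 t).
  have /choice[mu muP] : forall l, exists mu : 'I_n.+1 -> k,
      mu z0 = 0 /\ f i l = \sum_t mu t *: u t.
    by move=> l; have [mu] := spD_low em (Gf i l) (pf i l); exists mu.
  (* Collecting the terms that end in a generator writes an element of V (x) R as \sum_t u_t y_t,
     the situation of [sp_two_sided]. *)
  pose y t := \sum_l mu l t *: x l + (t == z0)%:R *: \sum_j (b i j * p j) *: x j.
  have Gy t : hgrade 1 (y t).
    apply: hgradeD; last apply: hgradeZ.
      by apply: hgrade_sum => l _; apply: hgradeZ; exact: hgrade_gen.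
    by apply: hgrade_sum => l _; apply: hgradeZ; exact: hgrade_gen.
  have Cuy : \sum_j C (i, j) * u j + \sum_j b i j *: (x j * u z0) = \sum_t u t * y t.
    have := fX i; rewrite big_split /=.
    have -> : \sum_j b i j *: (x j * u z0 - p j *: (u z0 * x j)) =
        \sum_j b i j *: (x j * u z0) - u z0 * \sum_j (b i j * p j) *: x j.
      rewrite mulr_sumr -sumrB; apply: eq_bigr => t _.
      by rewrite scalerBr scalerA -scalerAr.
    rewrite addrA => /eqP; rewrite eq_sym subr_eq => /eqP ->.
    rewrite /y; under [in RHS]eq_bigr => t _ do rewrite mulrDr -scalerAr.
    rewrite big_split /= (sum_delta0 (fun t => u t * \sum_j (b i j * p j) *: x j)).
    congr (_ + _).
    under eq_bigr => l _ do rewrite (proj2 (muP l)) mulr_suml.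
    rewrite exchange_big; apply: eq_bigr => t _ /=; rewrite mulr_sumr.
    by apply: eq_bigr => l _; rewrite -scalerAl scalerAr.
  have [t|la' yE] := sp_two_sided Gy.
    have -> : \sum_j N t j * y j = lpart t (\sum_j u j * y j).
      rewrite linear_sum; apply: eq_bigr => j' _.
      by rewrite /= lpartM sp_aug_u scale0r addr0.
    rewrite -Cuy 2!linearD !linear_sum /= big1 ?add0r => [|j' _]; last first.
      by rewrite lpartM augC scale0r addr0 rmorphM /= (pi_rel hA) mulr0.
    rewrite big1 // => j' _; rewrite linearZ /= lpartM aug_gen scale0r addr0 linearZ /= rmorphM /=.
    by rewrite (pi_rel hA) mulr0 scaler0.
  have y0E : \sum_j (b i j * p j) *: x j = (la' * q z0) *: x z0.
    by rewrite -yE /y eqxx scale1r [Z in _ = Z + _]big1 ?add0r // => l _; rewrite (proj1 (muP l)) scale0r.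
  have bpE t : b i t * p t = (t == z0)%:R * (la' * q z0).
    have := congr1 (rpart t) y0E.
    under eq_bigr => j' _ do rewrite -[_ *: x j']mul1r -scalerAr scalerAl.
    rewrite rpart_sum linearZ /= -[x z0]mul1r rpart_Mgen eq_sym scalerA => /eqP.
    rewrite -subr_eq0 -scalerBl scaler_eq0 oner_eq0 orbF subr_eq0 => /eqP ->.
    by rewrite mulrC.
  (* No multiple of u_1 occurs among the relations of degree m of D, so y at ord0 is \sum_j b_ij p_j
     x_j. Its coefficient at x_1 is 0, because b_i1 = 0. *)
  have la'0 : la' = 0.
    have := bpE z0; rewrite b_z0 mul0r eqxx mul1r => /esym/eqP.
    by rewrite mulf_eq0 (negbTE (q0 _)) orbF => /eqP.
  have b0 t : b i t = 0.
    by have := bpE t; rewrite la'0 mul0r mulr0 => /eqP; rewrite mulf_eq0 (negbTE (p0 _)) orbF => /eqP.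
  split; first exact: b0.
  have Cu0 : \sum_j C (i, j) * u j = 0.
    transitivity (\sum_t u t * y t).
      by rewrite -Cuy [Z in _ + Z]big1 ?addr0 // => t _; rewrite b0 scale0r.
    by rewrite big1 // => t _; rewrite yE la'0 mul0r scale0r mulr0.
  rewrite (lpart_decomp (C (i, j))) augC scale0r add0r big1 // => t _.
  have CS j' : lpart t (C (i, j')) = (aug (lpart t (C (i, j'))) : k)%:A.
    by apply: hgrade0P; apply: hgrade_lpart; rewrite add0r.
  rewrite CS; suff -> : aug (lpart t (C (i, j))) = 0 by rewrite scale0r mulr0.
  move: j; apply: (@sp_independent (fun j => aug (lpart t (C (i, j))))).
  transitivity (lpart t (\sum_j C (i, j) * u j)); last by rewrite Cu0 linear0.
  rewrite linear_sum; apply: eq_bigr => j' _.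
  by rewrite /= lpartM augC scale0r addr0 CS linearZ /= aug1 /GRing.scale /= mulr1 -scalerAl mul1r.
case: nz => i1 [j1 [|]].
  rewrite alE a0 scale0r addr0 big1 ?eqxx // => l _.
  by rewrite -[c l j1]/(c (l, j1).1 (l, j1).2) -CE (proj2 (key l j1)) linear0 mulr0.
by rewrite beE big1 ?eqxx // => l _; rewrite (proj1 (key l j1)) scale0r.
Qed.

End Syzygy.

Lemma sp_comm_rpart l i : rpart l (x i * u z0 - p i *: (u z0 * x i)) =
  q l *: (x i * N z0 l) - ((i == l)%:R * p i) *: u z0.
Proof.
rewrite linearB; congr (_ - _); first by rewrite /= rpartM sp_aug_u scale0r addr0 sp_rpart scalerAr.
by rewrite linearZ /= rpart_Mgen scalerA mulrC.
Qed.

(** * The twist fixes the relations, and Om is regular *)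

Section RegularD.
Variables (K : lmodType D) (e : K) (P : proj_resolution K).
Variable GP : forall i, int -> P i -> Prop.
Arguments GP : clear implicits.
Hypotheses (hK : trivial_module GD e) (gP : graded_resolution GD (@trivial_grade K) GP).
Variable l : int.
Hypothesis extR : ext_trivial_regular_iso GD GP 4 l.
Hypothesis ext3 : ext_vanishes GP (GD : int -> D^o -> Prop) 3.
Hypothesis pdK : pd_le K 4.

Lemma spD_tau_u i : Ut i = (i == z0)%:R *: Om.
Proof.
have k0 : 'I_n := Ordinal (sp_two_gens).
(* The syzygy needed by [top_syzygy] consists of the right parts of one relation u_i = 0 of D. Its
   degree m - 1 is below those of all relations, and the highest of these is m + 1. *)
pose y0 j := pd (rpart j (u (lift z0 k0))).
have hr j : hgrade (m%:Z - 1) (rpart j (u (lift z0 k0))).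
  by apply: hgrade_rpart; rewrite subrK; exact: sp_u_deg.
have [|t|t|j|||de [kap [dle Gkap kapR Xkap [i1 kap0]]]] :=
  @top_syzygy _ _ _ _ _ _ _ _ _ hD K e P GP hK gP l extR ext3 pdK (m%:Z - 1) m.+1 y0.
- by rewrite subr_eq0 eqz_nat; case: m hm => [|[]].
- by rewrite /sp_reldeg; case: split => _; lia.
- by rewrite /sp_reldeg; case: split => _; lia.
- exact: (pres_pi hD).
- have := rel_decomp hD (lshift n k0); rewrite /sp_rel split_lshift; apply.
- apply: contrapT => none; have u0 : u (lift z0 k0) = 0.
    rewrite (rpart_decomp (u _)) sp_aug_u scale0r add0r big1 // => j _.
    have -> : rpart j (u (lift z0 k0)) = 0; last by rewrite mul0r.
    apply: (spD_inj _ (hr j)); first by rewrite ltrBlDr ltrDl.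
    by apply/eqP; apply: contra_notT none => nz; exists j.
  have := @sp_independent (fun i => (lift z0 k0 == i)%:R).
  rewrite (sum_delta (lift z0 k0) u) u0 => /(_ erefl (lift z0 k0)) /eqP.
  by rewrite eqxx oner_eq0.
pose al i j := if unlift z0 j is Some j' then kap i 0 (lshift n j') else 0.
pose be i j := if unlift z0 j is Some j' then kap i 0 (rshift n j') else 0.
have all j i' : al i' (lift z0 j) = kap i' 0 (lshift n j) by rewrite /al liftK.
have bel j i' : be i' (lift z0 j) = kap i' 0 (rshift n j) by rewrite /be liftK.
have al0 i' : al i' z0 = 0 by rewrite /al unlift_none.
have be0 i' : be i' z0 = 0 by rewrite /be unlift_none.
(* The bound of [top_syzygy] is de < 2m + 1, that is, ee <= 0. *)
pose ee : int := de - m%:Z - m%:Z.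
have ent t : \sum_i' X i' * kap i' 0 t = 0.
  have /rowP/(_ t) := Xkap; rewrite summxE [RHS]mxE => E; rewrite -[RHS]E.
  by apply: eq_bigr => i' _; rewrite mxE.
apply: (@tail_tau ee al be) => // [|i' j|i' j|j|j|i' l'|].
- by rewrite /ee; move: dle; lia.
- rewrite /al; case: unliftP => [j' _|_]; last exact: (grade0 gD).
  have := Gkap i' (lshift n j'); rewrite /sp_reldeg split_lshift.
  by rewrite (_ : ee + m%:Z = de - m%:Z) // /ee; lia.
- rewrite /be; case: unliftP => [j' _|_]; last exact: (grade0 gD).
  have := Gkap i' (rshift n j'); rewrite /sp_reldeg split_rshift.
  by rewrite (_ : ee + m%:Z - 1 = de - m.+1%:Z) // /ee; lia.
- case: (unliftP z0 j) => [j'|] ->.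
    by under eq_bigr => i' _ do rewrite all.
  by rewrite big1 // => i' _; rewrite al0 mulr0.
- case: (unliftP z0 j) => [j'|] ->.
    by under eq_bigr => i' _ do rewrite bel.
  by rewrite big1 // => i' _; rewrite be0 mulr0.
- have /rowP/(_ l') := kapR i'; rewrite !mxE big_split_ord /= => E.
  rewrite big_ord_recl al0 be0 !mul0r addr0 add0r -[RHS]E -big_split; apply: eq_bigr => j _ /=.
  rewrite all bel !mxE /sp_rel split_lshift split_rshift sp_rpart sp_comm_rpart.
  congr (_ * _ + _ * _); first by rewrite linearZ.
  rewrite [RHS]linearB; congr (_ - _); last by rewrite linearZ.
  by rewrite linearZ /= rmorphM.
apply: contrapT => none.
have z j i' : al i' j = 0 /\ be i' j = 0.
  by split; apply/eqP; apply: contra_notT none => nz; exists i', j; [left|right].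
case/negP: kap0; apply/eqP/rowP => t; rewrite mxE.
case: (split_ordP t) => j ->; first by rewrite -all (proj1 (z _ _)).
by rewrite -bel (proj2 (z _ _)).
Qed.

Lemma spD_regular d c : GD d c -> Om * c = 0 -> c = 0.
Proof. by move=> Gc Oc; apply: (spD_annihilator Gc Oc); right; exact: spD_tau_u. Qed.

(** From D back to T: tau(u_i) is a combination of the u_a, so tau(w) lies in R (x) V, and its left
    parts p_i tau(u_i) are in R. By [sp_two_sided] tau(w) is a multiple of w; the coefficient of u_1
    in tau(u_1) being 1, the factor is p_1. *)
Lemma sp_tau_u i : tau (u i) = (p z0 / p i) *: u i.
Proof.
have /choice[mu muP] : forall i, exists mu : 'I_n.+1 -> k,
    mu z0 = (i == z0)%:R /\ tau (u i) = \sum_a mu a *: u a.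
  move=> {}i; have [||c c0 cE] := @spD_low m (tau (u i) - (i == z0)%:R *: u z0) (lexx _).
  - by apply: hgradeB; [apply: sp_tau_deg | apply: hgradeZ]; exact: sp_u_deg.
  - by rewrite linearB linearZ /= spD_tau_u subrr.
  exists (fun a => c a + (a == z0)%:R * (i == z0)%:R); first split.
    by rewrite c0 add0r eqxx mul1r.
  under eq_bigr => a _ do rewrite scalerDl -scalerA.
  rewrite big_split /= (sum_delta0 (fun a => (i == z0)%:R *: u a)) -cE.
  by rewrite subrK.
pose y a := \sum_j (q j * p j * mu j a) *: x j.
have tw : tau w = \sum_a u a * y a.
  rewrite sp_w_right linear_sum /=.
  under eq_bigr => j _ do rewrite linearZ /= sp_tauM sp_tau_gen (proj2 (muP j)) -scalerAr scalerA mulr_suml scaler_sumr.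
  rewrite exchange_big; apply: eq_bigr => a _ /=; rewrite mulr_sumr; apply: eq_bigr => j _.
  by rewrite -scalerAl -scalerAr scalerA.
have [a|t|la yE] := sp_two_sided (y := y).
- by apply: hgrade_sum => j _; apply: hgradeZ; exact: hgrade_gen.
- have -> : \sum_j N t j * y j = lpart t (tau w).
    rewrite tw linear_sum; apply: eq_bigr => j _.
    by rewrite /= lpartM sp_aug_u scale0r addr0.
  rewrite sp_lpart_tau linearZ /= -/(u t) (proj2 (muP t)) linear_sum big1 ?scaler0 // => a _.
  by rewrite linearZ /= (pi_rel hA) scaler0.
have muE j a : q j * p j * mu j a = (j == a)%:R * (la * q a).
  have := congr1 (rpart j) (yE a); rewrite /y.
  under eq_bigr => j' _ do rewrite -[_ *: x j']mul1r -scalerAr scalerAl.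
  rewrite rpart_sum linearZ /= -[x a]mul1r rpart_Mgen eq_sym scalerA => /eqP.
  rewrite -subr_eq0 -scalerBl scaler_eq0 oner_eq0 orbF subr_eq0 => /eqP ->.
  by rewrite mulrC.
have laE : la = p z0.
  have := muE z0 z0; rewrite (proj1 (muP z0)) eqxx mulr1 mul1r mulrC => /(mulIf (q0 _)).
  by [].
rewrite (proj2 (muP i)) (bigD1 i) //= big1 ?addr0 => [|a ai].
  congr (_ *: _); apply: (mulfI (q0 i)); apply: (mulfI (p0 i)).
  rewrite mulrA [p i * q i]mulrC muE eqxx mul1r laE.
  by rewrite [q i * _]mulrCA mulrCA mulrA; field; exact: p0.
have /eqP := muE i a; rewrite [i == a]eq_sym (negbTE ai) mul0r !mulf_eq0.
by rewrite (negbTE (q0 _)) (negbTE (p0 _)) => /eqP ->; rewrite scale0r.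
Qed.

End RegularD.
End OnD.
End OnA.
End Superpotential.

(** * The enveloping algebra *)

Lemma finite_basis (k : fieldType) (V : lmodType k) (s : seq V) :
  exists (r : nat) (b : 'I_r -> V),
    [/\ forall c : 'I_r -> k, \sum_i c i *: b i = 0 -> forall i, c i = 0,
        forall i, b i \in s
      & forall v, v \in s -> exists c : 'I_r -> k, v = \sum_i c i *: b i].
Proof.
elim: s => [|v s [r [b [bfree bs bspan]]]].
  by exists 0%N, (fun=> 0); split=> // [c _ []|[]].
have [[c vE]|vn] := pselect (exists c : 'I_r -> k, v = \sum_i c i *: b i).
  exists r, b; split=> // [i|u]; first by rewrite inE bs orbT.
  by rewrite inE => /orP[/eqP ->|/bspan //]; exists c.
pose b' (i : 'I_r.+1) := if unlift ord0 i is Some j then b j else v.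
have b'0 : b' ord0 = v by rewrite /b' unlift_none.
have b'l j : b' (lift ord0 j) = b j by rewrite /b' liftK.
have b'E (c : 'I_r.+1 -> k) : \sum_i c i *: b' i = c ord0 *: v + \sum_i c (lift ord0 i) *: b i.
  by rewrite big_ord_recl b'0; congr (_ + _); apply: eq_bigr => i _; rewrite b'l.
exists r.+1, b'; split=> [c|i|u].
- rewrite b'E => c0; have cz : c ord0 = 0.
    apply/eqP; apply: contra_notT vn => cn; exists (fun i => - (c ord0)^-1 * c (lift ord0 i)).
    under eq_bigr => i _ do rewrite -scalerA.
    rewrite -scaler_sumr; move/eqP: c0; rewrite addrC addr_eq0 => /eqP ->.
    by rewrite scalerN scaleNr opprK scalerA mulVf // scale1r.
  move: c0; rewrite cz scale0r add0r => /bfree cl i.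
  by case: (unliftP ord0 i) => [j|] ->.
- by rewrite /b' inE; case: unliftP => [j _|_]; rewrite ?bs ?orbT ?eqxx.
rewrite inE => /orP[/eqP ->|/bspan [c ->]].
  exists (fun i => (i == ord0)%:R); rewrite b'E eqxx scale1r big1 ?addr0 // => i _.
  by rewrite eq_sym (negbTE (neq_lift _ _)) scale0r.
exists (fun i => if unlift ord0 i is Some j then c j else 0).
rewrite b'E unlift_none scale0r add0r; apply: eq_bigr => i _.
by rewrite liftK.
Qed.

(** The words of length j span the graded piece, so a finite basis can be extracted. The dual
    coordinates are defined on all of B, through the projection to degree j, so as to contract
    tensors with them. *)
Lemma pres_deg_basis (k : fieldType) (n p : nat) (T : word_algebra k n) (B : algType k)
    (pi : {lrmorphism T -> B}) (r : 'I_p -> T) (dr : 'I_p -> int) (G : int -> B -> Prop)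
    (hP : presented pi r dr G) (hG : is_grading G) (j : int) :
  exists (R : nat) (b : 'I_R -> B) (la : 'I_R -> B -> k^o),
    [/\ forall a, G j (b a), forall a, linear (la a),
        forall a a', la a (b a') = (a == a')%:R
      & forall z, gpr hG j z = \sum_a (la a z : k) *: b a].
Proof.
have [S SP] : exists S : seq B, (forall v, v \in S -> G j v) /\
    forall v, G j v -> exists (N : nat) (c : 'I_N -> k) (u : 'I_N -> B),
      (forall i, u i \in S) /\ v = \sum_i c i *: u i.
  case: j => [d|d]; last first.
    exists [::]; split=> // v Gv; exists 0%N, (fun=> 0), (fun=> 0); split; first by case.
    by rewrite big_ord0; exact: (pres_neg hP _ Gv).
  exists [seq pi (wa_word T (val t)) | t <- enum {: d.-tuple 'I_n}]; split.
    move=> v /mapP[t _ ->]; apply: (pres_pi hP).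
    by rewrite -[d in Posz d](size_tuple t); exact: hgrade_word.
  move=> v /(pres_lift hP) [f hf <-]; move: f hf; apply: hgrade_ind.
    by exists 0%N, (fun=> 0), (fun=> 0); split; [case | rewrite big_ord0 linear0].
  move=> c s f [/eqP sd] [N [c' [u [uS fE]]]].
  exists N.+1, (fun i => if unlift ord0 i is Some i' then c' i' else c),
    (fun i => if unlift ord0 i is Some i' then u i' else pi (wa_word T s)); split.
    move=> i; case: unliftP => [i' _|_] //; apply/mapP; exists (Tuple sd) => //.
    by rewrite mem_enum.
  rewrite big_ord_recl unlift_none linearP /= fE; congr (_ + _).
  by apply: eq_bigr => i _; rewrite liftK.
have [R [b [bfree bS bspan]]] := finite_basis S.
have /choice[c cE] : forall z, exists c : 'I_R -> k, gpr hG j z = \sum_a c a *: b a.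
  move=> z; have [N [c [u [uS ->]]]] := (proj2 SP) _ (gpr_grade hG j z).
  have /choice[c' c'E] : forall i, exists c' : 'I_R -> k, u i = \sum_a c' a *: b a.
    by move=> i; exact: bspan.
  exists (fun a => \sum_i c i * c' i a).
  under eq_bigr => i _ do rewrite c'E scaler_sumr.
  rewrite exchange_big; apply: eq_bigr => a _ /=; rewrite scaler_suml.
  by apply: eq_bigr => i _; rewrite scalerA.
have cu z c' : gpr hG j z = \sum_a c' a *: b a -> forall a, c z a = c' a.
  rewrite cE => /eqP; rewrite -subr_eq0 -sumrB => /eqP z0 a; apply/eqP; rewrite -subr_eq0.
  apply/eqP; move: a; apply: (bfree (fun a => c z a - c' a)); rewrite -[RHS]z0.
  by apply: eq_bigr => a _; rewrite scalerBl.
have gZ l y : gpr hG j (l *: y) = l *: gpr hG j y.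
  have mB : {morph (fun z : B => l *: z) : u v / u - v} by move=> u v; rewrite scalerBr.
  have md i z : G i z -> G (i + 0) (l *: z) by rewrite addr0; exact: (pres_scale hP).
  by have := gpr_degree hG hG mB md j y; rewrite addr0.
exists R, b, (fun a z => c z a); split.
- by move=> a; apply: (proj1 SP); exact: bS.
- move=> a l y z; apply: (@cu _ (fun a => l * c y a + c z a)); rewrite raddfD /= gZ !cE scaler_sumr -big_split.
  by apply: eq_bigr => a' _ /=; rewrite scalerDl scalerA.
- move=> a a'; apply: (@cu _ (fun a => (a == a')%:R)); rewrite (gpr_id hG _ (_ : G j _)); last exact: (proj1 SP).
  rewrite eqxx; under eq_bigr => i _ do rewrite eq_sym.
  by rewrite (sum_delta a' b).
- by move=> z; rewrite cE.
Qed.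

Section Enveloping.
Variables (k : fieldType) (D : algType k) (G : int -> D -> Prop).
Hypothesis hG : connected_graded G.
Variables (E : algType k) (t : D -> D -> E).
Hypothesis hE : enveloping t.

Lemma env_ring : graded_ring G. Proof. by case: hG. Qed.
Let gG : is_grading G. Proof. by case: env_ring. Qed.
Lemma env_neg j a : j < 0 -> G j a -> a = 0. Proof. by case: hG => _ h _; exact: h. Qed.
Lemma env_mulG i j a b : G i a -> G j b -> G (i + j) (a * b).
Proof. by case: env_ring => _ _ h; exact: h. Qed.
Lemma env_scaleG j c b : G j b -> G j (c *: b).
Proof.
move=> Gb; rewrite -mulr_algl -[j]add0r; apply: env_mulG => //.
by case: hG => _ _ h; apply/h; exists c.
Qed.

Lemma env_linl b : linear (t^~ b). Proof. by case: hE => -[h _] _ _ _; exact: h. Qed.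
Lemma env_linr a : linear (t a). Proof. by case: hE => -[_ h] _ _ _; exact: h. Qed.
Lemma env_mul a b a' b' : t a b * t a' b' = t (a * a') (b' * b).
Proof. by case: hE. Qed.
Lemma env_one : t 1 1 = 1. Proof. by case: hE. Qed.
Lemma env_suml (I : Type) (s : seq I) (P : pred I) (F : I -> D) b :
  t (\sum_(i <- s | P i) F i) b = \sum_(i <- s | P i) t (F i) b.
Proof. exact: (linear_sum (mklin (env_linl b))). Qed.
Lemma env_sumr (I : Type) (s : seq I) (P : pred I) (F : I -> D) a :
  t a (\sum_(i <- s | P i) F i) = \sum_(i <- s | P i) t a (F i).
Proof. exact: (linear_sum (mklin (env_linr a))). Qed.
Lemma env_scalel c a b : t (c *: a) b = c *: t a b.
Proof. exact: (linearZ_LR (mklin (env_linl b))). Qed.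
Lemma env_scaler c a b : t a (c *: b) = c *: t a b.
Proof. exact: (linearZ_LR (mklin (env_linr a))). Qed.
Lemma env_0l b : t 0 b = 0. Proof. exact: (linear0 (mklin (env_linl b))). Qed.
Lemma env_0r a : t a 0 = 0. Proof. exact: (linear0 (mklin (env_linr a))). Qed.
Lemma env_oppl a b : t (- a) b = - t a b.
Proof. exact: (linearN (mklin (env_linl b))). Qed.
(** E is known only by its universal property. The bilinear map into the span of the pure tensors
    factors through E; followed by the inclusion it is the identity, by uniqueness. *)
Lemma env_span z : exists (N : nat) (a b : 'I_N -> D), z = \sum_i t (a i) (b i).
Proof.
pose S (z : E) := exists (N : nat) (a b : 'I_N -> D), z = \sum_i t (a i) (b i).
have S0 : S 0 by exists 0%N, (fun=> 0), (fun=> 0); rewrite big_ord0.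
have SP c u v : S u -> S v -> S (c *: u + v).
  move=> [N [a [b ->]]] [N' [a' [b' ->]]].
  exists (N + N')%N, (fun i => match split i with inl j => c *: a j | inr j => a' j end),
    (fun i => match split i with inl j => b j | inr j => b' j end).
  rewrite big_split_ord scaler_sumr; congr (_ + _); apply: eq_bigr => i _ /=.
    by rewrite split_lshift env_scalel.
  by rewrite split_rshift.
pose SM := @Submod k E S S0 SP.
have tS a b : `[< S (t a b) >].
  by apply/asboolP; exists 1%N, (fun=> a), (fun=> b); rewrite big_ord1.
pose t' a b : submod_lmod SM := exist _ (t a b) (tS a b).
have t'b : bilinear_map t'.
  split=> [b|a] c u v; apply: val_inj; [exact: env_linl | exact: env_linr].
have [[tl tr] univ _ _] := hE.
have [h [hT _]] := univ _ _ t'b.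
have [h0 [_ h0u]] := univ _ _ (conj tl tr : bilinear_map t).
have il : linear (fun z => submod_incl SM (h z)) by move=> c u v; rewrite !linearP.
have idl : linear (idfun : E -> E) by [].
have -> : z = submod_incl SM (h z).
  rewrite -[LHS]/(mklin idl z) -[RHS]/(mklin il z) (h0u (mklin idl)) //.
  by rewrite (h0u (mklin il)) // => a b /=; rewrite hT.
exact: (submod_inclP (h z)).
Qed.

Lemma env_ext (W : lmodType k) (f g : E -> W) : linear f -> linear g ->
  (forall a b, f (t a b) = g (t a b)) -> f =1 g.
Proof.
move=> lf lg fg z; have [N [a [b ->]]] := env_span z.
rewrite -[f _]/(mklin lf _) -[g _]/(mklin lg _) !linear_sum.
by apply: eq_bigr => i _; exact: fg.
Qed.

(** Contraction of the left factor with a functional. Dual coordinates of a graded piece thus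
    recover the right factors. *)
Lemma env_slice (la : D -> k^o) : linear la ->
  exists L : {linear E -> D}, forall a b, L (t a b) = (la a : k) *: b.
Proof.
move=> ll; have [_ univ _ _] := hE.
have bil : bilinear_map (fun a b : D => (la a : k) *: b : D).
  split=> [b|a] c u v; last by rewrite scalerDr !scalerA mulrC.
  by rewrite ll scalerDl scalerA.
by have [h [hT _]] := univ _ _ bil; exists h.
Qed.

Lemma env_slice_mul (la : D -> k^o) (L : {linear E -> D}) :
  (forall a b, L (t a b) = (la a : k) *: b) -> forall z c, L (z * t 1 c) = c * L z.
Proof.
move=> LE z c; move: z; apply: (@env_ext _ (fun z => L (z * t 1 c)) (fun z => c * L z)).
- by move=> l u v; rewrite mulrDl -scalerAl linearP.
- by move=> l u v; rewrite linearP mulrDr -scalerAr.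
- by move=> a b; rewrite env_mul mulr1 !LE scalerAr.
Qed.

Lemma gpr_scalar j c a : gpr gG j (c *: a) = c *: gpr gG j a.
Proof.
have mB : {morph (fun z : D => c *: z) : u v / u - v} by move=> u v; rewrite scalerBr.
have md i z : G i z -> G (i + 0) (c *: z) by rewrite addr0; exact: env_scaleG.
by have := gpr_degree gG gG mB md j a; rewrite addr0.
Qed.

Lemma gpr_linear j : linear (gpr gG j : D -> D).
Proof. by move=> c u v; rewrite raddfD /= gpr_scalar. Qed.

Lemma env_left_exists j : exists L : {linear E -> E}, forall a b, L (t a b) = t (gpr gG j a) b.
Proof.
have [_ univ _ _] := hE.
have bil : bilinear_map (fun a b => t (gpr gG j a) b).
  split=> [b|a] c u v; last exact: env_linr.
  by rewrite gpr_linear env_linl.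
by have [h [hT _]] := univ _ _ bil; exists h.
Qed.

Definition env_left j : {linear E -> E} := projT1 (cid (env_left_exists j)).
Lemma env_leftE j a b : env_left j (t a b) = t (gpr gG j a) b.
Proof. exact: (projT2 (cid (env_left_exists j))). Qed.

Lemma env_left_mul j r u v z : G r u ->
  env_left j (z * t u v) = env_left (j - r) z * t u v.
Proof.
move=> Gu; move: z; apply: (@env_ext _ (fun z => env_left j (z * t u v))
  (fun z => env_left (j - r) z * t u v)).
- by move=> l y z; rewrite mulrDl -scalerAl linearP.
- by move=> l y z; rewrite linearP mulrDl -scalerAl.
move=> a b; rewrite env_mul !env_leftE env_mul; congr (t _ _).
have mB : {morph (fun z : D => z * u) : y z / y - z} by move=> y z; rewrite mulrBl.
have md i z : G i z -> G (i + r) (z * u) by move=> Gz; exact: env_mulG.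
by rewrite -(gpr_degree gG gG mB md) subrK.
Qed.

Definition env_total_fun (N : int) (a b : D) : E :=
  \sum_(i <- gsupp gG a) t (gpr gG i a) (gpr gG (N - i) b).

Lemma env_totalE N a b (s : seq int) : uniq s -> {subset gsupp gG a <= s} ->
  env_total_fun N a b = \sum_(i <- s) t (gpr gG i a) (gpr gG (N - i) b).
Proof.
move=> us sub; apply: big_extend => // [|j jx]; first by case: (gprP gG a).
by rewrite (gpr_supp jx) env_0l.
Qed.

Lemma env_total_exists N : exists L : {linear E -> E}, forall a b, L (t a b) = env_total_fun N a b.
Proof.
have [_ univ _ _] := hE.
have bil : bilinear_map (env_total_fun N).
  split=> [b|a] c u v.
    pose s := undup (gsupp gG u ++ gsupp gG v ++ gsupp gG (c *: u + v)).
    rewrite !(@env_totalE N _ _ s) ?undup_uniq //;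
      try by (move=> j jx; rewrite mem_undup !mem_cat jx ?orbT).
    rewrite scaler_sumr -big_split; apply: eq_bigr => i _ /=.
    by rewrite gpr_linear env_linl.
  rewrite /env_total_fun scaler_sumr -big_split; apply: eq_bigr => i _ /=.
  by rewrite gpr_linear env_linr.
by have [h [hT _]] := univ _ _ bil; exists h.
Qed.

Definition env_total j : {linear E -> E} := projT1 (cid (env_total_exists j)).
Lemma env_total_t j a b : env_total j (t a b) = env_total_fun j a b.
Proof. exact: (projT2 (cid (env_total_exists j))). Qed.

Local Notation GE := (enveloping_grade G t).

Lemma env_grade_t r j a b : G r a -> G (j - r) b -> GE j (t a b).
Proof. by move=> Ga Gb; exists 1%N, (fun=> r), (fun=> a), (fun=> b); rewrite big_ord1. Qed.

Lemma env_grade0 j : GE j 0.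
Proof. by exists 0%N, (fun=> 0), (fun=> 0), (fun=> 0); split; [case | rewrite big_ord0]. Qed.

Lemma env_gradeB j u v : GE j u -> GE j v -> GE j (u - v).
Proof.
move=> [N [r [a [b [ab ->]]]]] [N' [r' [a' [b' [ab' ->]]]]].
exists (N + N')%N, (fun i => match split i with inl j => r j | inr j => r' j end),
  (fun i => match split i with inl j => a j | inr j => - a' j end),
  (fun i => match split i with inl j => b j | inr j => b' j end); split.
  move=> i; case: split => i'; first exact: ab.
  by have [Ga Gb] := ab' i'; split=> //; exact: (gradeN gG).
rewrite big_split_ord -sumrN; congr (_ + _); apply: eq_bigr => i _ /=.
  by rewrite split_lshift.
by rewrite split_rshift env_oppl.
Qed.

Lemma env_grade_sum (I : Type) (s : seq I) (P : pred I) (F : I -> E) j :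
  (forall i, P i -> GE j (F i)) -> GE j (\sum_(i <- s | P i) F i).
Proof.
move=> h; apply: big_ind => //; first exact: env_grade0.
move=> u v Gu Gv; rewrite -[v]opprK; apply: env_gradeB => //.
by rewrite -sub0r; apply: env_gradeB => //; exact: env_grade0.
Qed.

Lemma env_grading : is_grading GE.
Proof.
apply: (@is_grading_of_proj _ _ env_total).
- exact: env_grade0.
- exact: env_gradeB.
- by move=> j u v; rewrite linearB.
- move=> i j z [N [r [a [b [ab ->]]]]]; rewrite linear_sum /=.
  transitivity (\sum_(l < N) if j == i then t (a l) (b l) else 0); last first.
    by case: eqP => // _; rewrite big1.
  apply: eq_bigr => l _; have [Ga Gb] := ab l; rewrite env_total_t.
  rewrite (@env_totalE j _ _ (undup (r l :: gsupp gG (a l)))) ?undup_uniq //; last first.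
    by move=> i' ii; rewrite mem_undup inE ii orbT.
  rewrite (bigD1_seq (r l)) ?undup_uniq ?mem_undup ?inE ?eqxx //=.
  rewrite (gpr_id gG _ Ga) eqxx (gpr_id gG _ Gb) (inj_eq (addIr _)) big1 ?addr0.
    by case: eqP => // _; rewrite env_0r.
  by move=> i' /negbTE ii; rewrite (gpr_id gG _ Ga) ii env_0l.
- move=> j z; have [N [a [b ->]]] := env_span z; rewrite linear_sum.
  apply: env_grade_sum => l _; rewrite env_total_t; apply: env_grade_sum => i _.
  by apply: (env_grade_t (r := i)); exact: gpr_grade.
move=> z; suff [s sP] : exists s : seq int, forall u, uniq u -> {subset s <= u} ->
    z = \sum_(j <- u) env_total j z.
  by exists (undup s); apply: sP; rewrite ?undup_uniq // => j; rewrite mem_undup.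
have [N [a [b ->]]] := env_span z; elim: N a b => [|N IH] a b.
  by exists [::] => u _ _; rewrite big_ord0 big1 // => j _; rewrite linear0.
have [s sP] := IH (fun i => a (lift ord0 i)) (fun i => b (lift ord0 i)).
pose s' := [seq i + j | i <- gsupp gG (a ord0), j <- gsupp gG (b ord0)].
exists (s ++ s') => u uu su; rewrite big_ord_recl.
under [in RHS]eq_bigr => j _ do rewrite linearD /=.
rewrite big_split /=; congr (_ + _); last first.
  by apply: sP => // j js; apply: su; rewrite mem_cat js.
under [in RHS]eq_bigr => j _ do rewrite env_total_t.
rewrite exchange_big {1}(gpr_sum gG (a ord0)) env_suml.
apply: eq_big_seq => i ia /=; rewrite -env_sumr; congr (t _ _).
rewrite -(big_map (fun j => j - i) xpredT (fun j => gpr gG j (b ord0))).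
apply: gpr_big; first by rewrite map_inj_uniq //; exact: addIr.
move=> j jn; apply: gpr_supp; apply: contra jn => jb.
apply/mapP; exists (i + j); last by rewrite addrC addKr.
by apply: su; rewrite mem_cat orbC; apply/orP; left; apply/allpairsP; exists (i, j).
Qed.

Lemma env_graded : graded_ring GE.
Proof.
split; first exact: env_grading.
  rewrite -env_one; apply: (env_grade_t (r := 0)); rewrite ?subr0; by case: env_ring.
move=> i j u v [N [r [a [b [ab ->]]]]] [N' [r' [a' [b' [ab' ->]]]]].
rewrite mulr_suml; apply: env_grade_sum => l _; rewrite mulr_sumr.
apply: env_grade_sum => l' _; rewrite env_mul; have [Ga Gb] := ab l; have [Ga' Gb'] := ab' l'.
apply: (env_grade_t (r := r l + r' l')); first exact: env_mulG.
rewrite (_ : i + j - (r l + r' l') = (j - r' l') + (i - r l)); last by ring.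
exact: env_mulG.
Qed.

Definition env_fil (j : int) (z : E) := forall i, i < j -> env_left i z = 0.

(* Right multiplication by w preserves the filtration by left degree and acts on
   the associated graded module as 1 (x) R. *)
Definition leads (w : E) (R : D) := forall j z, env_fil j z ->
  env_fil j (z * w) /\ env_left j (z * w) = env_left j z * t 1 R.

Lemma leads_pos r u v : 0 < r -> G r u -> leads (t u v) 0.
Proof.
move=> r0 Gu j z Fz; split=> [i ij|].
  rewrite (env_left_mul _ _ _ Gu) Fz ?mul0r //; lia.
by rewrite (env_left_mul _ _ _ Gu) Fz ?mul0r ?env_0r ?mulr0 //; lia.
Qed.

Lemma leads_one v : leads (t 1 v) v.
Proof.
move=> j z Fz; have G1 : G 0 1 by case: env_ring.
split=> [i ij|]; last by rewrite (env_left_mul _ _ _ G1) subr0.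
by rewrite (env_left_mul _ _ _ G1) subr0 Fz ?mul0r.
Qed.

Lemma leads_lin c w R w' R' : leads w R -> leads w' R' -> leads (c *: w + w') (c *: R + R').
Proof.
move=> h h' j z Fz; have [F1 L1] := h j z Fz; have [F2 L2] := h' j z Fz.
rewrite mulrDr -scalerAr; split=> [i ij|].
  by rewrite linearP /= F1 // F2 // scaler0 addr0.
by rewrite linearP /= L1 L2 env_linr mulrDr -scalerAr.
Qed.

Lemma leads0 : leads 0 0.
Proof.
by move=> j z Fz; rewrite mulr0 env_0r mulr0 linear0; split=> // i _; rewrite linear0.
Qed.

Lemma leadsD w R w' R' : leads w R -> leads w' R' -> leads (w + w') (R + R').
Proof. by move=> h h'; rewrite -[w]scale1r -[R]scale1r; exact: leads_lin. Qed.

Lemma leadsZ c w R : leads w R -> leads (c *: w) (c *: R).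
Proof. by move=> h; rewrite -[c *: w]addr0 -[c *: R]addr0; apply: leads_lin => //; exact: leads0. Qed.

Lemma leadsM w R w' R' : leads w R -> leads w' R' -> leads (w * w') (R' * R).
Proof.
move=> h h' j z Fz; have [F1 L1] := h j z Fz; have [F2 L2] := h' j _ F1.
by rewrite mulrA; split=> //; rewrite L2 L1 -mulrA env_mul mulr1.
Qed.

Lemma env_fil0 z : env_fil 0 z.
Proof.
move=> i i0; have [N [a [b ->]]] := env_span z; rewrite linear_sum big1 // => l _.
by rewrite /= env_leftE (env_neg i0 (gpr_grade gG i _)) env_0l.
Qed.

(** Right degrees are nonnegative, so the left degree is at most the total degree. This makes the
    filtration finite in each total degree. *)
Lemma env_fil_bound j N z : GE N z -> N < j -> env_fil j z -> z = 0.
Proof.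
move=> Gz Nj Fz; suff [s ->] : exists s : seq int, z = \sum_(i <- s) env_left i z.
  rewrite big1 // => i _; have [ij|ji] := ltP i j; first exact: Fz.
  have [M [r [a [b [ab ->]]]]] := Gz; rewrite linear_sum big1 // => l _ /=.
  have [Ga Gb] := ab l; rewrite env_leftE (gpr_id gG _ Ga); case: eqP => [ir|_]; last exact: env_0l.
  by rewrite (env_neg _ Gb) ?env_0r // -ir; lia.
suff [s sP] : exists s : seq int, forall u, uniq u -> {subset s <= u} ->
    z = \sum_(i <- u) env_left i z.
  by exists (undup s); apply: sP; rewrite ?undup_uniq // => i; rewrite mem_undup.
have [M [a [b ->]]] := env_span z; elim: M a b => [|M IH] a b.
  by exists [::] => u _ _; rewrite big_ord0 big1 // => i _; rewrite linear0.
have [s sP] := IH (fun i => a (lift ord0 i)) (fun i => b (lift ord0 i)).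
exists (s ++ gsupp gG (a ord0)) => u uu su; rewrite big_ord_recl.
under [in RHS]eq_bigr => i _ do rewrite linearD /=.
rewrite big_split /=; congr (_ + _); last first.
  by apply: sP => // i ii; apply: su; rewrite mem_cat ii.
under [in RHS]eq_bigr => i _ do rewrite env_leftE.
rewrite -env_suml; congr (t _ _); apply: gpr_big => // i iu.
by apply: gpr_supp; apply: contra iu => ii; apply: su; rewrite mem_cat ii orbT.
Qed.

Section Lift.
Hypothesis basis : forall j : int, exists (R : nat) (b : 'I_R -> D) (la : 'I_R -> D -> k^o),
    [/\ forall a, G j (b a), forall a, linear (la a),
        forall a a', la a (b a') = (a == a')%:R
      & forall z, gpr gG j z = \sum_a (la a z : k) *: b a].
Variables (p1 p p2 : nat) (d1 : 'I_p1 -> int) (d : 'I_p -> int).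
Variables (D1 : 'M[E]_(p1, p)) (D2 : 'M[E]_(p, p2)) (R1 : 'I_p1 -> 'I_p -> D) (R2 : 'I_p -> 'I_p2 -> D).
Hypothesis D12 : D1 *m D2 = 0.
Hypothesis G1 : forall i j, GE (d1 i - d j) (D1 i j).
Hypothesis L1 : forall i j, leads (D1 i j) (R1 i j).
Hypothesis L2 : forall i j, leads (D2 i j) (R2 i j).
Hypothesis exR : forall N (c : 'I_p -> D), (forall i, G (N - d i) (c i)) ->
  (forall l, \sum_i R2 i l * c i = 0) ->
  exists2 c' : 'I_p1 -> D, forall i, G (N - d1 i) (c' i) & forall i, c i = \sum_l R1 l i * c' l.

(* The leading terms are corrected one left degree at a time: in left degree j,
   D (x) D is a finite sum of copies of the right factor, where exR applies. *)
Lemma env_exact N (z : 'rV[E]_p) : row_grade GE d N z -> z *m D2 = 0 ->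
  exists2 z', row_grade GE d1 N z' & z' *m D1 = z.
Proof.
(* h counts the left degrees, from j on, that are still to be corrected; the total degree bounds it
   from the start. *)
suff main : forall (h : nat) (j : int) (z : 'rV[E]_p), (forall i, N - d i < j + h%:Z) ->
    (forall i, env_fil j (z 0 i)) -> row_grade GE d N z -> z *m D2 = 0 ->
    exists2 z', row_grade GE d1 N z' & z' *m D1 = z.
  move=> Gz zD; apply: (main (\sum_i `|N - d i|).+1 0) => // i; last exact: env_fil0.
  rewrite (bigD1 i) //=; lia.
elim=> [|h IH] j {}z hj Fz Gz zD.
  exists 0; first by move=> i; rewrite mxE; exact: env_grade0.
  rewrite mul0mx; apply/rowP => i; rewrite mxE; apply/esym.
  by apply: (env_fil_bound (Gz i) _ (Fz i)); have := hj i; rewrite addr0.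
have [M [b [la [Gb lla lab gprE]]]] := basis j.
have /choice[L LE] := fun a => env_slice (lla a).
have leftE y : env_left j y = \sum_a t (b a) (L a y).
  move: y; apply: (@env_ext _ (env_left j) (fun y => \sum_a t (b a) (L a y))).
  - exact: linearP.
  - move=> c u v; rewrite scaler_sumr -big_split; apply: eq_bigr => a _ /=.
    by rewrite linearP env_linr.
  move=> u v; rewrite env_leftE gprE env_suml; apply: eq_bigr => a _.
  by rewrite LE env_scaler env_scalel.
have Ltb a a' c : L a (t (b a') c) = (a == a')%:R *: c by rewrite LE lab.
have Lleft a y : L a (env_left j y) = L a y.
  rewrite leftE linear_sum (bigD1 a) //= Ltb eqxx scale1r big1 ?addr0 // => a' aa.
  by rewrite Ltb eq_sym (negbTE aa) scale0r.
have GL a Q y : GE Q y -> G (Q - j) (L a y).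
  move=> [Q' [r [u [v [uv ->]]]]]; rewrite linear_sum; apply: (grade_sum gG) => i _ /=.
  have [Gu Gv] := uv i; rewrite -Lleft env_leftE (gpr_id gG _ Gu).
  case: eqP => [->|_]; last by rewrite env_0l linear0; exact: (grade0 gG).
  by rewrite LE; exact: env_scaleG.
have step a : exists2 c' : 'I_p1 -> D, forall i, G (N - j - d1 i) (c' i) &
    forall i, L a (z 0 i) = \sum_l R1 l i * c' l.
  apply: exR => [i|l].
    by rewrite (_ : N - j - d i = N - d i - j); [exact: GL (Gz i) | ring].
  transitivity (L a (env_left j ((z *m D2) 0 l))); last by rewrite zD mxE !linear0.
  rewrite mxE linear_sum linear_sum; apply: eq_bigr => i _.
  by rewrite /= (proj2 (L2 i l (Fz i))) (env_slice_mul (LE a)) Lleft.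
have /choice[c' c'P] : forall a, exists c' : 'I_p1 -> D, (forall i, G (N - j - d1 i) (c' i)) /\
    forall i, L a (z 0 i) = \sum_l R1 l i * c' l.
  by move=> a; have [c' Gc cE] := step a; exists c'.
pose z' : 'rV[E]_p1 := \row_i \sum_a t (b a) (c' a i).
have Gz' : row_grade GE d1 N z'.
  move=> i; rewrite mxE; apply: env_grade_sum => a _; apply: (env_grade_t (r := j)) => //.
  by rewrite (_ : N - d1 i - j = N - j - d1 i); [exact: (proj1 (c'P a)) | ring].
have leftz' i l : env_left i (z' 0 l) = if i == j then z' 0 l else 0.
  rewrite mxE linear_sum; transitivity (\sum_a if i == j then t (b a) (c' a l) else 0).
    apply: eq_bigr => a _; rewrite /= env_leftE (gpr_id gG _ (Gb a)).
    by case: eqP => // _; rewrite env_0l.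
  by case: eqP => // _; rewrite big1.
have Fz' l : env_fil j (z' 0 l) by move=> i ij; rewrite leftz' lt_eqF.
(* By the choice of c', the part of left degree j of z' D1 is that of z, so the difference lies in
   the next step of the filtration. *)
have [||||z2 Gz2 z2E] := IH (j + 1) (z - z' *m D1).
- by move=> i; have := hj i; lia.
- move=> i l lj; rewrite !mxE linearB /= linear_sum /=.
  have [lj'|lj'] := ltP l j.
    rewrite Fz // sub0r big1 ?oppr0 // => a _.
    exact: (proj1 (L1 a i (Fz' a))).
  have -> : l = j by lia.
  rewrite leftE; apply/eqP; rewrite subr_eq0; apply/eqP.
  under [in RHS]eq_bigr => a _ do rewrite (proj2 (L1 a i (Fz' a))) leftz' eqxx mxE mulr_suml.
  rewrite exchange_big; apply: eq_bigr => a _ /=.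
  rewrite (proj2 (c'P a)) env_sumr; apply: eq_bigr => a' _.
  by rewrite env_mul mulr1.
- move=> i; have -> : (z - z' *m D1) 0 i = z 0 i - (z' *m D1) 0 i by rewrite !mxE.
  apply: env_gradeB; first exact: Gz.
  by exact: (row_mul_grade env_graded G1 Gz').
- by rewrite mulmxBl zD -mulmxA D12 mulmx0 subrr.
exists (z2 + z'); last by rewrite mulmxDl z2E subrK.
by move=> i; rewrite mxE; apply: (gradeD env_grading).
Qed.

End Lift.
End Enveloping.

(** * Fox derivatives and the bimodule resolution *)

Definition deg2 (r1 r2 : nat) (a b : int) (i : 'I_(r1 + r2)) : int :=
  match split i with inl _ => a | inr _ => b end.

Lemma deg2l r1 r2 a b i : deg2 a b (lshift r2 i : 'I_(r1 + r2)) = a.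
Proof. by rewrite /deg2 split_lshift. Qed.
Lemma deg2r r1 r2 a b i : deg2 a b (rshift r1 i : 'I_(r1 + r2)) = b.
Proof. by rewrite /deg2 split_rshift. Qed.

Lemma env_gradeZ (k : fieldType) (D : algType k) (G : int -> D -> Prop)
    (hG : connected_graded G) (E : algType k) (t : D -> D -> E) (hE : enveloping t) c j z :
  enveloping_grade G t j z -> enveloping_grade G t j (c *: z).
Proof.
move=> Gz; rewrite -mulr_algl -[j]add0r; case: (env_graded hG hE) => _ _; apply=> //.
rewrite -(env_one hE) -(env_scalel hE); have [_ G1 _] := env_ring hG.
by apply: (env_grade_t t (r := 0)); [exact: env_scaleG | rewrite subr0].
Qed.

Section Fox.
Variables (k : fieldType) (n : nat) (T : word_algebra k n).
Variables (D : algType k) (pd : {lrmorphism T -> D}).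
Variables (E : algType k) (t : D -> D -> E).
Hypothesis hE : enveloping t.
Local Notation W := (@wa_word k n T).
Local Notation x := (wgen T).
Local Notation X i := (pd (wgen T i)).

Lemma env_lr a b : t a 1 * t 1 b = t a b.
Proof. by rewrite env_mul // mulr1 mulr1. Qed.
Lemma env_rl a b : t 1 b * t a 1 = t a b.
Proof. by rewrite env_mul // mul1r mul1r. Qed.
Lemma env_ll a b : t a 1 * t b 1 = t (a * b) 1.
Proof. by rewrite env_mul // mul1r. Qed.
Lemma env_rr a b : t 1 a * t 1 b = t 1 (b * a).
Proof. by rewrite env_mul // mul1r. Qed.

Variable psi : {linear T -> D}.
Hypotheses (psi1 : psi 1 = 1) (psiM : forall f g, psi (f * g) = psi f * psi g).

(* The derivation of TV into E, where TV acts on the left through pd and on the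
   right through psi, that sends x_l to 1 and the other generators to 0. *)
Definition der (l : 'I_n) : T -> E := wa_ext T (fix F s :=
  if s is i :: v then (i == l)%:R *: t 1 (psi (W v)) + t (X i) 1 * F v else 0).
HB.instance Definition _ l := GRing.Linear.on (der l).

Lemma der1 l : der l 1 = 0. Proof. by rewrite -wa_nil /der wa_extE. Qed.

Lemma der_genM l i f :
  der l (x i * f) = (i == l)%:R *: t 1 (psi f) + t (X i) 1 * der l f.
Proof.
move: f; apply: (@eq_on_words _ _ _ _ (fun f => der l (x i * f))) => [c f g|c f g|s].
- by rewrite mulrDr -scalerAr linearP.
- rewrite !linearP (env_linr hE) mulrDr !scalerDr -scalerAr !scalerA mulrC.
  by rewrite addrACA.
- by rewrite -wa_cons /der !wa_extE.
Qed.

Lemma der_gen l i : der l (x i) = (i == l)%:R%:A.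
Proof. by rewrite -[x i]mulr1 der_genM der1 mulr0 addr0 psi1 (env_one hE). Qed.

Lemma derM l f g : der l (f * g) = t (pd f) 1 * der l g + t 1 (psi g) * der l f.
Proof.
move: f; apply: (@eq_on_words _ _ _ _ (fun f => der l (f * g))
  (fun f => t (pd f) 1 * der l g + t 1 (psi g) * der l f)).
- by move=> c f h; rewrite mulrDl -scalerAl linearP.
- move=> c f h; rewrite !linearP (env_linl hE) mulrDl mulrDr scalerDr -scalerAl -scalerAr.
  by rewrite addrACA.
elim=> [|i s IH]; first by rewrite wa_nil mul1r der1 mulr0 addr0 rmorph1 (env_one hE) mul1r.
rewrite wa_cons -mulrA !der_genM IH psiM rmorphM !mulrDr -scalerAr env_rr.
by rewrite !mulrA env_ll env_lr env_rl addrCA.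
Qed.

(** Fox's fundamental formula. The right-hand side is itself a derivation for the twisted actions,
    and a derivation is determined by its values on the generators. *)
Lemma der_fundamental f :
  \sum_l der l f * (t (X l) 1 - t 1 (psi (x l))) = t (pd f) 1 - t 1 (psi f).
Proof.
move: f; apply: (@eq_on_words _ _ _ _ (fun f => \sum_l der l f * (t (X l) 1 - t 1 (psi (x l))))
  (fun f => t (pd f) 1 - t 1 (psi f))).
- move=> c f g; rewrite scaler_sumr -big_split; apply: eq_bigr => l _ /=.
  by rewrite linearP /= mulrDl -scalerAl.
- move=> c f g; rewrite !linearP (env_linl hE) (env_linr hE) scalerBr opprD.
  by rewrite addrACA.
elim=> [|i s IH].
  by rewrite wa_nil rmorph1 psi1 subrr big1 // => l _; rewrite der1 mul0r.
under eq_bigr => l _ do rewrite wa_cons der_genM mulrDl -scalerAl -mulrA.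
rewrite big_split /= -mulr_sumr IH.
rewrite (sum_delta i (fun l => t 1 (psi (W s)) * (t (X l) 1 - t 1 (psi (x l))))).
by rewrite !mulrBr env_rl env_rr env_ll env_lr wa_cons psiM rmorphM addrC addrA subrK.
Qed.

Variable G : int -> D -> Prop.
Hypothesis hG : connected_graded G.
Hypothesis pdG : forall d f, hgrade d f -> G d (pd f).
Hypothesis psiG : forall d f, hgrade d f -> G d (psi f).

Lemma G_gen i : G 1 (X i). Proof. by apply: pdG; exact: hgrade_gen. Qed.

(** The derivative of a word is a sum of prefix (x) suffix over the occurrences of x_l. Left degree
    0 means an empty prefix, so only an initial x_l counts. *)
Lemma leads_der l f : leads hG hE (der l f) (psi (lpart l f)).
Proof.
move: f; apply: wa_ind => [|c s f IH].
  by rewrite !linear0; exact: leads0.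
rewrite !linearP /=; apply: leads_lin IH; elim: s => [|i s IH].
  by rewrite wa_nil der1 lpart1 linear0; exact: leads0.
rewrite wa_cons der_genM lpart_genM linearZ /= -[_ *: psi _]addr0 -(mulr0 (psi (lpart l (W s)))).
apply: leadsD; first by apply: leadsZ; exact: leads_one.
by apply: leadsM => //; apply: (leads_pos 1 _ (G_gen i)).
Qed.

Lemma der_deg l d f : hgrade d f -> enveloping_grade G t (d - 1) (der l f).
Proof.
have G1 : G 0 1 by case: (env_ring hG).
move: f; apply: hgrade_ind => [|c s f sd IH]; first by rewrite linear0; exact: env_grade0.
rewrite linearP /=; apply: (gradeD (env_grading hG hE)) => //.
apply: (env_gradeZ hG hE); rewrite -sd; elim: s {sd} => [|i s IHs]; first by rewrite wa_nil der1; exact: env_grade0.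
rewrite wa_cons der_genM; apply: (gradeD (env_grading hG hE)).
  apply: (env_gradeZ hG hE); apply: (env_grade_t t (r := 0)) => //; rewrite subr0 /=.
  by rewrite intS addrC addKr; apply: psiG; exact: hgrade_word.
rewrite (_ : (size (i :: s))%:Z - 1 = 1 + ((size s)%:Z - 1)); last by rewrite /= intS addrA.
case: (env_graded hG hE) => _ _; apply=> //.
by apply: (env_grade_t t (r := 1)); rewrite ?subrr //; exact: G_gen.
Qed.

End Fox.

(** * The complex of free bimodules *)

Section BimoduleComplex.
Variables (k : fieldType) (n : nat) (T : word_algebra k n.+1) (m : nat).
Variables (w : T) (q p : 'I_n.+1 -> k).
Hypotheses (hm : (2 <= m)%N) (wd : hgrade m.+1 w) (q0 : forall i, q i != 0).
Hypothesis rw : forall i, rpart i w = q i *: lpart i w.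
Hypotheses (p0 : forall i, p i != 0) (pq : p ord0 = q ord0).
Local Notation x := (wgen T).
Local Notation z0 := (ord0 : 'I_n.+1).
Local Notation u := (sp_u w).
Local Notation N := (sp_N w).
Local Notation tau := (sp_tau p).
Variables (D : algType k) (pd : {lrmorphism T -> D}) (G : int -> D -> Prop).
Local Notation X i := (pd (x i)).
Local Notation Om := (pd (u z0)).
Hypothesis uE : forall i, pd (u i) = (i == z0)%:R *: Om.
Hypothesis commt : forall f, pd f * Om = Om * pd (tau f).
Hypothesis tau_u : forall i, tau (u i) = (p z0 / p i) *: u i.
Hypothesis hG : connected_graded G.
Hypothesis pdG : forall d f, hgrade d f -> G d (pd f).
Variables (E : algType k) (t : D -> D -> E).
Hypothesis hE : enveloping t.
Local Notation GE := (enveloping_grade G t).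

Lemma comm i : X i * Om = p i *: (Om * X i).
Proof. by rewrite commt sp_tau_gen linearZ /= scalerAr. Qed.

Definition bi (a : D) (c d : k) : E := c *: t a 1 + d *: t 1 a.

Lemma bi_scaleM a c d e z : bi a (e * c) (e * d) * z = e *: (bi a c d * z).
Proof. by rewrite scalerAl /bi scalerDr !scalerA. Qed.

(** The four conditions are the vanishing of the coefficients of Om x_i (x) 1, Om (x) x_i, x_i (x)
    Om and 1 (x) Om x_i. *)
Lemma bi_swap c c' d d' e e' f f' i :
  c * d + p i * (e * f) = 0 -> c * d' + e' * f = 0 ->
  c' * d + e * f' = 0 -> p i * (c' * d') + e' * f' = 0 ->
  bi Om c c' * bi (X i) d d' + bi (X i) e e' * bi Om f f' = 0.
Proof.
move=> h1 h2 h3 h4; rewrite /bi !mulrDl !mulrDr -!scalerAl -!scalerAr !scalerA.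
rewrite !(env_ll hE, env_lr hE, env_rl hE, env_rr hE) comm (env_scalel hE) (env_scaler hE) !scalerA.
set A := t (Om * X i) 1; set B := t Om (X i); set C := t (X i) Om; set F := t 1 (Om * X i).
transitivity ((c * d + p i * (e * f)) *: A + (c * d' + e' * f) *: B
   + (c' * d + e * f') *: C + (p i * (c' * d') + e' * f') *: F); last first.
  by rewrite h1 h2 h3 h4 !scale0r !addr0.
rewrite !scalerDl !(mulrC (p i)).
by rewrite [LHS](AC ((2 * 2) * (2 * 2)) ((((1 * 5) * (2 * 7)) * (3 * 6)) * (4 * 8))).
Qed.

Lemma pd_linear_id : linear pd. Proof. exact: linearP. Qed.
Definition pdl : {linear T -> D} := mklin pd_linear_id.
Lemma pd_tau_linear : linear (fun f => pd (tau f)).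
Proof. by move=> c f g; rewrite !linearP. Qed.
(** Moving Om to the left past f turns f into tau(f). Derivatives with this twist on the right
    therefore record the overlap of u_i with Om. *)
Definition pdt : {linear T -> D} := mklin pd_tau_linear.

Lemma pdl1 : pdl 1 = 1. Proof. exact: rmorph1. Qed.
Lemma pdlM f g : pdl (f * g) = pdl f * pdl g. Proof. exact: rmorphM. Qed.
Lemma pdt1 : pdt 1 = 1. Proof. by rewrite /= sp_tau1 rmorph1. Qed.
Lemma pdtM f g : pdt (f * g) = pdt f * pdt g. Proof. by rewrite /= sp_tauM rmorphM. Qed.

Local Notation W := (@wa_word k n.+1 T).
Local Notation Del := (der pd t pdl).
Local Notation Gd := (der pd t pdt).

Lemma pdt_u i : pdt (u i) = (i == z0)%:R *: Om.
Proof.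
rewrite /= tau_u linearZ /= uE scalerA; case: eqP => [->|_]; last by rewrite mulr0 scale0r.
by rewrite mulfV // mul1r.
Qed.

Lemma der_w_left (psi : {linear T -> D}) l :
  psi 1 = 1 -> (forall f g, psi (f * g) = psi f * psi g) ->
  der pd t psi l w = t 1 (psi (u l)) + \sum_i t (X i) 1 * der pd t psi l (u i).
Proof.
move=> psi1 psiM; rewrite {1}(sp_w_left wd) linear_sum /=.
under eq_bigr => i _ do rewrite (der_genM _ hE) eq_sym.
by rewrite big_split /= (sum_delta l (fun i => t 1 (psi (u i)))).
Qed.

Lemma der_w_right (psi : {linear T -> D}) l :
  psi 1 = 1 -> (forall f g, psi (f * g) = psi f * psi g) ->
  der pd t psi l w = q l *: t (pd (u l)) 1 + \sum_i q i *: (t 1 (psi (x i)) * der pd t psi l (u i)).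
Proof.
move=> psi1 psiM; rewrite {1}(sp_w_right wd rw) linear_sum /=.
under eq_bigr => i _.
  rewrite linearZ /= (derM _ hE psiM) (der_gen _ hE psi1) mulr_algr scalerDr scalerA mulrC -scalerA eq_sym.
  over.
by rewrite big_split /= (sum_delta l (fun i => q i *: t (pd (u i)) 1)).
Qed.

(* Commuting u_1 past a derivative exchanges the two twists. *)
Lemma der_bi l f : Gd l f * bi Om (- p l) 1 = t 1 Om * Del l f - t Om 1 * Del l (tau f).
Proof.
move: f; apply: (@eq_on_words _ _ _ _ (fun f => Gd l f * bi Om (- p l) 1)
  (fun f => t 1 Om * Del l f - t Om 1 * Del l (tau f))).
- by move=> c f g; rewrite linearP /= mulrDl -scalerAl.
- move=> c f g; rewrite !linearP /= !mulrDr scalerBr -!scalerAr opprD.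
  by rewrite addrACA.
elim=> [|i s IH]; first by rewrite wa_nil sp_tau1 !der1 !mulr0 mul0r subrr.
have h1 : t 1 (pdt (W s)) * bi Om (- p l) 1 =
    t 1 Om * t 1 (pd (W s)) - p l *: (t Om 1 * t 1 (pdt (W s))).
  rewrite /bi scale1r mulrDr -scalerAr (env_rl hE) (env_lr hE) !(env_rr hE) scaleNr addrC.
  by rewrite commt.
have h2 : t (X i) 1 * t Om 1 = p i *: (t Om 1 * t (X i) 1).
  by rewrite !(env_ll hE) comm (env_scalel hE).
have h3 : t (X i) 1 * t 1 Om = t 1 Om * t (X i) 1 by rewrite (env_lr hE) (env_rl hE).
have dp : (i == l)%:R * p l = p i * (i == l)%:R :> k.
  by case: eqP => [->|_]; rewrite ?mulr1 ?mul1r // mulr0 mul0r.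
rewrite wa_cons sp_tauM sp_tau_gen -scalerAl linearZ /= !(der_genM _ hE) mulrDl -mulrA IH.
rewrite -scalerAl h1 mulrBr !mulrA h3 h2 scalerBr scalerA dp scalerDr mulrDr.
rewrite [t Om 1 * (_ + _)]mulrDr -!scalerAr scalerA opprD !mulrA -scalerAl.
by rewrite addrACA.
Qed.

Definition bc_rk (i : nat) : nat :=
  match i with
  | 0 => 1 | 1 => n.+1 + 1 | 2 => n.+1 + n.+1 | 3 => 1 + n.+1 | 4 => 1 | _ => 0
  end%N.

Definition bc_deg (i : nat) : 'I_(bc_rk i) -> int :=
  match i return 'I_(bc_rk i) -> int with
  | 1%N => deg2 1 m
  | 2%N => deg2 m m.+1
  | 3%N => deg2 m.+1 (2 * m)%N
  | 4%N => fun=> (2 * m).+1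
  | _ => fun=> 0
  end.

(* C_1 has generators for the x_l and for Om, C_2 for the relations d_i w =
   delta_i1 Om and x_i Om = p_i Om x_i, C_3 for the two expressions of w as
   \sum_i x_i u_i and \sum_i q_i u_i x_i, and for tau(u_i) = (p_1 / p_i) u_i.
   Making Om a generator keeps all i on the same footing, at the cost of
   minimality. *)
Definition bc1 : 'M[E]_(n.+1 + 1, 1) :=
  col_mx (\col_l bi (X l) 1 (-1)) (\col_l bi Om 1 (-1)).
Definition bc2 : 'M[E]_(n.+1 + n.+1, n.+1 + 1) :=
  block_mx (\matrix_(i, l) Del l (u i)) (\col_i (- (i == z0)%:R)%:A)
    (\matrix_(i, l) ((i == l)%:R *: bi Om (- p i) 1)) (\col_i bi (X i) 1 (- p i)).
Definition bc3 : 'M[E]_(1 + n.+1, n.+1 + n.+1) :=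
  block_mx (\row_i bi (X i) 1 (- q i)) (\row_i (i == z0)%:R%:A)
    (\matrix_(i, j) ((i == j)%:R *: bi Om (p z0 / p i) (-1)))
    (\matrix_(i, l) Gd l (u i)).
Definition bc4 : 'M[E]_(1, 1 + n.+1) :=
  row_mx (\row_l bi Om (- p z0) 1) (\row_i bi (X i) 1 (- (p i * q i))).

Lemma bi_sub a : bi a 1 (-1) = t a 1 - t 1 a.
Proof. by rewrite /bi !scale1r scaleN1r. Qed.

Lemma bc21 : bc2 *m bc1 = 0.
Proof.
apply/eqP; rewrite /bc2 /bc1 mul_block_col col_mx_eq0; apply/andP; split; apply/eqP/colP => i.
  rewrite !mxE big_ord1 !mxE.
  under eq_bigr => l _ do rewrite !mxE bi_sub.
  rewrite (der_fundamental pd hE pdl1 pdlM) /= uE bi_sub (env_scalel hE) (env_scaler hE).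
  by rewrite mulr_algl scaleNr -scalerBr subrr.
rewrite !mxE big_ord1 !mxE.
under eq_bigr => l _ do rewrite !mxE -scalerAl.
rewrite (sum_delta i (fun l => bi Om (- p i) 1 * bi (X l) 1 (-1))).
by rewrite -[p i]mulr1 bi_swap //; ring.
Qed.

(** The derivative of w is computed from its expressions \sum_i x_i u_i and \sum_i q_i u_i x_i, and
    the results are equated. Stated for any twist, it serves [bc32] untwisted and [bc43] twisted by
    tau. *)
Lemma der_w_diff (psi : {linear T -> D}) l :
  psi 1 = 1 -> (forall f g, psi (f * g) = psi f * psi g) ->
  \sum_i (t (X i) 1 - q i *: t 1 (psi (x i))) * der pd t psi l (u i) =
  q l *: t (pd (u l)) 1 - t 1 (psi (u l)).
Proof.
move=> psi1 psiM; under eq_bigr => i _ do rewrite mulrBl -scalerAl.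
rewrite sumrB; apply/eqP; rewrite subr_eq addrAC eq_sym subr_eq; apply/eqP.
by rewrite -(der_w_right _ psi1 psiM) (der_w_left _ psi1 psiM) addrC.
Qed.

(** Over the four blocks, in order: the two expressions of w, the condition p_1 = q_1, the exchange
    of twists [der_bi], and Fox's formula for u_i with the twist. *)
Lemma bc32 : bc3 *m bc2 = 0.
Proof.
apply/eqP; rewrite /bc3 /bc2 mulmx_block block_mx_eq0; apply/and4P; split; apply/eqP/matrixP => i j.
- rewrite !mxE; transitivity (q j *: t (pd (u j)) 1 - t 1 (pd (u j)) + (j == z0)%:R *: bi Om (- p z0) 1).
    congr (_ + _).
      rewrite -(der_w_diff _ pdl1 pdlM); apply: eq_bigr => l _.
      by rewrite !mxE /bi scale1r scaleNr.
    under eq_bigr => l _ do rewrite !mxE mulr_algl.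
    by rewrite sum_delta0 eq_sym.
  rewrite uE (env_scalel hE) (env_scaler hE) scalerA mulrC -scalerA -scalerBr -scalerDr.
  case: eqP => [->|_]; last by rewrite scale0r.
  by rewrite -pq /bi !scale1r scaleNr addrACA subrr addrC addr0 addNr.
- rewrite !mxE; under eq_bigr => l _ do rewrite !mxE mulr_algr scaleNr.
  under [Z in _ + Z]eq_bigr => l _ do rewrite !mxE mulr_algl.
  by rewrite sumrN !sum_delta0 pq addNr.
- rewrite !mxE; under eq_bigr => l _ do rewrite !mxE -scalerAl.
  rewrite (sum_delta i (fun l => bi Om (p z0 / p i) (-1) * Del j (u l))).
  under [Z in _ + Z]eq_bigr => l _ do rewrite !mxE -scalerAr eq_sym.
  rewrite (sum_delta j (fun l => Gd l (u i) * bi Om (- p l) 1)) der_bi tau_u linearZ /=.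
  by rewrite /bi scaleN1r mulrBl -scalerAl -scalerAr addrA subrK subrr.
rewrite !mxE; under eq_bigr => l _ do rewrite !mxE -scalerAl.
rewrite (sum_delta i (fun l => bi Om (p z0 / p i) (-1) * (- (l == z0)%:R)%:A)) mulr_algr.
transitivity (- (i == z0)%:R *: bi Om (p z0 / p i) (-1) + (t (pd (u i)) 1 - t 1 (pdt (u i)))).
  congr (_ + _); rewrite -(der_fundamental pd hE pdt1 pdtM); apply: eq_bigr => l _.
  by rewrite !mxE /bi scale1r scaleNr /= sp_tau_gen [pd (_ *: _)]linearZ /= (env_scaler hE).
rewrite pdt_u (uE i) (env_scalel hE) (env_scaler hE) -scalerBr scaleNr addrC -scalerBr.
case: eqP => [->|_]; last by rewrite scale0r.
by rewrite mulfV // bi_sub subrr scaler0.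
Qed.

(** The first block is normality of Om; the second is the comparison of the two expressions of w,
    twisted by tau. *)
Lemma bc43 : bc4 *m bc3 = 0.
Proof.
apply/eqP; rewrite /bc4 /bc3 mul_row_block row_mx_eq0; apply/andP; split; apply/eqP/matrixP => i j.
  rewrite !mxE big_ord1 !mxE; under eq_bigr => l _ do rewrite !mxE -scalerAr eq_sym.
  rewrite (sum_delta j (fun l => bi (X l) 1 (- (p l * q l)) * bi Om (p z0 / p l) (-1))).
  by rewrite bi_swap //; field.
rewrite !mxE big_ord1 !mxE mulr_algr.
transitivity ((j == z0)%:R *: bi Om (- p z0) 1 + (q j *: t (pd (u j)) 1 - t 1 (pdt (u j)))).
  congr (_ + _); rewrite -(der_w_diff _ pdt1 pdtM); apply: eq_bigr => l _.
  rewrite !mxE /bi scale1r scaleNr /= sp_tau_gen [pd (_ *: _)]linearZ /= (env_scaler hE) scalerA.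
  by rewrite [q l * _]mulrC.
rewrite pdt_u (uE j) (env_scalel hE) (env_scaler hE) scalerA mulrC -scalerA -scalerBr -scalerDr.
case: eqP => [->|_]; last by rewrite scale0r.
by rewrite -pq /bi !scale1r scaleNr addrACA addNr subrr addr0.
Qed.

(** * Exactness through leading terms *)

Hypothesis pd_surj : forall a, exists f, pd f = a.
Local Notation Nd a i := (pd (N a i)).
Local Notation Nt a i := (pd (tau (N a i))).
Hypothesis exact1 : forall (b : 'I_n.+1 -> D) d a, (forall i, G d (b i)) ->
  \sum_i X i * b i = Om * a ->
  exists (c v : 'I_n.+1 -> D), [/\ forall i, G (d + 1 - m%:Z) (c i), forall i, G (d - m%:Z) (v i)
    & forall i, b i = \sum_j Nd i j * c j + Om * v i].
Hypothesis exact2 : forall (c : 'I_n.+1 -> D) d (b : 'I_n.+1 -> D), (forall i, G d (c i)) ->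
  (forall a, \sum_i Nd a i * c i = Om * b a) ->
  exists s v, [/\ G (d - 1) s, forall i, G (d - m%:Z) (v i)
    & forall i, c i = q i *: (X i * s) + Om * v i].
Hypothesis exact3 : forall c d (b : 'I_n.+1 -> D), G d c -> (forall i, X i * c = Om * b i) ->
  exists2 v, G (d - m%:Z) v & c = Om * v.
Hypothesis regular : forall d c, G d c -> Om * c = 0 -> c = 0.

Local Notation leads := (leads hG hE).

Lemma bc_X i : G 1 (X i). Proof. by apply: pdG; exact: hgrade_gen. Qed.
Lemma bc_Om : G m Om. Proof. by apply: pdG; exact: sp_u_deg. Qed.
Lemma bc_N a i : hgrade (m%:Z - 1) (N a i). Proof. exact: sp_N_deg. Qed.
Lemma bc_one : G 0 1. Proof. by case: (env_ring hG). Qed.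

Lemma bi_deg r a c d : G r a -> GE r (bi a c d).
Proof.
move=> Ga; apply: (gradeD (env_grading hG hE)); apply: (env_gradeZ hG hE).
  by apply: (env_grade_t t (r := r)); rewrite ?subrr //; exact: bc_one.
by apply: (env_grade_t t (r := 0)); rewrite ?subr0 //; exact: bc_one.
Qed.

Lemma bi_leads r a c d : 0 < r -> G r a -> leads (bi a c d) (d *: a).
Proof.
move=> r0 Ga; rewrite -[d *: a]add0r -(scaler0 _ c).
by apply: leads_lin; [exact: leads_pos Ga | apply: leadsZ; exact: leads_one].
Qed.

Lemma bi_leads_X i c d : leads (bi (X i) c d) (d *: X i).
Proof. by apply: bi_leads (bc_X i). Qed.
Lemma bi_leads_Om c d : leads (bi Om c d) (d *: Om).
Proof. by apply: bi_leads bc_Om; lia. Qed.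

Lemma leads_scal c : leads c%:A c%:A.
Proof. by apply: leadsZ; rewrite -{1}(env_one hE); exact: leads_one. Qed.

Lemma scal_deg r c : (c != 0 -> r = 0) -> GE r c%:A.
Proof.
have [-> _|cn r0] := eqVneq c 0; first by rewrite scale0r; exact: env_grade0.
rewrite r0 //; apply: (env_gradeZ hG hE); rewrite -(env_one hE).
by apply: (env_grade_t t (r := 0)); rewrite ?subr0; exact: bc_one.
Qed.

(** What is left of the [bc] matrices in left degree 0. Acting on columns by left multiplication,
    they give the complex of free right D-modules obtained from [bc] by tensoring with k on the
    left. *)
Definition br1 : 'M[D]_(n.+1 + 1, 1) := col_mx (\col_l ((-1) *: X l)) (\col_l ((-1) *: Om)).
Definition br2 : 'M[D]_(n.+1 + n.+1, n.+1 + 1) :=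
  block_mx (\matrix_(i, l) Nd l i) (\col_i (- (i == z0)%:R)%:A)
    (\matrix_(i, l) ((i == l)%:R *: (1 *: Om))) (\col_i ((- p i) *: X i)).
Definition br3 : 'M[D]_(1 + n.+1, n.+1 + n.+1) :=
  block_mx (\row_i ((- q i) *: X i)) (\row_i (i == z0)%:R%:A)
    (\matrix_(i, j) ((i == j)%:R *: ((-1) *: Om))) (\matrix_(i, l) Nt l i).
Definition br4 : 'M[D]_(1, 1 + n.+1) :=
  row_mx (\row_l (1 *: Om)) (\row_i ((- (p i * q i)) *: X i)).

Lemma bc_leads1 i j : leads (bc1 i j) (br1 i j).
Proof.
case: (split_ordP i) => {}i ->; rewrite /bc1 /br1 ?col_mxEu ?col_mxEd !mxE.
  exact: bi_leads_X.
exact: bi_leads_Om.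
Qed.

Lemma pdtG d f : hgrade d f -> G d (pdt f).
Proof. by move=> hf; apply: pdG; exact: sp_tau_deg. Qed.

Lemma bc_leads2 i j : leads (bc2 i j) (br2 i j).
Proof.
case: (split_ordP i) => {}i ->; case: (split_ordP j) => {}j ->; rewrite /bc2 /br2.
- by rewrite !block_mxEul !mxE; exact: (leads_der pdl pdG).
- by rewrite !block_mxEur !mxE; exact: leads_scal.
- by rewrite !block_mxEdl !mxE; apply: leadsZ; exact: bi_leads_Om.
- by rewrite !block_mxEdr !mxE; exact: bi_leads_X.
Qed.

Lemma bc_leads3 i j : leads (bc3 i j) (br3 i j).
Proof.
case: (split_ordP i) => {}i ->; case: (split_ordP j) => {}j ->; rewrite /bc3 /br3.
- by rewrite !block_mxEul !mxE; exact: bi_leads_X.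
- by rewrite !block_mxEur !mxE; exact: leads_scal.
- by rewrite !block_mxEdl !mxE; apply: leadsZ; exact: bi_leads_Om.
- by rewrite !block_mxEdr !mxE; exact: (leads_der pdt pdG).
Qed.

Lemma bc_leads4 i j : leads (bc4 i j) (br4 i j).
Proof.
case: (split_ordP j) => {}j ->; rewrite /bc4 /br4 ?row_mxEl ?row_mxEr !mxE.
  exact: bi_leads_Om.
exact: bi_leads_X.
Qed.

Definition bc_mat (i : nat) : 'M[E]_(bc_rk i.+1, bc_rk i) :=
  match i return 'M[E]_(bc_rk i.+1, bc_rk i) with
  | 0 => bc1 | 1 => bc2 | 2 => bc3 | 3 => bc4 | _ => 0%R
  end%N.

Lemma delta_deg r (b : bool) z : (b -> GE r z) -> GE r (b%:R *: z).
Proof.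
by case: b => [/(_ isT)|_]; rewrite ?scale1r // scale0r; exact: env_grade0.
Qed.

Lemma bc_mat_deg i a b : GE (bc_deg a - bc_deg b) (bc_mat i a b).
Proof.
case: i a b => [|[|[|[|i]]]] /=; last by move=> a b; rewrite mxE; exact: env_grade0.
- move=> a b; case: (split_ordP a) => {}a ->; rewrite /bc1 ?col_mxEu ?col_mxEd !mxE subr0.
    by rewrite deg2l; exact: bi_deg (bc_X a).
  by rewrite deg2r; exact: bi_deg bc_Om.
- move=> a b; case: (split_ordP a) => {}a ->; case: (split_ordP b) => {}b ->; rewrite /bc2 ?(deg2l, deg2r).
  + by rewrite block_mxEul mxE; apply: (der_deg hE hG pdG pdG); exact: sp_u_deg.
  + by rewrite block_mxEur mxE subrr; exact: scal_deg.
  + rewrite block_mxEdl mxE; apply: delta_deg => _.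
    by rewrite (_ : _ - _ = m%:Z); [exact: bi_deg bc_Om | lia].
  + by rewrite block_mxEdr mxE (_ : _ - _ = 1); [exact: bi_deg (bc_X a) | lia].
- move=> a b; case: (split_ordP a) => {}a ->; case: (split_ordP b) => {}b ->; rewrite /bc3 ?(deg2l, deg2r).
  + by rewrite block_mxEul mxE (_ : _ - _ = 1); [exact: bi_deg (bc_X b) | lia].
  + by rewrite block_mxEur mxE subrr; exact: scal_deg.
  + rewrite block_mxEdl mxE; apply: delta_deg => _.
    by rewrite (_ : _ - _ = m%:Z); [exact: bi_deg bc_Om | lia].
  + rewrite block_mxEdr mxE (_ : _ - _ = m%:Z - 1); last by lia.
    by apply: (der_deg hE hG pdG pdtG); exact: sp_u_deg.
- move=> a b; case: (split_ordP b) => {}b ->; rewrite /bc4 ?row_mxEl ?row_mxEr mxE ?(deg2l, deg2r).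
    by rewrite (_ : _ - _ = m%:Z); [exact: bi_deg bc_Om | lia].
  by rewrite (_ : _ - _ = 1); [exact: bi_deg (bc_X b) | lia].
Qed.

Hypothesis N_left : forall i, \sum_a X a * Nd a i = (i == z0)%:R *: Om.
Hypothesis mul_N : forall (c : 'I_n.+1 -> D) s v a, (forall i, c i = q i *: (X i * s) + Om * v i) ->
  \sum_i Nd a i * c i = Om * ((a == z0)%:R *: s + \sum_i Nt a i * v i).

Definition join2 (r1 r2 : nat) (a : 'I_r1 -> D) (b : 'I_r2 -> D) (i : 'I_(r1 + r2)) : D :=
  match split i with inl j => a j | inr j => b j end.
Lemma join2l r1 r2 (a : 'I_r1 -> D) (b : 'I_r2 -> D) j : join2 a b (lshift r2 j) = a j.
Proof. by rewrite /join2 split_lshift. Qed.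
Lemma join2r r1 r2 (a : 'I_r1 -> D) (b : 'I_r2 -> D) j : join2 a b (rshift r1 j) = b j.
Proof. by rewrite /join2 split_rshift. Qed.

Let dD j a b : G j a -> G j b -> G j (a + b).
Proof. by case: (env_ring hG) => gG _ _; exact: gradeD. Qed.
Let dN j a : G j a -> G j (- a).
Proof. by case: (env_ring hG) => gG _ _; exact: gradeN. Qed.
Let dS j (F : 'I_n.+1 -> D) : (forall i, G j (F i)) -> G j (\sum_i F i).
Proof. by case: (env_ring hG) => gG _ _ h; exact: (grade_sum gG). Qed.

(** [exact1] describes the x_l-coordinates; the coordinate at Om is then forced, since Om times the
    discrepancy is 0 and Om can be cancelled. [br_exact2] and [br_exact3] follow the same pattern,
    with [exact2] and [exact3]. *)
Lemma br_exact1 (d : int) (c : 'I_(n.+1 + 1) -> D) : (forall i, G (d - deg2 1 m i) (c i)) ->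
  (forall l, \sum_i br1 i l * c i = 0) ->
  exists2 c', forall i, G (d - deg2 m m.+1 i) (c' i) & forall i, c i = \sum_l br2 l i * c' l.
Proof.
move=> Gc /(_ ord0) c0; pose a i := c (lshift 1 i); pose e := c (rshift n.+1 ord0).
have sum0 : \sum_i X i * a i = Om * - e.
  move/eqP: c0; rewrite big_split_ord big_ord1 /= /br1 col_mxEd mxE -scalerAl [_ *: (Om * _)]scaleN1r subr_eq0.
  under eq_bigr => i _ do rewrite col_mxEu mxE -scalerAl scaleN1r.
  by rewrite sumrN => /eqP oE; rewrite mulrN -oE opprK.
have Ga i : G (d - 1) (a i) by have := Gc (lshift 1 i); rewrite deg2l.
have [f [v [Gf Gv aE]]] := exact1 Ga sum0.
have eE : e = - (f z0 + \sum_i p i *: (X i * v i)).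
  apply/eqP; rewrite -subr_eq0 opprK; apply/eqP.
  apply: (@regular (d - m%:Z)).
    apply: dD; first by have := Gc (rshift n.+1 ord0); rewrite deg2r.
    apply: dD; first by rewrite (_ : d - m%:Z = d - 1 + 1 - m%:Z) //; lia.
    apply: dS => i; apply: env_scaleG => //.
    rewrite (_ : d - m%:Z = 1 + (d - 1 - m%:Z)); last by lia.
    by apply: env_mulG => //; exact: bc_X.
  rewrite mulrDr -[Om * e]opprK -mulrN -sum0; apply/eqP; rewrite addrC subr_eq0; apply/eqP.
  under [in RHS]eq_bigr => i _ do rewrite aE mulrDr mulr_sumr.
  rewrite big_split exchange_big /= mulrDr mulr_sumr; congr (_ + _); last first.
    by apply: eq_bigr => i _; rewrite mulrA comm -scalerAl -scalerAr mulrA.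
  transitivity (\sum_j (j == z0)%:R *: (Om * f j)); first by rewrite sum_delta0.
  apply: eq_bigr => j _; rewrite scalerAl -N_left mulr_suml.
  by apply: eq_bigr => i _; rewrite mulrA.
exists (join2 f v) => i.
  case: (split_ordP i) => {}i ->; rewrite ?(deg2l, deg2r, join2l, join2r).
    by rewrite (_ : _ - _ = d - 1 + 1 - m%:Z) //; lia.
  by rewrite (_ : _ - _ = d - 1 - m%:Z) //; lia.
rewrite big_split_ord /=; case: (split_ordP i) => {}i ->.
  rewrite -/(a i) aE; congr (_ + _).
    by apply: eq_bigr => j _; rewrite join2l block_mxEul mxE.
  under eq_bigr => j _ do rewrite join2r block_mxEdl mxE scale1r eq_sym -scalerAl.
  by rewrite (sum_delta i (fun j => Om * v j)).
rewrite (ord1 i) -/e eE opprD; congr (_ + _).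
  under eq_bigr => j _ do rewrite join2l block_mxEur mxE mulr_algl scaleNr.
  by rewrite sumrN sum_delta0.
rewrite -sumrN; apply: eq_bigr => j _.
by rewrite join2r block_mxEdr mxE scaleNr mulNr scalerAl.
Qed.

Lemma br_exact2 (d : int) (c : 'I_(n.+1 + n.+1) -> D) : (forall i, G (d - deg2 m m.+1 i) (c i)) ->
  (forall l, \sum_i br2 i l * c i = 0) ->
  exists2 c', forall i, G (d - deg2 m.+1 (2 * m)%N i) (c' i) & forall i, c i = \sum_l br3 l i * c' l.
Proof.
move=> Gc c0; pose f i := c (lshift n.+1 i); pose g i := c (rshift n.+1 i).
have Gf i : G (d - m%:Z) (f i) by have := Gc (lshift n.+1 i); rewrite deg2l.
have sum0 a : \sum_i Nd a i * f i = Om * - g a.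
  have := c0 (lshift 1 a); rewrite big_split_ord /= /br2 => /eqP.
  under eq_bigr => i _ do rewrite block_mxEul mxE.
  under [Z in _ + Z]eq_bigr => i _ do rewrite block_mxEdl mxE scale1r eq_sym -scalerAl.
  by rewrite (sum_delta a (fun i => Om * g i)) addr_eq0 mulrN => /eqP.
have [s [v [Gs Gv fE]]] := exact2 Gf sum0.
have gE a : g a = - ((a == z0)%:R *: s + \sum_i Nt a i * v i).
  apply/eqP; rewrite -subr_eq0 opprK; apply/eqP; apply: (@regular (d - m.+1%:Z)).
    apply: dD; first by have := Gc (rshift n.+1 a); rewrite deg2r.
    apply: dD; first by apply: env_scaleG => //; rewrite (_ : _ - _ = d - m%:Z - 1) //; lia.
    apply: dS => i; rewrite (_ : _ - _ = (m%:Z - 1) + (d - m%:Z - m%:Z)); last by lia.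
    by apply: env_mulG => //; apply: pdtG; exact: bc_N.
  by rewrite mulrDr -(mul_N a fE) sum0 mulrN subrr.
exists (join2 (fun=> - s) (fun i => - v i)) => i.
  case: (split_ordP i) => {}i ->; rewrite ?(deg2l, deg2r, join2l, join2r); apply: dN.
    by rewrite (_ : _ - _ = d - m%:Z - 1) //; lia.
  by rewrite (_ : _ - _ = d - m%:Z - m%:Z) //; lia.
rewrite big_split_ord big_ord1 join2l /=; case: (split_ordP i) => {}i ->.
  rewrite -/(f i) fE block_mxEul mxE scaleNr mulrNN -scalerAl; congr (_ + _).
  under eq_bigr => j _ do rewrite join2r block_mxEdl mxE scaleN1r scalerN mulrNN eq_sym -scalerAl.
  by rewrite (sum_delta i (fun j => Om * v j)).
rewrite -/(g i) gE opprD block_mxEur mxE mulr_algl scalerN; congr (_ + _).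
by rewrite -sumrN; apply: eq_bigr => j _; rewrite join2r block_mxEdr mxE mulrN.
Qed.

Lemma br_exact3 (d : int) (c : 'I_(1 + n.+1) -> D) : (forall i, G (d - deg2 m.+1 (2 * m)%N i) (c i)) ->
  (forall l, \sum_i br3 i l * c i = 0) ->
  exists2 c' : 'I_1 -> D, forall i, G (d - (2 * m).+1%:Z) (c' i) & forall i, c i = \sum_l br4 l i * c' l.
Proof.
move=> Gc c0; pose e := c (lshift n.+1 ord0); pose h i := c (rshift 1 i).
have Xe i : q i *: (X i * e) = - (Om * h i).
  have := c0 (lshift n.+1 i); rewrite big_split_ord big_ord1 /= /br3 block_mxEul mxE => /eqP.
  under eq_bigr => j _ do rewrite block_mxEdl mxE scaleN1r scalerN eq_sym mulNr -scalerAl.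
  rewrite sumrN (sum_delta i (fun j => Om * h j)) scaleNr mulNr -scalerAl subr_eq0 => /eqP <-.
  by rewrite opprK.
have Ge : G (d - m.+1%:Z) e by have := Gc (lshift n.+1 ord0); rewrite deg2l.
have [i|v Gv eE] := exact3 (b := fun i => - ((q i)^-1 *: h i)) Ge.
  by rewrite mulrN -scalerAr -scalerN -Xe scalerA mulVf // scale1r.
have hE' i : h i = - (p i * q i) *: (X i * v).
  apply/eqP; rewrite scaleNr -subr_eq0 opprK; apply/eqP; apply: (@regular (d - (2 * m)%N%:Z)).
    apply: dD; first by have := Gc (rshift 1 i); rewrite deg2r.
    apply: env_scaleG => //; rewrite (_ : _ - _ = 1 + (d - m.+1%:Z - m%:Z)); last by lia.
    by apply: env_mulG => //; exact: bc_X.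
  rewrite mulrDr -[Om * h i]opprK -Xe eE mulrA comm -scalerAl -mulrA scalerA -scalerAr.
  by rewrite mulrC addNr.
exists (fun=> v) => [_|i]; first by rewrite (_ : _ - _ = d - m.+1%:Z - m%:Z) //; lia.
rewrite big_ord1 /br4; case: (split_ordP i) => {}i ->.
  by rewrite (ord1 i) row_mxEl mxE scale1r.
by rewrite row_mxEr mxE -scalerAl; exact: hE'.
Qed.

Hypothesis basis : forall (gG : is_grading G) (j : int),
  exists (R : nat) (b : 'I_R -> D) (la : 'I_R -> D -> k^o),
    [/\ forall a, G j (b a), forall a, linear (la a),
        forall a a', la a (b a') = (a == a')%:R
      & forall z, gpr gG j z = \sum_a (la a z : k) *: b a].
Variables (M : lmodType E) (theta : D -> M).
Hypothesis hM : diagonal_bimodule t theta.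

Definition diag_grade (j : int) (y : M) : Prop := exists2 a, G j a & theta a = y.

Lemma theta_scale a b : t a b *: theta 1 = theta (a * b).
Proof. by case: hM => _ _ ->; rewrite mulr1. Qed.

Lemma thetaD : {morph theta : x y / x + y}. Proof. by case: hM. Qed.
Lemma theta0 : theta 0 = 0. Proof. by apply: (addrI (theta 0)); rewrite -thetaD !addr0. Qed.
Lemma thetaB : {morph theta : x y / x - y}.
Proof. by move=> a b; apply: (addIr (theta b)); rewrite -thetaD !subrK. Qed.
Lemma theta_sum (I : Type) (s : seq I) (P : pred I) (F : I -> D) :
  theta (\sum_(i <- s | P i) F i) = \sum_(i <- s | P i) theta (F i).
Proof. exact: (big_morph _ thetaD theta0). Qed.

Lemma diag_graded : graded_module GE diag_grade.
Proof.
have [bij _ act] := hM; have [gG _ _] := env_ring hG; have [g gK Kg] := bij.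
have thinj : injective theta by exact: bij_inj.
split; last first.
  move=> i j z y [N' [r [a [b [ab ->]]]]] [c Gc <-].
  exists (\sum_l a l * c * b l).
    apply: (grade_sum gG) => l _; have [Ga Gb] := ab l.
    rewrite (_ : i + j = r l + j + (i - r l)); last by lia.
    by apply: env_mulG => //; exact: env_mulG.
  rewrite theta_sum scaler_suml; apply: eq_bigr => l _.
  by rewrite act.
split=> [j|j y y' [a Ga <-] [b Gb <-]|y|s c us Gc sum0 j js].
- by exists 0; rewrite ?theta0 //; exact: grade0.
- by exists (a - b); rewrite ?thetaB //; exact: gradeB.
- exists (gsupp gG (g y)), (fun j => theta (gpr gG j (g y))); split.
    by move=> j; exists (gpr gG j (g y)) => //; exact: gpr_grade.
  by rewrite -{1}[y]Kg {1}(gpr_sum gG (g y)) theta_sum.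
have /choice[a aE] : forall j, exists a, G j a /\ theta a = c j.
  by move=> i; have [a Ga aE] := Gc i; exists a.
rewrite -(proj2 (aE j)); case: gG => _ _ _ /(_ s a us) h.
rewrite h ?theta0 // => [i|]; first exact: (proj1 (aE i)).
apply: thinj; rewrite theta_sum theta0 -[RHS]sum0; apply: eq_bigr => i _.
exact: (proj2 (aE i)).
Qed.

Definition bc_mod (i : nat) : lmodType E := 'rV[E]_(bc_rk i).
Definition bc_diff i : {linear bc_mod i.+1 -> bc_mod i} := mklin (row_mul_linear (bc_mat i)).
Definition bc_aug_fun (z : bc_mod 0) : M := (z 0 0 : E) *: theta 1.
Lemma bc_aug_linear : linear bc_aug_fun.
Proof. by move=> a y z; rewrite /bc_aug_fun !mxE scalerDl scalerA. Qed.
Definition bc_aug : {linear bc_mod 0 -> M} := mklin bc_aug_linear.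

Lemma bc_mat_mul i : bc_mat i.+1 *m bc_mat i = 0.
Proof.
case: i => [|[|[|i]]] /=; [exact: bc21 | exact: bc32 | exact: bc43 |].
by rewrite mul0mx.
Qed.

Lemma bc_dd i z : bc_diff i (bc_diff i.+1 z) = 0.
Proof. by rewrite /= -mulmxA bc_mat_mul mulmx0. Qed.

Lemma bc_augd z : bc_aug (bc_diff 0 z) = 0.
Proof.
rewrite /= /bc_aug_fun mxE scaler_suml big1 // => l _; rewrite -scalerA.
suff -> : bc1 l 0 *: theta 1 = 0 by rewrite scaler0.
by case: (split_ordP l) => {}l ->; rewrite /bc1 ?col_mxEu ?col_mxEd mxE bi_sub scalerBl !theta_scale
  mulr1 mul1r subrr.
Qed.

Definition bc : aug_complex M := AugComplex bc_augd bc_dd.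
Definition bc_grade i : int -> bc i -> Prop := row_grade GE (@bc_deg i).

Lemma bc_graded : graded_complex GE diag_grade bc_grade.
Proof.
split.
- by move=> i; exact: (row_graded (env_graded hG hE)).
- move=> j z /(_ ord0); rewrite subr0 => Gz; rewrite -[j]addr0.
  have [_ act] := diag_graded; apply: act => //.
  by exists 1 => //; exact: bc_one.
- by move=> i j z; apply: row_mul_grade; [exact: (env_graded hG hE) | exact: bc_mat_deg].
Qed.

Lemma bc_proj i : projective (bc i).
Proof. exact: row_projective. Qed.

(** For \sum_i a_i (x) b_i in the kernel of multiplication, subtracting 1 (x) \sum_i a_i b_i = 0
    leaves multiples of the a_i (x) 1 - 1 (x) a_i, which are boundaries by Fox's formula. *)
Lemma bc_exact0 (z : bc_mod 0) : bc_aug z = 0 -> exists y, bc_diff 0 y = z.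
Proof.
rewrite /= /bc_aug_fun => z0'; have [bij _ _] := hM.
have gen a : exists y : 'rV[E]_(n.+1 + 1), (y *m bc1) 0 0 = t a 1 - t 1 a.
  have [f <-] := pd_surj a; exists (row_mx (\row_l Del l f) 0).
  rewrite /bc1 mul_row_col mul0mx addr0 mxE -(der_fundamental pd hE pdl1 pdlM).
  by apply: eq_bigr => l _; rewrite !mxE bi_sub.
have /choice[y yE] := gen.
have [r [a [b zE]]] := env_span hE (z 0 0).
exists (\sum_i t 1 (b i) *: y (a i)).
apply/matrixP => i j; rewrite !ord1 /= -[LHS]/((_ *m bc1) 0 0) mulmx_suml summxE zE.
have ab0 : \sum_i a i * b i = 0.
  apply: (bij_inj bij); rewrite theta_sum theta0.
  rewrite -[RHS]z0' zE scaler_suml; apply: eq_bigr => l _.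
  by rewrite theta_scale.
apply/eqP; rewrite -subr_eq0 -sumrB; apply/eqP.
transitivity (- t 1 (\sum_i a i * b i)); last by rewrite ab0 (env_0r hE) oppr0.
rewrite (env_sumr hE) -sumrN; apply: eq_bigr => l _.
by rewrite -scalemxAl mxE yE mulrBr (env_rl hE) (env_rr hE) addrC addKr.
Qed.

Lemma bc_exact : exact_below bc 5.
Proof.
split=> [y|_ z|i i4].
- have [bij _ act] := hM; have [g _ Kg] := bij.
  by exists (const_mx (t (g y) 1)); rewrite /= /bc_aug_fun mxE theta_scale mulr1.
- exact: bc_exact0.
have gC j : graded_module GE (@bc_grade j) by case: bc_graded.
apply: (exact_of_homog (gC i.+2) (gC i.+1) (gC i)); first by case: bc_graded => _ _; apply.
move=> N' z Gz dz.
suff [y _ yE] : exists2 y, row_grade GE (@bc_deg i.+2) N' y & y *m bc_mat i.+1 = z by exists y.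
case: i i4 z Gz dz => [|[|[|[|i]]]] //= _ z Gz dz.
- exact: (env_exact (basis _) bc21 (@bc_mat_deg 1) bc_leads2 bc_leads1 br_exact1 Gz dz).
- exact: (env_exact (basis _) bc32 (@bc_mat_deg 2) bc_leads3 bc_leads2 br_exact2 Gz dz).
- exact: (env_exact (basis _) bc43 (@bc_mat_deg 3) bc_leads4 bc_leads3 br_exact3 Gz dz).
(* Injectivity of the last map: the incoming module is 0, so [R1] has an empty index set, and the
   leading-term condition is the cancellation of Om. *)
apply: (env_exact (basis _) (mul0mx _ _) (@bc_mat_deg 4) (R1 := fun _ _ => 0) _ bc_leads4 _ Gz dz).
  by case.
move=> d c Gc c0; exists (fun=> 0) => [[]//|i]; rewrite big_ord0.
rewrite (ord1 i); apply: (regular (Gc ord0)); have := c0 (lshift n.+1 ord0).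
by rewrite big_ord1 /br4 row_mxEl mxE scale1r.
Qed.

(** * The Nakayama automorphism on generators *)

Variables (nu : {lrmorphism D -> D}) (P : proj_resolution M).
Variable GP : forall i, int -> P i -> Prop.
Arguments GP : clear implicits.
Local Notation GEo := (GE : int -> E^o -> Prop).
Hypothesis nuG : forall j a, G j a -> G j (nu a).
Hypothesis gP : graded_resolution GE diag_grade GP.
Variables (l : int) (phi : (P 4 -> E^o) -> D).
Hypothesis hphi : ext_iso GP GEo (fun j a => G (j + l) a) phi.
Hypothesis phiM : forall f a b, cocycle GP GEo f ->
  phi (fun z => (f z : E) * t a b) = nu b * phi f * a.

Lemma cocycle_mul (f : P 4 -> E^o) d e z : cocycle GP GEo f -> hom_deg GP GEo d f -> GE e z ->
  cocycle GP GEo (fun y => (f y : E) * z : E^o).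
Proof.
move=> [_ f0] [lf fd] Gz; split; last by move=> y; rewrite f0 mul0r.
have gE := regular_graded (env_graded hG hE).
suff h : hom_deg GP GEo (d + e) (fun y => (f y : E) * z : E^o) by exact: (hom_deg_graded gE h).
split; first by move=> a u' v; rewrite lf mulrDl -[a *: _]/((a : E) * _) -mulrA.
by move=> i y Gy; rewrite addrA; case: (env_graded hG hE) => _ _; apply=> //; exact: fd.
Qed.

Lemma env_homog_span z : exists (r : nat) (a b : 'I_r -> D) (d e : 'I_r -> int),
  [/\ forall i, G (d i) (a i), forall i, G (e i) (b i) & z = \sum_i t (a i) (b i)].
Proof.
have gE := env_grading hG hE.
pose S z := exists (r : nat) (a b : 'I_r -> D) (d e : 'I_r -> int),
  [/\ forall i, G (d i) (a i), forall i, G (e i) (b i) & z = \sum_i t (a i) (b i)].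
rewrite (gpr_sum gE z); apply: (big_ind S) => [|u' v|j _].
- by exists 0%N, (fun=> 0), (fun=> 0), (fun=> 0), (fun=> 0); split; [case | case | rewrite big_ord0].
- move=> [r [a [b [d [e [Ga Gb ->]]]]]] [r' [a' [b' [d' [e' [Ga' Gb' ->]]]]]].
  pose jn (V : Type) (f : 'I_r -> V) (f' : 'I_r' -> V) (i : 'I_(r + r')) :=
    match split i with inl j => f j | inr j => f' j end.
  exists (r + r')%N, (jn _ a a'), (jn _ b b'), (jn _ d d'), (jn _ e e'); split.
  + by move=> i; rewrite /jn; case: split.
  + by move=> i; rewrite /jn; case: split.
  by rewrite big_split_ord; congr (_ + _); apply: eq_bigr => i _; rewrite /jn ?split_lshift ?split_rshift.
have [r [d [a [b [ab E']]]]] := gpr_grade gE j z.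
exists r, a, b, d, (fun i => j - d i); split=> // i; exact: (proj1 (ab i)) || exact: (proj2 (ab i)).
Qed.

Theorem nakayama_gen i : nu (X i) = (p i * q i)^-1 *: X i.
Proof.
have gE := regular_graded (env_graded hG hE); have gEg := env_grading hG hE.
have [gP0 _ gPd] := gP; have [phiD phi0 phis phid] := hphi.
have [be [be_aug be_d] Gbe] : exists2 f : forall i, {linear P i -> bc i}, @chain_map _ _ (complex_of_res P) bc 5 f &
    forall i j z, GP i j z -> bc_grade j (f i z).
  by apply: (chain_lift_graded gEg diag_graded (X := complex_of_res P)) => //;
    [exact: pr_proj | exact: bc_graded | exact: bc_exact].
have [al [al_aug al_d]] : exists f, @chain_map _ _ bc (complex_of_res P) 5 f.
  by apply: (chain_lift (Y := complex_of_res P)); [exact: bc_proj | exact: res_exact].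
have be5 v : be 4%N (pr_diff P 4 v) = 0.
  by rewrite -(be_d 4%N) // /= mulmx0.
(* This cocycle is the pullback of the dual generator of the last term of [bc]; that term sits in
   degree 2m + 1, which explains the degree of [b4]. The element y of the overview is [phi b4]. *)
pose b4 v : E^o := (be 4%N v : 'rV[E]_1) 0 0.
have b4lin : linear b4 by move=> a u' v; rewrite /b4 linearP !mxE.
have b4deg : hom_deg GP GEo (- (2 * m).+1%:Z) b4.
  by split=> // j v Gv; exact: (Gbe 4%N j v Gv ord0).
have b4c : cocycle GP GEo b4.
  split; first exact: (hom_deg_graded gE b4deg).
  by move=> v; rewrite /b4 be5 mxE.
(* b4 times the entry x_i (x) 1 - p_i q_i 1 (x) x_i of the last map is a coordinate of be_3 composed
   with the differential, hence a coboundary. Applying phi gives the relation. *)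
have yX : phi b4 * X i = (p i * q i) *: (nu (X i) * phi b4).
  have c1 : cocycle GP GEo (fun v => (b4 v : E) * t (X i) 1 : E^o).
    apply: (cocycle_mul b4c b4deg (e := 1)); apply: (env_grade_t t (r := 1)); first exact: bc_X.
    by rewrite subrr; exact: bc_one.
  have c2 : cocycle GP GEo (fun v => (b4 v : E) * t 1 (- (p i * q i) *: X i) : E^o).
    apply: (cocycle_mul b4c b4deg (e := 1)); apply: (env_grade_t t (r := 0)); first exact: bc_one.
    by rewrite subr0; apply: env_scaleG => //; exact: bc_X.
  have cs : cocycle GP GEo ((fun v => (b4 v : E) * t (X i) 1 : E^o) \+
      (fun v => (b4 v : E) * t 1 (- (p i * q i) *: X i) : E^o)).
    exact: (cocycleD gE c1 c2).
  have : phi ((fun v => (b4 v : E) * t (X i) 1 : E^o) \+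
      (fun v => (b4 v : E) * t 1 (- (p i * q i) *: X i) : E^o)) = 0.
    apply/(phi0 _ cs).
    pose g v : E^o := (be 3%N v : 'rV[E]_(1 + n.+1)) 0 (rshift 1 i).
    have glin : linear g by move=> a u' v; rewrite /g linearP !mxE.
    apply: (cobound_ungraded gEg gP0 gE gPd (g := g)) => //; first by case: cs.
    move=> v; rewrite /g -(be_d 3%N) //= mxE big_ord1 row_mxEr mxE /bi scale1r mulrDr.
    by rewrite (env_scaler hE).
  rewrite (phiD _ _ c1 c2) !(phiM _ _ b4c) rmorph1 mul1r mulr1 linearZ /= -scalerAl scaleNr.
  by move=> /eqP; rewrite subr_eq0 => /eqP.
have [uu uuc uu1] := phis 1.
(* A cocycle of class 1 is cohomologous to -b4 zz: its values factor, up to homotopy, through the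
   single generator of the last term of [bc]. *)
pose zz : E := - uu (al 4%N (1%:M : 'rV[E]_1)).
have [s sP] : exists s, @homotopy_of _ _ (complex_of_res P) (complex_of_res P) 5
    (fun i v => al i (be i v) - v) s.
  apply: chain_homotopy.
  - exact: pr_proj.
  - exact: res_exact.
  - by move=> j a u' v; rewrite (linearP (be j)) (linearP (al j)) scalerBr opprD addrACA.
  - by move=> v; rewrite linearB al_aug be_aug subrr.
  - by move=> j j5 v; rewrite linearB al_d 1?ltnW // be_d // ltnW.
have [lu uud] := (graded_hom_linear (proj1 uuc), proj2 uuc).
have b4al v : al 4%N (be 4%N v) = (b4 v : E) *: al 4%N (1%:M : 'rV[E]_1).
  rewrite -linearZ /=; congr (al 4%N _); apply/rowP => j.
  by rewrite (ord1 j) !mxE mulr1n mulr1.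
have key v : (uu v : E) + (b4 v : E) * zz = - uu (s 3%N (pr_diff P 3 v)).
  rewrite /zz mulrN -[_ * uu _]/((b4 v : E) *: uu _) -[_ *: uu _](linearZ_LR (mklin lu)) /=.
  rewrite -b4al; have := proj2 sP 3%N isT v; move/eqP; rewrite subr_eq => /eqP ->.
  have uD a b : uu (a + b) = uu a + uu b by exact: (linearD (mklin lu) a b).
  by rewrite !uD uud add0r opprD addrCA subrr addr0.
have [r [a [b [d [e [Ga Gb zE]]]]]] := env_homog_span zz.
have ct j : cocycle GP GEo (fun v => (b4 v : E) * t (a j) (b j) : E^o).
  apply: (cocycle_mul b4c b4deg (e := d j + e j)).
  by apply: (env_grade_t t (r := d j)); rewrite // addrC addKr.
have [cz phiz] := ext_class_sum gE phi0 phiD (index_enum 'I_r) ct.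
have zfun : (fun v => \sum_j ((b4 v : E) * t (a j) (b j) : E^o)) = (fun v => (b4 v : E) * zz : E^o).
  by apply: funext => v; rewrite zE mulr_sumr.
have one : 1 + \sum_j nu (b j) * phi b4 * a j = 0.
  rewrite -uu1 -[RHS](_ : phi (uu \+ (fun v => (b4 v : E) * zz : E^o)) = 0).
    rewrite phiD //; last by rewrite -zfun.
    rewrite -zfun phiz; congr (_ + _); apply: eq_bigr => j _.
    by rewrite phiM.
  have cs : cocycle GP GEo (uu \+ (fun v => (b4 v : E) * zz : E^o)).
    by rewrite -zfun; exact: (cocycleD gE uuc cz).
  apply/(phi0 _ cs).
  have glin : linear (fun v => - uu (s 3%N v)).
    by move=> c u' v; rewrite linearP lu opprD -scalerN.
  by apply: (cobound_ungraded gEg gP0 gE gPd (g := fun v => - uu (s 3%N v))) => //; case: cs.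
have [gG G1 GM] := env_ring hG.
have Gy := phid _ _ b4c b4deg.
(* In 1 + \sum_j nu(b_j) y a_j = 0 a term of degree 0 forces y into degree at most 0, as a_j and b_j
   have nonnegative degree. If y had nonzero degree, it would vanish or leave the constant 1
   uncancelled. *)
have [e0|en] := eqVneq (- (2 * m).+1%:Z + l) 0; last first.
  have : gpr gG 0 (1 + \sum_j nu (b j) * phi b4 * a j) = 1.
    rewrite raddfD /= (gpr_id gG _ G1) eqxx raddf_sum big1 ?addr0 // => j _ /=.
    have Gt := GM _ _ _ _ (GM _ _ _ _ (nuG (Gb j)) Gy) (Ga j).
    rewrite (gpr_id gG _ Gt); case: eqP => // sum0.
    have [ej|ej] := ltP (e j) 0; first by rewrite (env_neg hG ej (Gb j)) rmorph0 !mul0r.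
    have [dj|dj] := ltP (d j) 0; first by rewrite (env_neg hG dj (Ga j)) mulr0.
    by rewrite (env_neg hG _ Gy) ?mulr0 ?mul0r //; move: en sum0 ej dj; lia.
  by rewrite one raddf0 => /esym/eqP; rewrite oner_eq0.
have [c yc] : exists c, phi b4 = c%:A.
  by case: hG => _ _ h; apply/h; rewrite -e0.
have cn : c != 0.
  apply/eqP => c0; move: one; rewrite big1 => [|j _].
    by rewrite addr0 => /eqP; rewrite oner_eq0.
  by rewrite yc c0 scale0r mulr0 mul0r.
move: yX; rewrite yc mulr_algl mulr_algr scalerA => yX.
have pq0 : p i * q i != 0 by rewrite mulf_neq0.
apply: (scalerI (mulf_neq0 pq0 cn)); rewrite -yX scalerA mulrC mulrA mulVf ?mul1r //.
Qed.

End BimoduleComplex.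

(** * Assembly, and return to the algebras of the statement *)

Lemma word_nakayama (k : fieldType) (n m : nat) (T : word_algebra k n.+1) (w : T)
    (q p : 'I_n.+1 -> k) (A D : algType k) (pi : {lrmorphism T -> A}) (pd : {lrmorphism T -> D})
    (GA : int -> A -> Prop) (GD : int -> D -> Prop) (nu : {lrmorphism D -> D}) (i : 'I_n.+1) :
  (2 <= m)%N -> hgrade m.+1 w -> (forall i, q i != 0) ->
  (forall i, rpart i w = q i *: lpart i w) -> (forall i, p i != 0) -> p ord0 = q ord0 ->
  presented pi (sp_u w) (fun=> m%:Z) GA -> AS_regular GA 3 ->
  presented pd (sp_rel w p) (sp_reldeg m) GD -> AS_regular GD 4 ->
  nakayama_automorphism GD 4 nu ->
  nu (pd (wgen T i)) = (p i * q i)^-1 *: pd (wgen T i).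
Proof.
move=> hm wd q0 rw p0 pq hA [_ _ _ [KA [eA [PA [GPA [hKA gPA vanA _]]]]]] hD.
move=> [_ [gd _] _ [K [e [P [GP [hK gP van [l extR]]]]]]] [_ nuG].
move=> [E [t [M [theta [P' [GP' [l' [phi [hE hM gP' hphi phiM]]]]]]]]].
have A3 c d (Gc : GA d c) (Xc : forall j, pi (wgen T j) * c = 0) : c = 0.
  exact: (ext0_socle hA hKA gPA (vanA 0%N isT) Gc Xc).
have A2 (a : 'I_n.+1 -> A) d (Ga : forall j, GA d (a j))
    (sum0 : forall s, \sum_j pi (rpart j (sp_u w s)) * a j = 0) :
    exists2 c, GA (d - 1) c & forall j, a j = pi (wgen T j) * c.
  exact: (ext1_column hA hKA gPA (vanA 1%N isT) Ga sum0).
have ext3 := van 3%N isT; have pdK := gd K.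
exact: (nakayama_gen hm wd q0 rw p0 pq (spD_uE hD) (spD_tau wd rw pq hD)
  (sp_tau_u hm wd q0 rw p0 pq hA A3 A2 hD hK gP extR ext3 pdK) (pres_conn hD) (pres_pi hD) hE
  (pres_surj hD) (spD_exact1 wd rw pq hA hD) (spD_exact2 hm wd q0 rw pq hA A2 hD)
  (spD_exact3 wd rw pq hA A3 hD) (spD_regular hm wd q0 rw p0 pq hA A3 A2 hD hK gP extR ext3 pdK)
  (spD_N_left hm wd hD) (spD_mul_N hm wd rw pq hD) (pres_deg_basis hD) hM nuG gP' hphi phiM i).
Qed.

Lemma presented_quotient (k : fieldType) (n p : nat) (T : word_algebra k n) (B : algType k)
    (pi : {lrmorphism T -> B}) (S : T -> Prop) (r : 'I_p -> T) (dr : 'I_p -> int)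
    (G : int -> B -> Prop) :
  (forall b, exists f, pi f = b) ->
  (forall f, pi f = 0 <-> exists (N : nat) (a s b : 'I_N -> T),
    (forall l, S (s l)) /\ f = \sum_l a l * s l * b l) ->
  (forall f, S f <-> exists i, f = r i) ->
  (forall i, hgrade (dr i) (r i)) -> (forall i, 0 < dr i) ->
  (forall j b, G j b <-> exists2 f, hgrade j f & pi f = b) -> connected_graded G ->
  presented pi r dr G.
Proof.
move=> surj ker SE rd r0 GE Gc; split=> // f; rewrite ker; split.
  move=> [N [a [s [b [Ss ->]]]]].
  have /choice[l lE] : forall i, exists j, s i = r j by move=> i; apply/SE.
  by exists N, a, b, l; apply: eq_bigr => i _; rewrite lE.
move=> [N [a [b [l ->]]]]; exists N, a, (fun i => r (l i)), b; split=> // i.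
by apply/SE; exists (l i).
Qed.

Lemma sp_rel_deg (k : fieldType) (n m : nat) (T : word_algebra k n.+1) (w : T) p i :
  hgrade m.+1 w -> hgrade (sp_reldeg m i) (sp_rel w p i).
Proof.
move=> wd; rewrite /sp_reldeg /sp_rel; case: split => j; first exact: sp_u_deg.
apply: hgradeB; last apply: hgradeZ.
  by rewrite (_ : m.+1%:Z = 1 + m%:Z); [apply: hgradeM (hgrade_gen _ _) _; exact: sp_u_deg | lia].
by rewrite (_ : m.+1%:Z = m%:Z + 1); [apply: hgradeM (hgrade_gen _ _); exact: sp_u_deg | lia].
Qed.

Lemma sp_relP (k : fieldType) (n : nat) (T : word_algebra k n.+1) (w : T) p f :
  (exists2 i, i != ord0 & f = lpart i w \/
     f = wgen T i * lpart ord0 w - p i *: (lpart ord0 w * wgen T i)) <->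
  exists i, f = sp_rel w p i.
Proof.
split=> [[i]|[i ->]].
  case: (unliftP ord0 i) => [j ->|->]; last by rewrite eqxx.
  move=> _ [->|->]; [exists (lshift n j) | exists (rshift n j)].
    by rewrite /sp_rel split_lshift.
  by rewrite /sp_rel split_rshift.
rewrite /sp_rel; case: split => j; exists (lift ord0 j); rewrite 1?eq_sym ?neq_lift //.
  by left.
by right.
Qed.

Theorem proposition3p14 (k : fieldType) (m n : nat) (hm : (2 <= m)%N)
    (q : 'rV[k]_n.+1) (w : tensor_alg k n.+1)
    (hw : twisted_superpotential (diag_mx q) m.+1 w)
    (A : algType k) (piA : {lrmorphism tensor_alg k n.+1 -> A})
    (hA : presents piA (rel_A w))
    (hAkoszul : koszul (quotient_grade piA) m)
    (hAreg : AS_regular (quotient_grade piA) 3)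
    (p : 'I_n.+1 -> k) (hp : forall i, p i != 0) (hpq : p ord0 = q 0 ord0)
    (D : algType k) (piD : {lrmorphism tensor_alg k n.+1 -> D})
    (hD : presents piD (rel_D w p))
    (hDreg : AS_regular (quotient_grade piD) 4)
    (nu : {lrmorphism D -> D})
    (hnu : nakayama_automorphism (quotient_grade piD) 4 nu)
    (i : 'I_n.+1) :
  nu (piD (gen k i)) = (p i * q 0 i)^-1 *: piD (gen k i).
Proof.
pose T := tv_words k n.+1.
have [Qu /tensor_gradeP wd rot] := hw.
have parts j := @rotation_parts k n.+1 T q m w j Qu wd rot.
have GE (B : algType k) (pi : {lrmorphism tensor_alg k n.+1 -> B}) j b :
    quotient_grade pi j b <-> exists2 f, @hgrade k n.+1 T j f & pi f = b.
  by split=> -[f /tensor_gradeP]; exists f.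
have pA : @presented k n.+1 n.+1 T A piA (sp_u (w : T)) (fun=> m%:Z) (quotient_grade piA).
  case: hA => surj ker; apply: (@presented_quotient _ _ _ T A piA (rel_A w)) => //.
  - by move=> j; exact: sp_u_deg.
  - by move=> _; exact: ltnW hm.
  - exact: GE.
  - by case: hAreg.
have pD : @presented k n.+1 (n + n) T D piD (sp_rel (w : T) p) (sp_reldeg m) (quotient_grade piD).
  case: hD => surj ker; apply: (@presented_quotient _ _ _ T D piD (rel_D w p)) => //.
  - exact: (sp_relP (w : T) p).
  - by move=> j; exact: sp_rel_deg.
  - by move=> j; rewrite /sp_reldeg; case: split => _ //; exact: ltnW hm.
  - exact: GE.
  - by case: hDreg.
exact: (word_nakayama i hm wd (fun j => proj1 (parts j)) (fun j => proj2 (parts j)) hp hpq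
  pA hAreg pD hDreg hnu).
Qed.
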